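(* Let $N\ge1$ be an integer, let $1<p<\infty$, let $(\mathbb R^N,|\cdot|,\mathcal L^N)$ be the Euclidean space with Lebesgue measure, let $(\rho_n)_n$ be mollifiers satisfying (M1)–(M3), and let $f\in W^{1,p}(\mathbb R^N)$. Then $$\lim_{n\to\infty}\int_{\mathbb R^N}\int_{\mathbb R^N}\frac{|f(x)-f(y)|^p}{|x-y|^p}\,\rho_n(x,y)\,dx\,dy=K_{p,N}\,\|\nabla f\|^p_{L^p},$$ where $$K_{p,N}:=\mathcal L^N(B_1^N)\,\frac1{\mathcal H^{N-1}(S_1^N)}\int_{S_1^N}|w\cdot v|^p\,d\mathcal H^{N-1}(v)$$ is a constant independent of the choice of $w\in S_1^N$, and $\mathcal L^N(B_1^N)=\pi^{N/2}/\Gamma(\tfrac N2+1)$.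
   Context: $B_1^N$ is the unit ball of $\mathbb R^N$ and $S_1^N$ denotes the unit sphere of $\mathbb R^N$ (boundary of $B_1^N$), $\mathcal H^{N-1}$ the surface measure. Mollifiers $\rho_n:\mathbb R^N\times\mathbb R^N\to[0,\infty)$: (M1) $\sup_x\sup_n\|\rho_n(x,\cdot)\|_{L^1(\mathcal L^N)}<\infty$. (M2) There are non-negative non-increasing functions $\tilde\rho_n$ with $\rho_n(x,y)=\tilde\rho_n(|x-y|)$. (M3) For every $\delta>0$, $\lim_n\int_0^\delta r^{N-1}\tilde\rho_n(r)\,dr=\frac1N$, and $\lim_n\int_{\{y:|x-y|\ge\delta\}}\rho_n(x,y)\,dy=0$ for every $x\in\mathbb R^N$. *)

(* Defs.v *)
From HB Require Import structures.
From mathcomp Require Import all_boot all_order all_algebra.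
From mathcomp Require Import all_classical all_reals all_analysis.

Set Implicit Arguments.
Unset Strict Implicit.
Unset Printing Implicit Defensive.

Import Order.TTheory GRing.Theory Num.Theory.
Import numFieldNormedType.Exports.

Local Open Scope classical_set_scope.
Local Open Scope ring_scope.

Section euclidean.
Context {R : realType} {n : nat}.
Implicit Types u v x : 'rV[R]_n.

Definition dot u v : R := \sum_(i < n) u ord0 i * v ord0 i.

(* The library's norm on 'rV[R]_n is the sup norm; it induces the same topology
   (used below for continuity, closure and compactness) but is not the
   Euclidean norm. *)
Definition enorm x : R := Num.sqrt (dot x x).

Definition unit_ball : set 'rV[R]_n := [set x | enorm x < 1].
Definition unit_sphere : set 'rV[R]_n := [set x | enorm x = 1].

End euclidean.

Definition rV_display : measure_display. Proof. exact. Qed.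

(* The product sigma-algebra on R^n, which is the Borel sigma-algebra. *)
Section measurable_rV.
Context {R : realType} {n : nat}.

Let coors (i : 'I_n) (x : 'rV[R]_n) : measurableTypeR R := x ord0 i.

Let rV_set0 : g_sigma_preimage coors set0.
Proof. exact: sigma_algebra0. Qed.

Let rV_setC A : g_sigma_preimage coors A -> g_sigma_preimage coors (~` A).
Proof. exact: sigma_algebraC. Qed.

Let rV_bigcup (F : _^nat) : (forall i, g_sigma_preimage coors (F i)) ->
  g_sigma_preimage coors (\bigcup_i (F i)).
Proof. exact: sigma_algebra_bigcup. Qed.

HB.instance Definition _ := @isMeasurable.Build rV_display
  'rV[R]_n (g_sigma_preimage coors) rV_set0 rV_setC rV_bigcup.

Lemma measurable_coor (i : 'I_n) :
  measurable_fun [set: 'rV[R]_n] (fun x => x ord0 i : measurableTypeR R).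
Proof.
move=> _ Y mY; rewrite setTI; apply: sub_sigma_algebra => /=.
rewrite -bigcup_seq/=; exists i => /=; first by rewrite mem_index_enum.
by exists Y => //; rewrite setTI.
Qed.

Lemma measurable_fun_rVP d (T : measurableType d) (f : T -> 'rV[R]_n) :
  measurable_fun [set: T] f <->
  forall i, measurable_fun [set: T] (fun t => f t ord0 i : measurableTypeR R).
Proof.
split=> [mf i|mf].
  exact: (measurableT_comp (measurable_coor i) mf).
move=> _ A mA; rewrite setTI.
suff: g_sigma_preimage coors `<=` [set B | measurable (f @^-1` B)] by exact.
apply: smallest_sub.
  split=> [|B /= mB|F /= mF]; rewrite /= ?preimage_set0//.
  - by rewrite setTD preimage_setC; exact: measurableC.
  - by rewrite preimage_bigcup; exact: bigcupT_measurable.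
move=> B; rewrite -bigcup_seq => -[i _ [C mC <-]]/=.
by have := mf i measurableT C mC; rewrite !setTI.
Qed.

End measurable_rV.

Section lebesgue_rV.
Context {R : realType}.

Definition rV_cons n (xv : measurableTypeR R * 'rV[R]_n) : 'rV[R]_n.+1 :=
  \row_(i < n.+1) if unlift ord0 i is Some j then xv.2 ord0 j else xv.1.

Definition rV_uncons n (v : 'rV[R]_n.+1) : measurableTypeR R * 'rV[R]_n :=
  (v ord0 ord0, \row_(j < n) v ord0 (lift ord0 j)).

Lemma rV_consK n : cancel (@rV_cons n) (@rV_uncons n).
Proof.
move=> [x v]; rewrite /rV_uncons mxE unlift_none; congr pair.
by apply/rowP => j; rewrite !mxE liftK.
Qed.

Lemma measurable_rV_cons n : measurable_fun [set: _] (@rV_cons n).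
Proof.
apply/measurable_fun_rVP => i; under eq_fun do rewrite mxE.
case: unliftP => [j _|_]; last exact: measurable_fst.
exact: (measurableT_comp (measurable_coor j) measurable_snd).
Qed.

Lemma measurable_rV_uncons n : measurable_fun [set: _] (@rV_uncons n).
Proof.
apply: measurable_fun_pair; first exact: measurable_coor.
apply/measurable_fun_rVP => i; under eq_fun do rewrite mxE.
exact: measurable_coor.
Qed.

Section step.
Context (n : nat) (m : {sigma_finite_measure set 'rV[R]_n -> \bar R}).

Let leb : {sigma_finite_measure set (measurableTypeR R) -> \bar R} :=
  @lebesgue_measure R.

Definition lebesgue_rV_step : set 'rV[R]_n.+1 -> \bar R :=
  pushforward (leb \x m)%E (@rV_cons n).

Let step0 : lebesgue_rV_step set0 = 0%E.
Proof. by rewrite /lebesgue_rV_step /pushforward preimage_set0 measure0. Qed.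

Let step_ge0 A : (0 <= lebesgue_rV_step A)%E.
Proof. by rewrite /lebesgue_rV_step /pushforward measure_ge0. Qed.

Let step_sigma_additive : semi_sigma_additive lebesgue_rV_step.
Proof.
move=> F mF tF mUF; rewrite /lebesgue_rV_step /pushforward preimage_bigcup.
apply: measure_semi_sigma_additive.
- by move=> k; rewrite -[X in measurable X]setTI; exact: measurable_rV_cons.
- apply/trivIsetP => /= i j _ _ ij; rewrite -preimage_setI.
  by move/trivIsetP : tF => /(_ _ _ _ _ ij) ->//; rewrite preimage_set0.
- by rewrite -preimage_bigcup -[X in measurable X]setTI; exact: measurable_rV_cons.
Qed.

HB.instance Definition _ := isMeasure.Build _ _ _ lebesgue_rV_step
  step0 step_ge0 step_sigma_additive.

Let step_sigma_finite : sigma_finite setT lebesgue_rV_step.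
Proof.
have /sigma_finiteP[F [TF ndF Foo]] := sigma_finiteT leb.
have /sigma_finiteP[G [TG ndG Goo]] := sigma_finiteT m.
exists (fun k => @rV_uncons n @^-1` (F k `*` G k)).
  rewrite -preimage_bigcup (_ : \bigcup_k _ = setT) ?preimage_setT//.
  rewrite -setXTT TF TG predeqE => -[x y]; split.
    by move=> [k _ []/= ? ?]; split; exists k.
  move=> [/= [i _ Fx] [k _ Gy]]; exists (maxn i k) => //; split.
    by move: x Fx; exact/subsetPset/ndF/leq_maxl.
  by move: y Gy; exact/subsetPset/ndG/leq_maxr.
move=> k; have [mF Fk] := Foo k; have [mG Gk] := Goo k; split.
  rewrite -[X in measurable X]setTI; apply: measurable_rV_uncons => //.
  exact: measurableX.
rewrite /lebesgue_rV_step /pushforward -comp_preimage.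
rewrite (_ : _ \o _ = id); last by apply/funext => x; exact: rV_consK.
by rewrite preimage_id product_measure1E// lte_mul_pinfty// ge0_fin_numE.
Qed.

HB.instance Definition _ := Measure_isSigmaFinite.Build _ _ _
  lebesgue_rV_step step_sigma_finite.

End step.

(* Lebesgue measure on R^n, as the n-fold product of the Lebesgue measure on R
   (on R^0, the unit mass of the point). *)
Fixpoint lebesgue_rV n : {sigma_finite_measure set 'rV[R]_n -> \bar R} :=
  match n with
  | 0%N => dirac (0 : 'rV[R]_0)
  | k.+1 => lebesgue_rV_step (lebesgue_rV k)
  end.

End lebesgue_rV.

Section gamma.
Context {R : realType}.

Definition Gamma (s : R) : R :=
  \int[lebesgue_measure]_(t in `]0, +oo[) (t `^ (s - 1) * expR (- t)).

(* pi^(s/2) / Gamma(s/2 + 1); the volume of the unit ball of R^s when s is a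
   natural number. *)
Definition ball_volume (s : R) : R := pi `^ (s / 2) / Gamma (s / 2 + 1).

Lemma Gamma_ge0 s : 0 <= Gamma s.
Proof.
apply: Rintegral_ge0 => t _.
by rewrite mulr_ge0// ?powR_ge0// expR_ge0.
Qed.

Lemma ball_volume_ge0 s : 0 <= ball_volume s.
Proof. by rewrite divr_ge0 ?powR_ge0 ?Gamma_ge0. Qed.

End gamma.

Section hausdorff.
Context {R : realType} {n : nat} (s : R).
Implicit Types (A B : set 'rV[R]_n) (C : (set 'rV[R]_n)^nat).
Local Open Scope ereal_scope.

Definition ediam A : \bar R :=
  ereal_sup [set (enorm (z.1 - z.2))%:E | z in A `*` A].

(* The case distinction matters only for s = 0, where x `^ 0 = 1. *)
Definition hausdorff_gauge A : \bar R :=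
  if A == set0 then 0
  else (ball_volume s)%:E * (ediam A * 2^-1%:E) `^ s.

Definition diam_cover (delta : R) A : set ((set 'rV[R]_n)^nat) :=
  [set C | A `<=` \bigcup_k C k /\ forall k, ediam (C k) <= delta%:E].

Definition hausdorff_content (delta : R) A : \bar R :=
  ereal_inf [set \sum_(k <oo) hausdorff_gauge (C k) | C in diam_cover delta A].

(* The s-dimensional Hausdorff outer measure, with the usual normalisation for
   which H^n = L^n on R^n. *)
Definition hausdorff A : \bar R :=
  ereal_sup [set hausdorff_content delta A | delta in [set d : R | (0 < d)%R]].

Lemma hausdorff_gauge_ge0 A : 0 <= hausdorff_gauge A.
Proof.
rewrite /hausdorff_gauge; case: ifP => // _.
by rewrite mule_ge0 ?poweR_ge0// lee_fin ball_volume_ge0.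
Qed.

Lemma hausdorff_content_ge0 delta A : 0 <= hausdorff_content delta A.
Proof.
apply: le_ereal_inf_tmp => _ [C _ <-].
by apply: nneseries_ge0 => k *; exact: hausdorff_gauge_ge0.
Qed.

Lemma hausdorff_content_le delta A : (0 < delta)%R ->
  hausdorff_content delta A <= hausdorff A.
Proof. by move=> d0; apply: ereal_sup_ubound; exists delta. Qed.

Lemma hausdorff_ge0 A : 0 <= hausdorff A.
Proof.
exact: le_trans (hausdorff_content_ge0 1 A) (hausdorff_content_le _ ltr01).
Qed.

Lemma hausdorff0 : hausdorff set0 = 0.
Proof.
apply/eqP; rewrite eq_le hausdorff_ge0 andbT.
apply: ge_ereal_sup => _ [d d0 <-]; apply: ereal_inf_lbound.
exists (fun=> set0); last by rewrite eseries0// => k *; rewrite /hausdorff_gauge eqxx.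
split => // k; rewrite /ediam set0X image_set0 ereal_sup0; exact: leNye.
Qed.

Lemma le_hausdorff : {homo hausdorff : A B / A `<=` B >-> A <= B}.
Proof.
move=> A B AB; apply: ge_ereal_sup => _ [d d0 <-].
apply: le_trans (hausdorff_content_le B d0).
apply: ereal_inf_le_tmp => _ [C [BC Cd] <-]; exists C => //.
by split=> //; exact: subset_trans BC.
Qed.

Lemma hausdorff_content_sigma_subadditive delta :
  sigma_subadditive (hausdorff_content delta).
Proof.
move=> A; have [[i ioo]|] := pselect (exists i, hausdorff_content delta (A i) = +oo).
  rewrite (eseries_pinfty _ _ ioo) ?leey// => k _.
  by rewrite -ltNye (lt_le_trans _ (hausdorff_content_ge0 _ _)).
rewrite -forallNE => Aoo.
apply/lee_addgt0Pr => _/posnumP[e].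
rewrite (le_trans _ (epsilon_trick _ _ _))//; last first.
  by move=> k; exact: hausdorff_content_ge0.
pose P k (B : (set 'rV[R]_n)^nat) := diam_cover delta (A k) B /\
  \sum_(j <oo) hausdorff_gauge (B j) <=
  hausdorff_content delta (A k) + (e%:num / (2 ^ k.+1)%:R)%:E.
have [G PG] : {G : ((set 'rV[R]_n)^nat)^nat & forall k, P k (G k)}.
  apply: (@choice _ _ P) => k.
  have en1 : (0 < e%:num / (2 ^ k.+1)%:R)%R by [].
  have Afin : hausdorff_content delta (A k) \is a fin_num.
    by rewrite ge0_fin_numE ?hausdorff_content_ge0// ltey; exact/eqP/Aoo.
  have [_ [B BA <-] /ltW BS] := lb_ereal_inf_adherent en1 Afin.
  by exists B.
have gG_ge0 x : 0 <= (hausdorff_gauge \o uncurry G) x.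
  exact: hausdorff_gauge_ge0.
apply: (@le_trans _ _ (\esum_(i in setT) (hausdorff_gauge \o uncurry G) i)).
  apply: ereal_inf_lbound => /=.
  have /card_esym/ppcard_eqP[f] := card_nat2.
  exists (uncurry G \o f).
    split => [t [i _ /(PG i).1.1[j _ Gt]]|k] /=; last first.
      by case: (f k) => i j; exact: (PG i).1.2.
    by exists (f^-1%FUN (i, j)) => //=; rewrite invK ?inE.
  rewrite -(esum_pred_image (hausdorff_gauge \o uncurry G) _ xpredT) ?[fun=> _]set_true//.
  by rewrite image_eq.
rewrite (_ : esum _ _ =
    \sum_(i <oo) \sum_(j <oo) hausdorff_gauge (G i j)); last first.
  pose J : nat -> set (nat * nat) := fun i => [set (i, j) | j in setT].
  rewrite (_ : setT = \bigcup_k J k); last first.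
    by rewrite predeqE => -[a b]; split => // _; exists a => //; exists b.
  rewrite esum_bigcupT /=; last 2 first.
    - apply/trivIsetP => i j _ _ ij.
      rewrite predeqE => -[k m] /=; split => //= -[] [_] _ [<-{k} _].
      by move=> [m' _] [] /esym/eqP; rewrite (negbTE ij).
    - by move=> /= [k m]; exact: hausdorff_gauge_ge0.
  rewrite -(image_id [set: nat]) -fun_true esum_pred_image//; last first.
    by move=> k _; apply: esum_ge0 => ? _; exact: gG_ge0.
  apply: eq_eseriesr => /= j _.
  rewrite -(esum_pred_image (hausdorff_gauge \o uncurry G) (pair j) predT)//=; last 2 first.
    by move=> k _; exact: hausdorff_gauge_ge0.
    by move=> ? ? _ _; exact: (@can_inj _ _ _ snd).
  by congr esum; rewrite predeqE => -[a b]; split; move=> [i _ <-]; exists i.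
apply: lee_nneseries => [k _ _|k _]; last exact: (PG k).2.
by apply: nneseries_ge0 => m *; exact: (gG_ge0 (k, m)).
Qed.

Lemma hausdorff_sigma_subadditive : sigma_subadditive hausdorff.
Proof.
move=> A; apply: ge_ereal_sup => _ [d d0 <-].
apply: le_trans (hausdorff_content_sigma_subadditive d A) _.
apply: lee_nneseries => [k _ _|k _]; first exact: hausdorff_content_ge0.
exact: hausdorff_content_le.
Qed.

HB.instance Definition _ := isOuterMeasure.Build R 'rV[R]_n hausdorff
  hausdorff0 hausdorff_ge0 le_hausdorff hausdorff_sigma_subadditive.

Definition hausdorff_outer : {outer_measure set 'rV[R]_n -> \bar R} := hausdorff.

(* Hausdorff measure on the sigma-algebra of Caratheodory-measurable sets. *)
Definition hausdorff_measure :
    {measure set (caratheodory_type hausdorff_outer) -> \bar R} :=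
  hausdorff_outer : set (caratheodory_type hausdorff_outer) -> \bar R.

End hausdorff.

Section sobolev.
Context {R : realType} {N : nat}.
Implicit Types (f g phi : 'rV[R]_N -> R).

Definition partial (i : 'I_N) phi : 'rV[R]_N -> R :=
  fun x => 'D_(delta_mx ord0 i) phi x.

Fixpoint is_Ck (k : nat) phi : Prop :=
  continuous phi /\
  if k is j.+1 then forall i : 'I_N,
    (forall x, derivable phi x (delta_mx ord0 i)) /\ is_Ck j (partial i phi)
  else True.

Definition test_function phi : Prop :=
  (forall k, is_Ck k phi) /\ compact (closure [set x | phi x != 0]).

Definition weak_partial (i : 'I_N) f g : Prop :=
  forall phi, test_function phi ->
    \int[lebesgue_rV N]_x (f x * partial i phi x) =
    - \int[lebesgue_rV N]_x (g x * phi x).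

(* f belongs to W^{1,p}(R^N) and Df is (a representative of) its weak
   gradient. *)
Definition sobolev_W1p (p : R) f (Df : 'rV[R]_N -> 'rV[R]_N) : Prop :=
  f \in Lfun (lebesgue_rV N) p%:E /\
  forall i, (fun x => Df x ord0 i) \in Lfun (lebesgue_rV N) p%:E /\
    weak_partial i f (fun x => Df x ord0 i).

End sobolev.

(* rhot n is the radial profile of rho n, a function on [0, +oo[: its values at
   negative reals are irrelevant. *)
Record mollifiers {R : realType} (N : nat)
    (rho : nat -> 'rV[R]_N -> 'rV[R]_N -> R) (rhot : nat -> R -> R) : Prop := {
  mollifier_ge0 : forall n x y, 0 <= rho n x y ;
  mollifier_L1_bounded :
    (ereal_sup (range (fun x => ereal_sup (range (fun n =>
       'N[lebesgue_rV N]_1[EFin \o rho n x])))) < +oo)%E ;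
  mollifier_profile_ge0 : forall n (r : R), 0 <= r -> 0 <= rhot n r ;
  mollifier_profile_nonincreasing :
    forall n (r s : R), 0 <= r -> r <= s -> rhot n s <= rhot n r ;
  mollifier_radial : forall n x y, rho n x y = rhot n (enorm (x - y)) ;
  mollifier_profile_cvg : forall delta : R, 0 < delta ->
    (\int[lebesgue_measure]_(r in `[0%R, delta]) (r ^+ N.-1 * rhot n r)%:E)%E
      @[n --> \oo] --> (N%:R^-1)%:E ;
  mollifier_tail_cvg : forall delta : R, 0 < delta -> forall x,
    (\int[lebesgue_rV N]_(y in [set y | (delta <= enorm (x - y))%R])
      (rho n x y)%:E)%E @[n --> \oo] --> 0%E }.

Definition K_const {R : realType} (p : R) (N : nat) (w : 'rV[R]_N) : \bar R :=
  (lebesgue_rV N unit_ball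
   * (hausdorff_measure (N.-1%:R : R) (unit_sphere : set 'rV[R]_N))^-1
   * \int[hausdorff_measure N.-1%:R]_(v in unit_sphere) (`|dot w v| `^ p)%:E)%E.

(* On the diagonal, a null set, the integrand is 0 because 0^-1 = 0. *)
Definition nonlocal_energy {R : realType} (p : R) (N : nat)
    (rho : 'rV[R]_N -> 'rV[R]_N -> R) (f : 'rV[R]_N -> R) : \bar R :=
  (\int[lebesgue_rV N]_y \int[lebesgue_rV N]_x
    (`|f x - f y| `^ p / enorm (x - y) `^ p * rho x y)%:E)%E.

(* Main.v *)
From HB Require Import structures.
From mathcomp Require Import all_boot all_order all_algebra.
From mathcomp Require Import all_classical all_reals all_analysis.
From mathcomp Require Import measurable_realfun.
From mathcomp Require Import ring lra.
Require Import Defs.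

(** With the substitution x = y + h, the energy becomes the integral of
    rhot n |h| * phi h, where phi h is the p-th power of the L^p norm of
    x |-> (f (x + h) - f x) / |h| ([nonlocal_energyE]). The proof has three
    ingredients.

    Sobolev functions are differentiable in L^p: the L^p norm of
    f (x + h) - f x - <h, Df x> is o(|h|) ([pnorm_remainder]). Along an axis,
    the increment of f is almost everywhere an average of the weak partial
    derivative over a segment ([increment_line]); this is obtained by testing
    the weak derivative against smooth functions supported in boxes, which
    suffice to determine a locally integrable function ([fundamental_lemma]).
    Jensen's inequality and the continuity of translations in L^p
    ([translation_continuousP]) then give the estimate along an axis, and a
    general h is reached by moving along one axis after another. Hence phi h is
    uniformly close, for small h, to psi h, the p-th power of the L^p norm of
    x |-> <h, Df x> / |h|.

    The function psi is homogeneous of degree 0, so integrating it against a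
    radial weight splits into a radial integral and the integral of psi over
    the unit ball ([polar_homogeneous]). The mollifiers concentrate at the
    origin with normalised radial mass, and phi is bounded away from the origin,
    so the energies converge to the integral of psi over the unit ball
    ([radial_limit]).

    Exchanging integrals, this limit is the integral over x of the integral
    over the ball of |<Df x, h>|^p / |h|^p, which scales like |Df x|^p
    ([gradient_energy_ball]). It remains to see that, for a unit vector w, the
    integral over the ball of |<w, h>|^p / |h|^p is the constant K_(p,N)
    ([K_constE]). Integrating |<v, h>|^p / |h|^p over v in the sphere and h in
    the ball, in both orders, this needs only that Lebesgue and Hausdorff
    measures are invariant under the reflections exchanging two unit vectors
    ([lebesgue_isometry], [hausdorff_isometry]), that Borel sets are
    Caratheodory measurable for the Hausdorff outer measure
    ([borel_caratheodory]), and that the sphere has positive finite measure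
    ([hausdorff_sphere_gt0], [hausdorff_sphere_lty]). The same invariance makes
    the constant independent of w. The volume of the ball comes from the
    Gaussian integral ([Gamma_layer_cake]). *)

Set Implicit Arguments.
Unset Strict Implicit.
Unset Printing Implicit Defensive.

Import Order.TTheory GRing.Theory Num.Theory.
Import numFieldNormedType.Exports.
Local Open Scope classical_set_scope.
Local Open Scope ring_scope.

(** * Boxes and Lebesgue measure on the n-dimensional space *)

Section boxes.
Context {R : realType} {n : nat}.
Implicit Types (a b x : 'rV[R]_n) (A : set 'rV[R]_n).

Definition box a b : set 'rV[R]_n :=
  [set x | forall i, a ord0 i < x ord0 i < b ord0 i].

Definition boxes : set (set 'rV[R]_n) := [set A | exists a b, A = box a b].

Lemma measurable_coor_setE (i : 'I_n) (C : set (measurableTypeR R)) :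
  measurable C -> measurable [set x : 'rV[R]_n | C (x ord0 i)].
Proof.
by move=> mC; rewrite -[X in measurable X]setTI; exact: measurable_coor.
Qed.

Lemma boxE a b :
  box a b = \bigcap_(i in [set: 'I_n]) [set x | `]a ord0 i, b ord0 i[%classic (x ord0 i)].
Proof.
apply/seteqP; split => x /= H i; first by move=> _; rewrite /= in_itv/= H.
by have /= := H i I; rewrite in_itv.
Qed.

Lemma measurable_box a b : measurable (box a b).
Proof.
rewrite boxE; apply: fin_bigcap_measurable => // i _.
apply: measurable_coor_setE; exact: measurable_itv.
Qed.

Lemma setI_closed_boxes : setI_closed boxes.
Proof.
move=> _ _ [a [b ->]] [c [d ->]].
exists (\row_i Num.max (a ord0 i) (c ord0 i)), (\row_i Num.min (b ord0 i) (d ord0 i)).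
apply/seteqP; split => x /= => [[H1 H2] i|H].
  by rewrite !mxE gt_max lt_min; have /andP[-> ->] := H1 i; have /andP[-> ->] := H2 i.
rewrite /box /= in H *.
by split=> i; move: (H i); rewrite !mxE gt_max lt_min => /andP[/andP[h1 h2]] /andP[h3 h4];
  rewrite ?h1 ?h2 ?h3 ?h4.
Qed.

Definition cube (r : R) : set 'rV[R]_n := box (const_mx (- r)) (const_mx r).

Lemma cubeP r x : cube r x <-> forall i, `|x ord0 i| < r.
Proof.
split=> H i; last by rewrite !mxE -ltr_norml H.
by have := H i; rewrite !mxE -ltr_norml.
Qed.

Lemma bigcup_cube : \bigcup_k cube k.+1%:R = setT.
Proof.
rewrite -subTset => x _.
have [k xk] : exists k : nat, forall i, `|x ord0 i| < k.+1%:R.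
  exists (\max_i Num.truncn `|x ord0 i|) => i.
  rewrite (lt_le_trans (truncnS_gt _))// ler_nat ltnS.
  exact: (leq_bigmax (F := fun i => Num.truncn `|x ord0 i|)).
by exists k => //; apply/cubeP.
Qed.

(** A slab constraining one coordinate is the increasing union of the boxes
    whose other edges are ]-k, k[, and such slabs generate the product sigma-
    algebra. *)
Lemma measurable_boxes : @measurable _ 'rV[R]_n = <<s boxes >>.
Proof.
apply/seteqP; split; last first.
  apply: smallest_sub; first exact: sigma_algebra_measurable.
  by move=> _ [a [b ->]]; exact: measurable_box.
apply: smallest_sub; first exact: smallest_sigma_algebra.
move=> B; rewrite -bigcup_seq => -[i _ [C mC <-]]; rewrite setTI.
pose c (x : 'rV[R]_n) : measurableTypeR R := x ord0 i.
have mBox A : boxes A -> <<s boxes >> A by exact: sub_sigma_algebra.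
suff Hg : @measurable _ (measurableTypeR R) `<=` [set D | <<s boxes >> (c @^-1` D)].
  exact: Hg.
have -> : @measurable _ (measurableTypeR R) = <<s @RGenOpens.G R >>.
  by have := @RGenOpens.measurableE R.
apply: smallest_sub.
  split=> [|A /= mA|F /= mF].
  - by rewrite /= preimage_set0; exact: sigma_algebra0.
  - by rewrite /= setTD preimage_setC -setTD; exact: sigma_algebraCD.
  - by rewrite /= preimage_bigcup; exact: sigma_algebra_bigcup.
move=> _ [l [r ->]] /=.
have -> : c @^-1` `]l, r[ = \bigcup_k
    box (\row_j if j == i then l else - k.+1%:R) (\row_j if j == i then r else k.+1%:R).
  apply/seteqP; split=> [x|x [k _ /(_ i)]]; rewrite /c /=; last first.
    by rewrite !mxE eqxx in_itv.
  rewrite in_itv/= => xlr.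
  have : setT x by [].
  rewrite -bigcup_cube => -[k _ /cubeP xk]; exists k => // j; rewrite !mxE.
  by case: eqP => [->//|_]; rewrite -ltr_norml.
apply: sigma_algebra_bigcup => k; apply: mBox.
by eexists; eexists.
Qed.

End boxes.

Section lebesgue_box.
Context {R : realType}.
Local Notation leb := (@lebesgue_rV R).
Local Open Scope ereal_scope.

Lemma ge0_integral_rV_cons n (f : 'rV[R]_n.+1 -> \bar R) :
  measurable_fun setT f -> (forall x, 0 <= f x) ->
  \int[leb n.+1]_x f x =
  \int[lebesgue_measure]_t \int[leb n]_v f (rV_cons (t, v)).
Proof.
move=> mf f0 /=.
rewrite ge0_integral_pushforward//; last exact: measurable_rV_cons.
rewrite preimage_setT fubini_tonelli1//=.
exact: measurableT_comp (@measurable_rV_cons R n).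
Qed.

Lemma lebesgue_rVS n (A : set 'rV[R]_n.+1) :
  leb n.+1 A = (lebesgue_measure \x leb n) (@rV_cons R n @^-1` A).
Proof. by []. Qed.

Definition rect n (A : 'I_n -> set R) : set 'rV[R]_n :=
  [set x | forall i, A i (x ord0 i)].

Lemma measurable_rect n (A : 'I_n -> set R) : (forall i, measurable (A i)) ->
  measurable (rect A).
Proof.
move=> mA.
have rectE : rect A = \bigcap_(i in [set: 'I_n]) [set x : 'rV[R]_n | A i (x ord0 i)].
  by apply/seteqP; split => x /= H i; [move=> _|]; apply: H.
rewrite rectE; apply: fin_bigcap_measurable => // i _.
exact: measurable_coor_setE (mA i).
Qed.

Lemma lebesgue_rect n (A : 'I_n -> set R) : (forall i, measurable (A i)) ->
  leb n (rect A) = \prod_(i < n) lebesgue_measure (A i).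
Proof.
elim: n A => [|n IH] A mA.
  by rewrite big_ord0 /= diracE mem_set// => -[].
rewrite lebesgue_rVS.
have -> : @rV_cons R n @^-1` rect A =
    A ord0 `*` rect (fun i => A (lift ord0 i)).
  apply/seteqP; split=> [[t v] /= H|[t v] [/= H1 H2] i].
    split=> [|i] /=; first by have := H ord0; rewrite mxE unlift_none.
    by have := H (lift ord0 i); rewrite !mxE liftK.
  by rewrite mxE /=; case: unliftP => [j|] -> /=; [exact: H2|].
rewrite product_measure1E; [|exact: mA|exact: measurable_rect].
by rewrite /= IH// big_ord_recl.
Qed.

Lemma lebesgue_box n (a b : 'rV[R]_n) :
  leb n (box a b) = (\prod_(i < n) Num.max 0 (b ord0 i - a ord0 i))%R%:E.
Proof.
have -> : box a b = rect (fun i => `]a ord0 i, b ord0 i[%classic).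
  by apply/seteqP; split=> x H i; have := H i; rewrite /= in_itv.
rewrite (lebesgue_rect (A := fun i => `]a ord0 i, b ord0 i[%classic))//.
rewrite -prodEFin; apply: eq_bigr => i _.
have := @lebesgue_measure_itv R `]a ord0 i, b ord0 i[.
rewrite /= lte_fin => ->; rewrite -EFinB; case: ltP => ?.
  by rewrite max_r// subr_ge0 ltW.
by rewrite max_l// subr_le0.
Qed.

Lemma lebesgue_box_lty n (a b : 'rV[R]_n) : leb n (box a b) < +oo.
Proof. by rewrite lebesgue_box ltry. Qed.

(** Boxes form a generating pi-system containing an exhaustion by cubes of
    finite measure. *)
Lemma lebesgue_rV_unique n (m : {measure set 'rV[R]_n -> \bar R}) :
  (forall a b, m (box a b) = leb n (box a b)) ->
  forall A, measurable A -> m A = leb n A.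
Proof.
move=> H A mA.
apply: (measure_unique boxes (fun k => cube k.+1%:R)) => //.
- exact: measurable_boxes.
- exact: setI_closed_boxes.
- by move=> i; eexists; eexists.
- exact: bigcup_cube.
- by move=> _ [a [b ->]].
- by move=> k; rewrite /cube [ltLHS]H lebesgue_box_lty.
Qed.

End lebesgue_box.

Section lebesgue_invariance.
Context {R : realType} {n : nat}.
Local Notation leb := (@lebesgue_rV R n).
Implicit Types (h x : 'rV[R]_n).

Lemma measurable_rVD d (T : measurableType d) (f g : T -> 'rV[R]_n) :
  measurable_fun setT f -> measurable_fun setT g ->
  measurable_fun setT (fun t => f t + g t).
Proof.
move=> /measurable_fun_rVP mf /measurable_fun_rVP mg.
apply/measurable_fun_rVP => i; under eq_fun do rewrite mxE.
exact: measurable_funD (mf i) (mg i).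
Qed.

Lemma measurable_rVZ d (T : measurableType d) (f : T -> R) (g : T -> 'rV[R]_n) :
  measurable_fun setT f -> measurable_fun setT g ->
  measurable_fun setT (fun t => f t *: g t).
Proof.
move=> mf /measurable_fun_rVP mg.
apply/measurable_fun_rVP => i; under eq_fun do rewrite mxE.
exact: measurable_funM mf (mg i).
Qed.

Lemma measurable_rVB d (T : measurableType d) (f g : T -> 'rV[R]_n) :
  measurable_fun setT f -> measurable_fun setT g ->
  measurable_fun setT (fun t => f t - g t).
Proof.
move=> mf mg; apply: measurable_rVD => //.
under eq_fun do rewrite -scaleN1r.
exact: measurable_rVZ.
Qed.

Lemma measurable_addrV h : measurable_fun setT (fun x : 'rV[R]_n => x + h).
Proof. by apply: measurable_rVD => //; exact: measurable_cst. Qed.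

Lemma measurable_scalerV (a : R) : measurable_fun setT (fun x : 'rV[R]_n => a *: x).
Proof. by apply: measurable_rVZ => //; exact: measurable_cst. Qed.

(** Reduces the invariance properties below to a computation on boxes. *)
Lemma lebesgue_rV_pushforward d (T : measurableType d)
    (m : {measure set T -> \bar R}) (f : T -> 'rV[R]_n) :
  measurable_fun setT f ->
  (forall a b, m (f @^-1` box a b) = leb (box a b)) ->
  forall A, measurable A -> m (f @^-1` A) = leb A.
Proof.
by move=> mf H A mA; rewrite -(lebesgue_rV_unique (m := pushforward m f)).
Qed.

Lemma ge0_integral_pushforwardT d d' (T : measurableType d) (T' : measurableType d')
    (m : {measure set T -> \bar R}) (m' : {measure set T' -> \bar R})
    (f : T -> T') (g : T' -> \bar R) :
  measurable_fun setT f ->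
  (forall A, measurable A -> m (f @^-1` A) = m' A) ->
  measurable_fun setT g -> (forall y, 0 <= g y)%E ->
  (\int[m]_x g (f x) = \int[m']_y g y)%E.
Proof.
move=> mf H mg g0.
rewrite -(@eq_measure_integral _ _ _ _ _ (pushforward m f))//; last first.
  by move=> A mA _; exact: H.
rewrite [RHS]ge0_integral_pushforward ?preimage_setT//.
Qed.

Lemma lebesgue_translation h (A : set 'rV[R]_n) : measurable A ->
  leb [set x | A (x + h)] = leb A.
Proof.
move: A; apply: (lebesgue_rV_pushforward (measurable_addrV h)) => a b.
have -> : (fun x : 'rV[R]_n => x + h) @^-1` box a b = box (a - h) (b - h).
  by apply/seteqP; split=> x /= H i; have := H i; rewrite !mxE => /andP[? ?];
    apply/andP; split; lra.
rewrite /= !lebesgue_box; congr (_%:E); apply: eq_bigr => i _; rewrite !mxE.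
by congr Num.max; ring.
Qed.

Lemma lebesgue_scale (r : R) (A : set 'rV[R]_n) : 0 < r -> measurable A ->
  leb [set x | A (r *: x)] = ((r ^- n)%:E * leb A)%E.
Proof.
move=> r0 mA; have rn0 : 0 <= r ^+ n by rewrite exprn_ge0// ltW.
pose m := mscale (NngNum rn0) leb.
have <- : m [set x | A (r *: x)] = leb A.
  apply: (lebesgue_rV_pushforward (m := m) (measurable_scalerV r)) => // a b.
  rewrite /m /mscale /=.
  have -> : (fun x : 'rV[R]_n => r *: x) @^-1` box a b = box (r^-1 *: a) (r^-1 *: b).
    apply/seteqP; split=> x /= H i; have := H i; rewrite !mxE.
      by rewrite ltr_pdivrMl// ltr_pdivlMl.
    by rewrite ltr_pdivrMl// ltr_pdivlMl.
  rewrite /mscale/= !lebesgue_box -EFinM; congr (_%:E).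
  have -> : r ^+ n = \prod_(i < n) r by rewrite prodr_const card_ord.
  rewrite -big_split/=; apply: eq_bigr => i _; rewrite !mxE -mulrBr maxr_pMr ?ltW//.
  by rewrite mulr0 mulrA divff ?mul1r ?gt_eqF.
by rewrite /m /mscale/= muleA -EFinM mulVf ?mul1e// gt_eqF// exprn_gt0.
Qed.

Local Open Scope ereal_scope.

Lemma ge0_integral_translation h (f : 'rV[R]_n -> \bar R) :
  measurable_fun setT f -> (forall x, 0 <= f x) ->
  \int[leb]_x f (x + h)%R = \int[leb]_x f x.
Proof.
apply: ge0_integral_pushforwardT; first exact: measurable_addrV.
exact: lebesgue_translation.
Qed.

Lemma ge0_integral_scale (r : R) (f : 'rV[R]_n -> \bar R) : (0 < r)%R ->
  measurable_fun setT f -> (forall x, 0 <= f x) ->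
  (r ^+ n)%:E * \int[leb]_x f (r *: x)%R = \int[leb]_x f x.
Proof.
move=> r0 mf f0; have rn0 : (0 <= r ^+ n)%R by rewrite exprn_ge0// ltW.
rewrite -[LHS](ge0_integral_mscale leb measurableT (NngNum rn0))//; last first.
  exact: measurableT_comp mf (measurable_scalerV r).
apply: ge0_integral_pushforwardT => // [|A mA]; first exact: measurable_scalerV.
rewrite /= /mscale/= lebesgue_scale// muleA -EFinM mulfV ?mul1e//.
by rewrite gt_eqF// exprn_gt0.
Qed.

End lebesgue_invariance.

(** * Euclidean norm, reflections and isometric invariance *)

Section enorm_theory.
Context {R : realType} {n : nat}.
Implicit Types (u v w x y z : 'rV[R]_n) (a : R).

Lemma dotC x y : dot x y = dot y x.
Proof. by apply: eq_bigr => i _; rewrite mulrC. Qed.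

Lemma dotDl x y z : dot (x + y) z = dot x z + dot y z.
Proof. by rewrite /dot -big_split; apply: eq_bigr => i _; rewrite mxE mulrDl. Qed.

Lemma dotZl a x y : dot (a *: x) y = a * dot x y.
Proof. by rewrite /dot mulr_sumr; apply: eq_bigr => i _; rewrite mxE mulrA. Qed.

Lemma dotDr x y z : dot x (y + z) = dot x y + dot x z.
Proof. by rewrite dotC dotDl ![dot _ x]dotC. Qed.

Lemma dotZr a x y : dot x (a *: y) = a * dot x y.
Proof. by rewrite dotC dotZl dotC. Qed.

Lemma dotNl x y : dot (- x) y = - dot x y.
Proof. by rewrite -scaleN1r dotZl mulN1r. Qed.

Lemma dotNr x y : dot x (- y) = - dot x y.
Proof. by rewrite dotC dotNl dotC. Qed.

Lemma dot0l x : dot 0 x = 0.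
Proof. by rewrite -(scale0r 0) dotZl mul0r. Qed.

Definition dotE := (dotDl, dotDr, dotNl, dotNr, dotZl, dotZr).

Lemma dot_ge0 x : 0 <= dot x x.
Proof. by apply: sumr_ge0 => i _; rewrite -expr2 sqr_ge0. Qed.

Lemma dot_eq0 x : (dot x x == 0) = (x == 0).
Proof.
rewrite psumr_eq0 => [|i _]; last by rewrite -expr2 sqr_ge0.
apply/idP/idP; last first.
  by move=> /eqP ->; apply/allP => i _; rewrite mxE mulr0 eqxx.
move=> /allP H; apply/eqP/rowP => i; rewrite mxE; apply/eqP.
by have := H i (mem_index_enum i); rewrite -expr2 sqrf_eq0.
Qed.

Lemma enorm_ge0 x : 0 <= enorm x. Proof. exact: sqrtr_ge0. Qed.

Lemma enorm_sqr x : enorm x ^+ 2 = dot x x.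
Proof. by rewrite sqr_sqrtr// dot_ge0. Qed.

Lemma enorm_eq0 x : (enorm x == 0) = (x == 0).
Proof. by rewrite -dot_eq0 -enorm_sqr sqrf_eq0. Qed.

Lemma enorm0 : enorm (0 : 'rV[R]_n) = 0.
Proof. by apply/eqP; rewrite enorm_eq0. Qed.

Lemma enorm_gt0 x : (0 < enorm x) = (x != 0).
Proof. by rewrite lt0r enorm_eq0 enorm_ge0 andbT. Qed.

Lemma enormZ a x : enorm (a *: x) = `|a| * enorm x.
Proof.
by rewrite /enorm dotZl dotZr mulrA -expr2 sqrtrM ?sqr_ge0// sqrtr_sqr.
Qed.

Lemma enormN x : enorm (- x) = enorm x.
Proof. by rewrite -scaleN1r enormZ normrN1 mul1r. Qed.

Lemma enormB x y : enorm (x - y) = enorm (y - x).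
Proof. by rewrite -enormN opprB. Qed.

Lemma cauchy_schwarz x y : `|dot x y| <= enorm x * enorm y.
Proof.
rewrite -(ler_pXn2r (ltn0Sn 1)) ?nnegrE ?mulr_ge0 ?enorm_ge0//.
rewrite exprMn !enorm_sqr real_normK ?num_real//.
have [/eqP|y0] := eqVneq (dot y y) 0.
  by rewrite dot_eq0 => /eqP ->; rewrite dotC dot0l expr0n/= mulr_ge0 ?dot_ge0.
(* this vector is the rejection of x from y, up to the factor |y|^2 *)
have := dot_ge0 (dot y y *: x - dot x y *: y).
rewrite !dotE (dotC y x).
set a := dot x x; set b := dot x y; set c := dot y y => H.
have c0 : 0 < c by rewrite lt0r y0 dot_ge0.
rewrite -(ler_pM2l c0); nra.
Qed.

Lemma enormD x y : enorm (x + y) <= enorm x + enorm y.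
Proof.
rewrite -(ler_pXn2r (ltn0Sn 1)) ?nnegrE ?addr_ge0 ?enorm_ge0//.
rewrite sqrrD !enorm_sqr !dotE (dotC y x).
have := le_trans (ler_norm _) (cauchy_schwarz x y); lra.
Qed.

Lemma enormBD x y z : enorm (x - z) <= enorm (x - y) + enorm (y - z).
Proof. by rewrite (le_trans _ (enormD _ _))// addrA subrK. Qed.

Lemma coor_le_enorm x i : `|x ord0 i| <= enorm x.
Proof.
rewrite -sqrtr_sqr ler_sqrt ?dot_ge0// /dot (bigD1 i)//= -expr2 lerDl.
by apply: sumr_ge0 => j _; rewrite -expr2 sqr_ge0.
Qed.

Lemma enorm_le_sum x : enorm x <= \sum_i `|x ord0 i|.
Proof.
have s0 (s : seq 'I_n) : 0 <= \sum_(i <- s) `|x ord0 i| by apply: sumr_ge0.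
rewrite -(ler_pXn2r (ltn0Sn 1)) ?nnegrE ?enorm_ge0// enorm_sqr /dot.
elim: (index_enum _) => [|i s IH]; first by rewrite !big_nil expr0n.
rewrite !big_cons sqrrD real_normK ?num_real// -expr2 -addrA lerD2l.
by rewrite (le_trans IH)// lerDr mulrn_wge0// mulr_ge0.
Qed.

Lemma measurable_dot d (T : measurableType d) (f g : T -> 'rV[R]_n) :
  measurable_fun setT f -> measurable_fun setT g ->
  measurable_fun setT (fun t => dot (f t) (g t)).
Proof.
move=> /measurable_fun_rVP mf /measurable_fun_rVP mg.
apply: (@measurable_sum _ _ _ _ _ _ (fun i t => f t ord0 i * g t ord0 i)) => i.
exact: measurable_funM (mf i) (mg i).
Qed.

Lemma measurable_enorm_comp d (T : measurableType d) (f : T -> 'rV[R]_n) :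
  measurable_fun setT f -> measurable_fun setT (fun t => enorm (f t)).
Proof.
move=> mf; apply: (@measurableT_comp _ _ _ _ _ _ (@Num.sqrt R)).
  apply: continuous_measurable_fun; exact: sqrt_continuous.
exact: measurable_dot.
Qed.

Lemma measurable_enorm : measurable_fun setT (@enorm R n).
Proof. exact: measurable_enorm_comp. Qed.

Definition ball0 (r : R) : set 'rV[R]_n := [set x | enorm x < r].

Lemma measurable_ball0 r : measurable (ball0 r).
Proof.
have := measurable_enorm measurableT (measurable_itv `]-oo, r[%R).
by rewrite setTI; congr measurable; apply/seteqP; split=> x; rewrite /= in_itv.
Qed.

(** Householder reflection. These explicit involutive isometries replace
    general rotations, because one of them maps any unit vector to any other
    one. *)
Definition reflect_along u x : 'rV[R]_n := x - (2 * dot u x / dot u u) *: u.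

Lemma reflect_alongD u : {morph reflect_along u : x y / x + y}.
Proof.
by move=> x y; rewrite /reflect_along dotDr mulrDr mulrDl scalerDl opprD addrACA.
Qed.

Lemma reflect_alongK u : u != 0 -> involutive (reflect_along u).
Proof.
rewrite -dot_eq0 => u0 x; rewrite /reflect_along !dotE -addrA -opprD -scalerDl.
rewrite [X in X *: u](_ : _ = 0) ?scale0r ?subr0//.
by field.
Qed.

Lemma dot_reflect u x y : u != 0 ->
  dot (reflect_along u x) (reflect_along u y) = dot x y.
Proof.
by rewrite -dot_eq0 => u0; rewrite /reflect_along !dotE (dotC x u); field.
Qed.

Lemma enorm_reflect u x : u != 0 -> enorm (reflect_along u x) = enorm x.
Proof. by move=> u0; rewrite /enorm dot_reflect. Qed.

Lemma measurable_reflect u : measurable_fun setT (reflect_along u).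
Proof.
apply: measurable_rVB => //; apply: measurable_rVZ => //.
apply: measurable_funM => //; apply: measurable_funM => //.
by apply: measurable_dot => //; exact: measurable_cst.
Qed.

Lemma reflect_unit w w' : enorm w = 1 -> enorm w' = 1 -> w != w' ->
  reflect_along (w - w') w = w'.
Proof.
move=> w1 w'1 ww'; have := ww'; rewrite -subr_eq0 -dot_eq0 => u0.
rewrite /reflect_along [X in X *: _](_ : _ = 1) ?scale1r.
  by rewrite opprB addrCA subrr addr0.
apply: (mulIf u0); rewrite mul1r divfK// !dotE -!enorm_sqr w1 w'1 (dotC w' w).
by ring.
Qed.

End enorm_theory.

Section lebesgue_isometry.
Context {R : realType} {n : nat}.
Local Notation leb := (@lebesgue_rV R n).
Local Open Scope ereal_scope.

Lemma lebesgue_ball_lty (r : R) : leb (ball0 r) < +oo.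
Proof.
apply: (le_lt_trans _ (lebesgue_box_lty (const_mx (- r)%R) (const_mx r))).
apply: le_measure; rewrite ?inE; [exact: measurable_ball0|exact: measurable_box|].
move=> x /= xr; apply/cubeP => i.
exact: le_lt_trans (coor_le_enorm _ _) xr.
Qed.

Lemma lebesgue_ball_gt0 (r : R) : (0 < r)%R -> 0 < leb (ball0 r).
Proof.
move=> r0; pose e : R := (r / n.+1%:R)%R.
have e0 : (0 < e)%R by rewrite divr_gt0.
apply: (@lt_le_trans _ _ (leb (cube e))).
  rewrite lebesgue_box lte_fin; apply: prodr_gt0 => i _; rewrite !mxE.
  by rewrite lt_max; apply/orP; right; lra.
apply: le_measure; rewrite ?inE; [exact: measurable_box|exact: measurable_ball0|].
move=> x /cubeP xe; rewrite /ball0 /=; apply: le_lt_trans (enorm_le_sum _) _.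
apply: (@le_lt_trans _ _ (\sum_(i < n) e)%R).
  by apply: ler_sum => i _; exact/ltW.
rewrite sumr_const card_ord -mulr_natr /e mulrAC ltr_pdivrMr//.
by rewrite ltr_pM2l// ltr_nat.
Qed.

Lemma unit_ballE : @unit_ball R n = ball0 1. Proof. by []. Qed.

(** Let B be the unit ball and integrate 1_A (T x + y) * 1_B y over x and y.
    Integrating in x first gives |T^-1 A| |B|, since T x + y = T (x + T y).
    Translating y by T x and then integrating in x first gives |A| |B|, since
    the norm of y - T x is that of x - T y. As |B| is positive and finite, the
    two measures agree. *)
Lemma lebesgue_isometry (T : 'rV[R]_n -> 'rV[R]_n) (A : set 'rV[R]_n) :
  measurable_fun setT T -> {morph T : x y / (x + y)%R} -> involutive T ->
  (forall x, enorm (T x) = enorm x) -> measurable A ->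
  leb (T @^-1` A) = leb A.
Proof.
move=> mT TD TK Tn mA.
pose B := @ball0 R n 1; have mB : measurable B := measurable_ball0 1.
have lB0 : leb B != 0 by rewrite gt_eqF// lebesgue_ball_gt0.
have lBf : leb B \is a fin_num.
  by rewrite ge0_fin_numE// lebesgue_ball_lty.
have mind (X : set 'rV[R]_n) : measurable X -> measurable_fun setT (EFin \o (\1_X : _ -> R)).
  by move=> mX; apply/measurable_EFinP; exact: measurable_indic.
have mTA : measurable (T @^-1` A) by rewrite -[X in measurable X]setTI; exact: mT.
suff : leb (T @^-1` A) * leb B = leb A * leb B.
  by move=> /(congr1 (fun z => z * (leb B)^-1)); rewrite -!muleA divee ?mule1.
have mT1 : measurable_fun setT (fun z : 'rV[R]_n * 'rV[R]_n => T z.1).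
  exact: measurableT_comp mT measurable_fst.
transitivity (\int[leb]_y \int[leb]_x ((\1_A (T x + y)%R)%:E * (\1_B y)%:E)).
  transitivity (\int[leb]_y (leb (T @^-1` A) * (\1_B y)%:E)).
    by rewrite ge0_integralZl//; [rewrite integral_indic// setIT|exact: mind].
  apply: eq_integral => y _.
  rewrite ge0_integralZr//; last first.
    apply: (@measurableT_comp _ _ _ _ _ _ (EFin \o \1_A) _
      (fun x => T x + y)%R); first exact: mind.
    by apply: measurable_rVD => //; exact: measurable_cst.
  congr (_ * _).
  transitivity (\int[leb]_x (\1_(T @^-1` A) x)%:E).
    by rewrite integral_indic// setIT.
  rewrite -(ge0_integral_translation (T y)); [|exact: mind|by move=> x; rewrite lee_fin].
  by apply: eq_integral => x _; rewrite !indicE; congr ((_ : bool)%:R%:E);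
    apply/idP/idP; rewrite !inE /= TD TK.
rewrite -(fubini_tonelli (fun z => (\1_A (T z.1 + z.2)%R)%:E * (\1_B z.2)%:E))/=; last 2 first.
- apply: emeasurable_funM.
    apply: (@measurableT_comp _ _ _ _ _ _ (EFin \o \1_A) _
      (fun z : 'rV[R]_n * 'rV[R]_n => T z.1 + z.2)%R); first exact: mind.
    by apply: measurable_rVD => //; exact: measurable_snd.
  by apply: (measurableT_comp (mind _ mB)); exact: measurable_snd.
- by move=> z; rewrite mule_ge0// lee_fin.
transitivity (\int[leb]_x \int[leb]_y ((\1_A y)%:E * (\1_B (y - T x)%R)%:E)).
  apply: eq_integral => x _; rewrite -[RHS](ge0_integral_translation (T x)).
  - by apply: eq_integral => y _; rewrite addrK addrC.
  - apply: emeasurable_funM; first exact: mind.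
    apply: (measurableT_comp (mind _ mB)).
    by apply: measurable_rVB => //; exact: measurable_cst.
  - by move=> z; rewrite mule_ge0// lee_fin.
rewrite (fubini_tonelli (fun z => (\1_A z.2)%:E * (\1_B (z.2 - T z.1)%R)%:E))/=; last 2 first.
- apply: emeasurable_funM.
    by apply: (measurableT_comp (mind _ mA)); exact: measurable_snd.
  apply: (measurableT_comp (mind _ mB)).
  by apply: measurable_rVB => //; exact: measurable_snd.
- by move=> z; rewrite mule_ge0// lee_fin.
transitivity (\int[leb]_y ((\1_A y)%:E * leb B)).
  apply: eq_integral => y _.
  rewrite ge0_integralZl//; last first.
    apply: (measurableT_comp (mind _ mB)).
    by apply: measurable_rVB => //; exact: measurable_cst.
  congr (_ * _); transitivity (\int[leb]_x (\1_B x)%:E); last first.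
    by rewrite integral_indic// setIT.
  rewrite -(ge0_integral_translation (- T y)); [|exact: mind|by move=> x; rewrite lee_fin].
  apply: eq_integral => x _; rewrite !indicE; congr ((_ : bool)%:R%:E).
  have E : enorm (y - T x)%R = enorm (x - T y)%R.
    have TN z : T (- z)%R = (- T z)%R.
      by apply/eqP; rewrite -addr_eq0 -TD addNr; apply/eqP/(@addrI _ (T 0)%R); rewrite -TD !addr0.
    by rewrite -(Tn (x - T y)%R) TD TN TK enormB.
  by apply/idP/idP; rewrite !inE /B /ball0 /= E.
by rewrite ge0_integralZr//; [rewrite integral_indic// setIT|exact: mind].
Qed.

Lemma lebesgue_reflect u (A : set 'rV[R]_n) : (u != 0)%R -> measurable A ->
  leb (reflect_along u @^-1` A) = leb A.
Proof.
move=> u0; apply: lebesgue_isometry; first exact: measurable_reflect.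
- exact: reflect_alongD.
- exact: reflect_alongK.
- by move=> x; exact: enorm_reflect.
Qed.

End lebesgue_isometry.

(** * Polar integration of homogeneous functions *)

Section density.
Context d (T : measurableType d) (R : realType).
Variables (mu : {measure set T -> \bar R}) (h : T -> R).
Local Open Scope ereal_scope.

(** The hypotheses on [h] are arguments so that the structure of measure can
    be attached to this constant. *)
Definition density (mh : measurable_fun setT h) (h0 : forall x, (0 <= h x)%R)
    (A : set T) : \bar R := \int[mu]_(x in A) (h x)%:E.

Variables (mh : measurable_fun setT h) (h0 : forall x, (0 <= h x)%R).

Let density0 : density mh h0 set0 = 0.
Proof. by rewrite /density integral_set0. Qed.

Let density_ge0 A : 0 <= density mh h0 A.
Proof. by apply: integral_ge0 => x _; rewrite lee_fin. Qed.

Let density_sigma_additive : semi_sigma_additive (density mh h0).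
Proof.
move=> /= A mA tA mUA.
rewrite /density/= ge0_integral_bigcup//=; last 2 first.
- by apply: measurable_funTS; exact/measurable_EFinP.
- by move=> x _; rewrite lee_fin.
apply: is_cvg_ereal_nneg_natsum_cond => n _ _.
by apply: integral_ge0 => x _; rewrite lee_fin.
Qed.

HB.instance Definition _ := isMeasure.Build _ _ _
  (density mh h0) density0 density_ge0 density_sigma_additive.

End density.

Section integral_weighted.
Context d d' (T : measurableType d) (T' : measurableType d') (R : realType).
Variables (mu : {measure set T -> \bar R}) (nu : {measure set T' -> \bar R}).
Variables (h : T -> R) (psi : T -> T').
Local Open Scope ereal_scope.
Hypotheses (mh : measurable_fun setT h) (h0 : forall x, (0 <= h x)%R).
Hypothesis mpsi : measurable_fun setT psi.
Hypothesis hnu : forall A, measurable A ->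
  \int[mu]_(x in psi @^-1` A) (h x)%:E = nu A.
Import HBNNSimple.

Let mhE : measurable_fun setT (EFin \o h). Proof. exact/measurable_EFinP. Qed.

Let weighted_nnsfun (g : {nnsfun T' >-> R}) :
  \int[mu]_x ((g (psi x))%:E * (h x)%:E) = \int[nu]_y (g y)%:E.
Proof.
rewrite integralT_nnsfun sintegralE.
transitivity (\int[mu]_x (\sum_(k \in range g)
     k%:E * ((\1_(g @^-1` [set k]) (psi x))%:E * (h x)%:E))).
  apply: eq_integral => x _; rewrite {1}fimfunE -fsumEFin//.
  rewrite ge0_mule_fsuml//; last first.
    by move=> k; rewrite EFinM nnfun_muleindic_ge0.
  by apply: eq_fsbigr => k _; rewrite EFinM muleA.
rewrite ge0_integral_fsum//.
- apply: eq_fsbigr => k; rewrite inE => -[y _ gyk].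
  have k0 : (0 <= k)%R by rewrite -gyk.
  rewrite ge0_integralZl//; last 2 first.
  + apply: emeasurable_funM => //; apply/measurable_EFinP.
    by apply: measurableT_comp => //; exact: measurable_indic.
  + by move=> x _; rewrite mule_ge0// lee_fin.
  congr (_ * _); rewrite -hnu// [RHS]integral_mkcond; apply: eq_integral => x _.
  rewrite patchE indicE.
  have -> : (psi x \in g @^-1` [set k]) = (x \in psi @^-1` (g @^-1` [set k])).
    by apply/idP/idP; rewrite !inE.
  by case: ifP; rewrite ?mul1e ?mul0e.
- move=> k; apply: emeasurable_funM => //; apply: emeasurable_funM => //.
  apply/measurable_EFinP.
  by apply: measurableT_comp => //; exact: measurable_indic.
- move=> k x _; rewrite muleA mule_ge0// ?lee_fin//.
  exact: nnfun_muleindic_ge0.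
Qed.

(** A change of variables which also absorbs a weight: the weighted measures
    of preimages determine the integral, first of simple functions, then of
    their monotone limits. *)
Lemma ge0_integral_weighted (g : T' -> \bar R) :
  measurable_fun setT g -> (forall y, 0 <= g y) ->
  \int[mu]_x (g (psi x) * (h x)%:E) = \int[nu]_y g y.
Proof.
move=> mg g0.
pose g_ := nnsfun_approx measurableT mg.
have cg y : (g_ n y)%:E @[n --> \oo] --> g y by exact: cvg_nnsfun_approx.
have mgp n : measurable_fun setT (fun x => (g_ n (psi x))%:E).
  by apply/measurable_EFinP; exact: measurableT_comp.
transitivity (limn (fun n => \int[mu]_x ((g_ n (psi x))%:E * (h x)%:E))).
  rewrite -monotone_convergence//.
  - apply: eq_integral => x _; apply/esym/cvg_lim => //.
    exact: cvgeZr.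
  - by move=> n; apply: emeasurable_funM.
  - by move=> n x _; rewrite mule_ge0// lee_fin.
  - move=> x _ a b ab; apply: lee_wpmul2r; rewrite lee_fin//.
    exact/lefP/nd_nnsfun_approx.
rewrite (_ : (fun n => _) = (fun n => \int[nu]_y (g_ n y)%:E)); last first.
  by apply/funext => n; exact: weighted_nnsfun.
rewrite -monotone_convergence//.
- by apply: eq_integral => x _; apply/cvg_lim => //; exact: cg.
- by move=> n; exact/measurable_EFinP.
- by move=> n x _; rewrite lee_fin.
- by move=> x _ a b ab; rewrite lee_fin; exact/lefP/nd_nnsfun_approx.
Qed.

End integral_weighted.

Section polar.
Context {R : realType}.
Local Notation L1 := (@lebesgue_measure R).
Local Open Scope ereal_scope.

Lemma measure_unique_rays (m1 m2 : {measure set (measurableTypeR R) -> \bar R}) :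
  (forall a : R, m1 `]-oo, a[%classic = m2 `]-oo, a[%classic) ->
  (forall a : R, m1 `]-oo, a[%classic < +oo) ->
  forall A, measurable A -> m1 A = m2 A.
Proof.
move=> H Hoo A mA.
apply: (@measure_unique _ R (measurableTypeR R) (@RGenInftyO.G R) (fun k : nat => `]-oo, k%:R[%classic : set R)) => //.
- by have := @RGenInftyO.measurableE R.
- move=> _ _ [a ->] [b ->]; exists (Num.min a b).
  apply/seteqP; split=> x /=; rewrite !in_itv/= lt_min; first by case=> -> ->.
  by move/andP => [-> ->].
- by move=> k; exists k%:R.
- rewrite -subTset => x _; exists (Num.truncn x).+1 => //=.
  by rewrite in_itv/= truncnS_gt.
- by move=> _ [a ->].
Qed.

Lemma integral_exprn n (a : R) : (0 < n)%N -> (0 < a)%R ->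
  \int[L1]_(r in `[0%R, a[) (n%:R * r ^+ n.-1)%:E = (a ^+ n)%:E.
Proof.
move=> n0 a0.
have cM : continuous (fun r : R => n%:R * r ^+ n.-1)%R.
  move=> x; apply: (@continuousM _ _ (cst n%:R) (fun r : R => r ^+ n.-1)%R).
    exact: cvg_cst.
  exact: exprn_continuous.
rewrite integral_itv_bndo_bndc; last first.
  by apply/measurable_EFinP/measurable_funTS; exact: continuous_measurable_fun.
rewrite (@continuous_FTC2 _ _ (fun r => r ^+ n)%R)//.
- by rewrite expr0n gtn_eqF// sube0.
- exact: continuous_subspaceT.
- split; first by move=> x _; exact: exprn_derivable.
  + by apply: cvg_at_right_filter; exact: exprn_continuous.
  + by apply: cvg_at_left_filter; exact: exprn_continuous.
- by move=> x _; rewrite exp_derive1 mulr_natl /GRing.scale/= mulr_natl.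
Qed.

(** Both sides are integrals of [F] against a measure on the line: the image
    under the norm of the measure of density [Psi], and the measure of density
    n r^(n-1) on the half-line times the integral of [Psi] over the unit ball.
    By homogeneity both give a^n times that integral to ]-oo, a[, so they
    coincide. *)
Lemma polar_homogeneous n (Psi : 'rV[R]_n -> R) (F : R -> \bar R) :
  (0 < n)%N ->
  measurable_fun setT Psi -> (forall x, (0 <= Psi x)%R) ->
  (forall a x, (0 < a)%R -> Psi (a *: x)%R = Psi x) ->
  \int[lebesgue_rV n]_(x in ball0 1) (Psi x)%:E < +oo ->
  measurable_fun setT F -> (forall r, 0 <= F r) ->
  \int[lebesgue_rV n]_x (F (enorm x) * (Psi x)%:E) =
  \int[L1]_(r in `[0%R, +oo[) (F r * (n%:R * r ^+ n.-1)%:E) *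
  \int[lebesgue_rV n]_(x in ball0 1) (Psi x)%:E.
Proof.
move=> n0 mPsi Psi0 homPsi; set C := integral _ _ _ => Coo mF F0.
have C0 : 0 <= C by apply: integral_ge0 => x _; rewrite lee_fin.
have mPsiE : measurable_fun setT (EFin \o Psi) by exact/measurable_EFinP.
pose nu1 := pushforward (density (lebesgue_rV n) mPsi Psi0) (@enorm R n : _ -> measurableTypeR R).
have nu1E a : nu1 `]-oo, a[%classic = \int[lebesgue_rV n]_(x in ball0 a) (Psi x)%:E.
  rewrite /nu1 /pushforward /density; congr integral.
have ballC a : (0 < a)%R ->
    \int[lebesgue_rV n]_(x in ball0 a) (Psi x)%:E = (a ^+ n)%:E * C.
  move=> a0; rewrite integral_mkcond -(ge0_integral_scale a0)//; last 2 first.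
  - apply/(measurable_restrictT _ (measurable_ball0 a)); exact: measurable_funTS.
  - by apply: erestrict_ge0 => x _; rewrite lee_fin.
  congr (_ * _); rewrite /C [RHS]integral_mkcond; apply: eq_integral => x _.
  rewrite !patchE /= homPsi//; congr (if _ then _ else _).
  have E (y : 'rV[R]_n) : ball0 a (a *: y) = ball0 1 y.
    by rewrite /ball0 /= enormZ gtr0_norm// -ltr_pdivlMl// mulVf ?gt_eqF.
  by apply/idP/idP; rewrite !inE E.
(* cut off at 0, as the norm only takes nonnegative values *)
pose g r : R := (if 0 <= r then n%:R * r ^+ n.-1 else 0)%R.
have g0 r : (0 <= g r)%R.
  by rewrite /g; case: ifPn => // r0; rewrite mulr_ge0// exprn_ge0.
have mg : measurable_fun setT g.
  apply: measurable_fun_ifT => //; first exact: measurable_fun_ler.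
  by apply: measurable_funM => //; exact: measurable_funX.
have fC : C \is a fin_num by rewrite ge0_fin_numE.
have c0 : (0 <= fine C)%R by exact: fine_ge0.
pose nu2 := mscale (NngNum c0) (density L1 mg g0).
have gE (G : R -> \bar R) : (forall r, 0 <= G r) ->
   \int[L1]_r (G r * (g r)%:E) = \int[L1]_(r in `[0%R, +oo[) (G r * (n%:R * r ^+ n.-1)%:E).
  move=> G0; rewrite [RHS]integral_mkcond; apply: eq_integral => r _.
  rewrite patchE /g; case: ifPn => r0.
    by rewrite mem_set//= in_itv/= r0.
  by rewrite memNset ?mule0//= in_itv/= andbT; exact/negP.
have nu2E a : nu2 `]-oo, a[%classic = if (0 < a)%R then (a ^+ n)%:E * C else 0.
  rewrite /nu2 /mscale /=.
  have -> : density L1 mg g0 `]-oo, a[ = \int[L1]_(r in `[0%R, a[) (n%:R * r ^+ n.-1)%:E.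
    rewrite /density integral_mkcond [RHS]integral_mkcond; apply: eq_integral => r _.
    rewrite !patchE /g !mem_setE !in_itv/=.
    by case: (r < a)%R; case: (0 <= r)%R.
  case: ifPn => a0; first by rewrite integral_exprn// muleC fineK.
  by rewrite set_itv_ge ?integral_set0 ?mule0// bnd_simp.
have menorm := @measurable_enorm R n.
have nuE A : measurable A -> nu1 A = nu2 A.
  apply: (measure_unique_rays (m1 := nu1) (m2 := nu2)) => a.
    rewrite [RHS]nu2E [LHS]nu1E; case: ifPn => a0; first exact: ballC.
    rewrite (_ : ball0 a = set0) ?integral_set0//.
    rewrite -subset0 => x /= /le_lt_trans - /(_ _ (enorm_ge0 x)).
    by rewrite (negbTE a0).
  rewrite [ltLHS]nu1E; have [a0|a0] := ltP 0%R a.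
    by rewrite ballC// lte_mul_pinfty// ?lee_fin ?exprn_ge0// ltW.
  rewrite (_ : ball0 a = set0) ?integral_set0//.
  rewrite -subset0 => x /= /le_lt_trans - /(_ _ (enorm_ge0 x)).
  by rewrite ltNge a0.
rewrite (ge0_integral_weighted (nu := nu2) mPsi Psi0 menorm)//.
rewrite ge0_integral_mscale//= fineK// muleC; congr (_ * _).
rewrite -gE//; apply/esym.
by apply: (@ge0_integral_weighted _ _ _ _ R L1 (density L1 mg g0) g id mg g0 _ _ F mF F0).
Qed.

End polar.

(** * Volume of the unit ball *)

Section ball_volume.
Context {R : realType}.
Local Notation L1 := (@lebesgue_measure R).
Local Open Scope ereal_scope.

Lemma lebesgue_ball0 n (r : R) : (0 < r)%R ->
  lebesgue_rV n (ball0 r) = (r ^+ n)%:E * lebesgue_rV n (ball0 1).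
Proof.
move=> r0.
have := lebesgue_scale r0 (measurable_ball0 (n := n) r).
rewrite [X in lebesgue_rV n X](_ : _ = ball0 1).
  move=> ->; rewrite muleA -EFinM mulfV ?mul1e//.
  by rewrite gt_eqF// exprn_gt0.
apply/funext => x; rewrite /ball0 /= enormZ gtr0_norm//.
by rewrite -ltr_pdivlMl// mulVf ?gt_eqF.
Qed.

Lemma integral_gauss_rV n :
  \int[lebesgue_rV n]_x (expR (- dot x x))%:E = ((Num.sqrt pi : R) ^+ n)%:E.
Proof.
have mg m : measurable_fun setT (fun x : 'rV[R]_m => (expR (- dot x x))%:E).
  apply/measurable_EFinP; apply: measurableT_comp => //.
  by apply: measurable_funN; exact: measurable_dot.
elim: n => [|n IH].
  rewrite /= integral_dirac//; last exact: mg.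
  by rewrite diracE mem_set// mul1e /dot big_ord0 oppr0 expR0 expr0.
rewrite ge0_integral_rV_cons; [|exact: mg|by move=> x; rewrite lee_fin expR_ge0].
transitivity (\int[L1]_t ((gauss_fun t)%:E * ((Num.sqrt pi : R) ^+ n)%:E)).
  apply: eq_integral => t _; rewrite -IH.
  rewrite -ge0_integralZl//; [|exact: mg|by rewrite lee_fin expR_ge0].
  apply: eq_integral => v _; rewrite -EFinM /gauss_fun -expRD; congr (expR _)%:E.
  rewrite /dot big_ord_recl !mxE unlift_none /= opprD expr2; congr (_ - _)%R.
  by apply: eq_bigr => i _; rewrite !mxE liftK.
rewrite ge0_integralZr//.
- by rewrite integralT_gauss -EFinM exprS.
- by apply/measurable_EFinP; exact: measurable_gauss_fun.
- by move=> x _; rewrite lee_fin expR_ge0.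
Qed.

Lemma integral_expRN (a : R) :
  \int[L1]_(t in `]a, +oo[) (expR (- t))%:E = (expR (- a))%:E.
Proof.
have dE (x : R) : is_derive x 1%R (fun t : R => - expR (- t))%R (expR (- x)).
  have H := is_derive1_comp (is_derive_expR (- x)) (is_deriveNid x 1%R).
  by apply: is_derive_eq; rewrite /= ?scaleN1r ?opprK /GRing.scale/= ?mulrN1 ?opprK.
rewrite integral_itv_obnd_cbnd; last first.
  apply/measurable_EFinP/measurable_funTS; exact: measurableT_comp.
rewrite (@ge0_continuous_FTC2y _ _ (fun t => - expR (- t))%R _ 0%R).
- by rewrite EFinN oppeK add0e.
- by move=> x _; exact: expR_ge0.
- apply: continuous_subspaceT => x; apply: continuous_comp.
    exact: opp_continuous.
  exact: continuous_expR.
- rewrite -[X in _ --> X]oppr0; apply: cvgN.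
  exact: cvgr_expR.
- by move=> x _; apply: ex_derive.
- apply: cvg_at_right_filter; have [/derivable1_diffP/differentiable_continuous] := dE a.
  exact.
- by move=> x _; rewrite derive1E derive_val.
Qed.

(** The Gaussian exp (- |x|^2) is the integral of exp (- t) over t > |x|^2.
    Exchanging the integrals, the inner one is the volume of the ball of
    radius sqrt t. *)
Lemma Gamma_layer_cake n :
  ((Num.sqrt pi : R) ^+ n)%:E =
  lebesgue_rV n (ball0 1) *
  \int[L1]_(t in `]0%R, +oo[) (t `^ (n%:R / 2) * expR (- t))%:E.
Proof.
rewrite -integral_gauss_rV.
pose I (z : 'rV[R]_n * R) : \bar R :=
  (if (dot z.1 z.1 < z.2)%R then expR (- z.2) else 0%R)%:E.
have mI : measurable_fun setT I.
  apply/measurable_EFinP; apply: measurable_fun_ifT => //.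
    apply: measurable_fun_ltr => //.
    by apply: measurable_dot; exact: measurable_fst.
  by apply: measurableT_comp => //; apply: measurable_funN; exact: measurable_snd.
have I0 z : 0 <= I z by rewrite /I lee_fin; case: ifPn => // _; exact: expR_ge0.
transitivity (\int[lebesgue_rV n]_x \int[L1]_t I (x, t)).
  apply: eq_integral => x _; rewrite -integral_expRN integral_mkcond.
  apply: eq_integral => t _; rewrite patchE /I /= mem_setE in_itv/= andbT.
  by case: ifP.
transitivity (\int[L1]_t \int[lebesgue_rV n]_x I (x, t)).
  exact: (@fubini_tonelli _ _ _ _ R (lebesgue_rV n) lebesgue_measure I).
rewrite -ge0_integralZl//; last 2 first.
- apply/measurable_EFinP; apply: measurable_funTS; apply: measurable_funM.
    exact: measurable_powR.
  by apply: measurableT_comp.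
- by move=> x _; rewrite lee_fin mulr_ge0 ?powR_ge0 ?expR_ge0.
rewrite [RHS]integral_mkcond; apply: eq_integral => t _.
rewrite patchE mem_setE in_itv/= andbT; case: (ltP 0%R t) => t0; last first.
  rewrite integral0_eq// => x _; rewrite /I/=.
  by rewrite ltNge (le_trans t0)// dot_ge0.
have st0 : (0 < Num.sqrt t)%R by rewrite sqrtr_gt0.
transitivity (\int[lebesgue_rV n]_x ((expR (- t))%:E * (\1_(ball0 (Num.sqrt t)) x)%:E)).
  apply: eq_integral => x _; rewrite /I /= indicE.
  have -> : (x \in ball0 (Num.sqrt t)) = (dot x x < t)%R.
    apply/idP/idP; rewrite inE /ball0 /= /enorm; first by rewrite ltr_sqrt.
    by rewrite ltr_sqrt.
  by case: ifP; rewrite ?mule1 ?mule0.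
rewrite ge0_integralZl//; last first.
  by apply/measurable_EFinP/measurable_indic; exact: measurable_ball0.
rewrite integral_indic ?setIT//; last exact: measurable_ball0.
rewrite /= (lebesgue_ball0 n st0) muleCA muleA muleC; congr (_ * _).
rewrite -EFinM.
congr (_ * _)%:E.
by rewrite -powR_mulrn ?sqrtr_ge0// -powR12_sqrt ?ltW// -powRrM mulrC.
Qed.

(** [Gamma] takes the finite part of an extended integral, which is 0 if the
    integral diverges; here it converges because the Gaussian integral is
    finite and the unit ball has positive volume. *)
Lemma Gamma_integral_fin n :
  \int[L1]_(t in `]0%R, +oo[) (t `^ (n%:R / 2) * expR (- t))%:E =
  (Gamma (n%:R / 2 + 1))%:E.
Proof.
rewrite /Gamma; under eq_Rintegral do rewrite addrK.
rewrite /Rintegral fineK// ge0_fin_numE; last first.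
  by apply: integral_ge0 => x _; rewrite lee_fin mulr_ge0 ?powR_ge0 ?expR_ge0.
rewrite ltey; apply/eqP => H; have := Gamma_layer_cake n.
by rewrite H gt0_muley// lebesgue_ball_gt0.
Qed.

Lemma Gamma_gt0 n : (0 < Gamma (n%:R / 2 + 1 : R))%R.
Proof.
rewrite lt0r Gamma_ge0 andbT; apply/eqP => H; have := Gamma_layer_cake n.
rewrite Gamma_integral_fin H mule0 => /eqP; rewrite eqe gt_eqF//.
by rewrite exprn_gt0// sqrtr_gt0 pi_gt0.
Qed.

Lemma lebesgue_unit_ball n :
  lebesgue_rV n (unit_ball : set 'rV[R]_n) = (ball_volume (n%:R : R))%:E.
Proof.
have := Gamma_layer_cake n; rewrite Gamma_integral_fin unit_ballE.
have := lebesgue_ball_lty (n := n) (1 : R)%R.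
case: (lebesgue_rV n (ball0 1)) (lebesgue_ball_gt0 (n := n) (ltr01 (R := R))) => // v _ _.
rewrite -EFinM => -[E]; congr (_%:E).
have -> : ball_volume n%:R = ((Num.sqrt pi : R) ^+ n / Gamma (n%:R / 2 + 1 : R))%R.
  rewrite /ball_volume [X in (_ `^ X)%R]mulrC powRrM powR12_sqrt ?pi_ge0//.
  by rewrite powR_mulrn ?sqrtr_ge0.
by rewrite E mulfK// gt_eqF// Gamma_gt0.
Qed.

Lemma ball_volume_gt0 n : (0 < ball_volume (n%:R : R))%R.
Proof.
by rewrite -lte_fin -lebesgue_unit_ball lebesgue_ball_gt0.
Qed.

End ball_volume.

(** * Hausdorff measure: isometries and Borel sets *)

Section hausdorff_theory.
Context {R : realType} {n : nat} (s : R).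
Implicit Types (A B : set 'rV[R]_n) (C : (set 'rV[R]_n)^nat).
Local Open Scope ereal_scope.
Local Notation H := (@hausdorff R n s).

Lemma hausdorff_gauge0 : @hausdorff_gauge R n s set0 = 0.
Proof. by rewrite /hausdorff_gauge eqxx. Qed.

Lemma ediam_le A (d : \bar R) :
  (forall x y, A x -> A y -> (enorm (x - y))%:E <= d) -> ediam A <= d.
Proof.
by move=> H; apply: ge_ereal_sup => _ [[x y] [/= Ax Ay] <-]; exact: H.
Qed.

Lemma enorm_le_ediam A x y : A x -> A y -> (enorm (x - y))%:E <= ediam A.
Proof. by move=> Ax Ay; apply: ereal_sup_ubound; exists (x, y). Qed.

Section isometry.
Variable T : 'rV[R]_n -> 'rV[R]_n.
Hypotheses (TK : involutive T)
  (Td : forall x y, enorm (T x - T y)%R = enorm (x - y)%R).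

Let preimageK A : T @^-1` (T @^-1` A) = A.
Proof. by apply/funext => x; rewrite /preimage /= TK. Qed.

Lemma ediam_isometry A : ediam (T @^-1` A) = ediam A.
Proof.
have le B : ediam (T @^-1` B) <= ediam B.
  by apply: ediam_le => x y Bx By; rewrite -Td; exact: enorm_le_ediam.
by apply/eqP; rewrite eq_le le/= -{1}(preimageK A) le.
Qed.

Lemma hausdorff_gauge_isometry A :
  hausdorff_gauge s (T @^-1` A) = hausdorff_gauge s A.
Proof.
rewrite /hausdorff_gauge ediam_isometry.
suff -> : (T @^-1` A == set0) = (A == set0) by [].
apply/eqP/eqP => [A0|->]; last by rewrite preimage_set0.
by rewrite -(preimageK A) A0 preimage_set0.
Qed.

Lemma hausdorff_isometry A : H (T @^-1` A) = H A.
Proof.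
suff le B : H (T @^-1` B) <= H B.
  by apply/eqP; rewrite eq_le le/= -{1}(preimageK A) le.
apply: ge_ereal_sup => _ [d d0 <-]; apply: le_trans (hausdorff_content_le s B d0).
apply: le_ereal_inf_tmp => _ [C [BC Cd] <-]; apply: ereal_inf_lbound.
exists (fun k => T @^-1` C k).
  split=> [x /= /BC[k _ Ck]|k]; first by exists k.
  by rewrite ediam_isometry.
by apply: eq_eseriesr => k _; rewrite hausdorff_gauge_isometry.
Qed.

End isometry.

Lemma hausdorff_content_anti A (d e : R) : (d <= e)%R ->
  hausdorff_content s e A <= hausdorff_content s d A.
Proof.
move=> de; apply: ereal_inf_le_tmp => _ [C [AC Cd] <-]; exists C => //.
by split=> // k; rewrite (le_trans (Cd k))// lee_fin.
Qed.

(** A set of diameter at most e < d cannot meet both A and B, so each cover of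
    the union splits into a cover of A and one of B. *)
Lemma hausdorff_content_metric A B (d e : R) : (e < d)%R ->
  (forall x y, A x -> B y -> (d <= enorm (x - y))%R) ->
  hausdorff_content s e A + hausdorff_content s e B <=
  hausdorff_content s e (A `|` B).
Proof.
move=> ed AB; apply: le_ereal_inf_tmp => _ [C [ABC Cd] <-].
pose meets (D E : set 'rV[R]_n) := `[< exists x, D x /\ E x >].
pose CA k := if meets (C k) A then C k else set0.
pose CB k := if meets (C k) B then C k else set0.
have cover X CX : X `<=` A `|` B ->
    CX = (fun k => if meets (C k) X then C k else set0) ->
    hausdorff_content s e X <= \sum_(k <oo) hausdorff_gauge s (CX k).
  move=> XAB ->; apply: ereal_inf_lbound.
  exists (fun k => if meets (C k) X then C k else set0) => //; split=> [x Xx|k].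
    have [k _ Ckx] := ABC _ (XAB _ Xx); exists k => //.
    by rewrite /meets asboolT//; exists x.
  by case: ifP => // _; apply: ediam_le => ? ? [].
apply: (@le_trans _ _ (\sum_(k <oo) hausdorff_gauge s (CA k) +
                       \sum_(k <oo) hausdorff_gauge s (CB k))).
  by apply: leeD; [apply: (cover A) => // x; left|apply: (cover B) => // x; right].
rewrite -nneseriesD; [|by move=> k _ _; exact: hausdorff_gauge_ge0..].
apply: lee_nneseries => [k _ _|k _].
  by apply: adde_ge0; exact: hausdorff_gauge_ge0.
rewrite /CA /CB /meets; case: asboolP => [[x [Cx Ax]]|_]; last first.
  by rewrite hausdorff_gauge0 add0e; case: asboolP => // _;
    rewrite ?hausdorff_gauge0 ?hausdorff_gauge_ge0.
case: asboolP => [[y [Cy By]]|_]; last by rewrite hausdorff_gauge0 adde0.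
have := le_trans (enorm_le_ediam Cx Cy) (Cd k); rewrite lee_fin => xye.
by have := le_lt_trans (le_trans (AB _ _ Ax By) xye) ed; rewrite ltxx.
Qed.

Lemma hausdorff_metric A B (d : R) : (0 < d)%R ->
  (forall x y, A x -> B y -> (d <= enorm (x - y))%R) ->
  H A + H B <= H (A `|` B).
Proof.
move=> d0 AB.
have [->|Hoo] := eqVneq (H (A `|` B)) +oo; first by rewrite leey.
have HABf : H (A `|` B) \is a fin_num by rewrite ge0_fin_numE ?hausdorff_ge0 ?ltey.
have sub X : X `<=` A `|` B -> H X \is a fin_num.
  move=> XAB; rewrite ge0_fin_numE ?hausdorff_ge0//.
  by rewrite (le_lt_trans (le_hausdorff s XAB))// ltey.
have HBf : H B \is a fin_num by apply: sub => x; right.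
rewrite -leeBrDr//; apply: ge_ereal_sup => _ [a a0 <-].
rewrite leeBrDr// addeC.
have caf : hausdorff_content s a A \is a fin_num.
  rewrite ge0_fin_numE ?hausdorff_content_ge0//.
  rewrite (le_lt_trans (hausdorff_content_le s A a0))// -ge0_fin_numE ?hausdorff_ge0//.
  by apply: sub => x; left.
rewrite -leeBrDr//; apply: ge_ereal_sup => _ [b b0 <-].
rewrite leeBrDr// addeC.
pose e := Num.min (Num.min a b) (d / 2)%R.
have e0 : (0 < e)%R by rewrite !lt_min a0 b0 divr_gt0.
apply: (le_trans _ (hausdorff_content_le s _ e0)).
apply: (le_trans _ (@hausdorff_content_metric A B d e _ AB)); last first.
  by rewrite gt_min; apply/orP; right; lra.
by apply: leeD; apply: hausdorff_content_anti; rewrite !ge_min lexx ?orbT.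
Qed.

Lemma hausdorff_separated_sum (G : (set 'rV[R]_n)^nat) J :
  (forall j, exists2 d : R, (0 < d)%R & forall i x y, (i < j)%N ->
     G i x -> G j y -> (d <= enorm (x - y))%R) ->
  \sum_(i < J) H (G i) <= H (\bigcup_(i < J) G i).
Proof.
move=> sepG; elim: J => [|J IH]; first by rewrite big_ord0 hausdorff_ge0.
have [d d0 dG] := sepG J.
rewrite big_ord_recr/= bigcup_mkord big_ord_recr/= -bigcup_mkord.
apply: (le_trans (leeD IH (lexx _))).
apply: (hausdorff_metric d0) => x y [i /= iJ Gi] GJ.
exact: (dG _ _ _ iJ Gi GJ).
Qed.

Section caratheodory_criterion.
Variable phi : 'rV[R]_n -> R.
Hypothesis phi_lip : forall x y, (`|phi x - phi y| <= enorm (x - y))%R.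
Variable c : R.

Let S := [set x | phi x < c]%R.
Let e (k : nat) : R := k.+1%:R^-1.
Let Sk k := [set x | phi x <= c - e k]%R.

Let e_gt0 k : (0 < e k)%R. Proof. by rewrite invr_gt0. Qed.
Let e_decr i j : (i <= j)%N -> (e j <= e i)%R.
Proof. by move=> ij; rewrite lef_pV2 ?posrE// ler_nat. Qed.
Let e_sdecr i j : (i < j)%N -> (e j < e i)%R.
Proof. by move=> ij; rewrite ltf_pV2 ?posrE// ltr_nat. Qed.

Let S_bigcup : S = \bigcup_k Sk k.
Proof.
apply/seteqP; split=> [x /= xc|x [k _]]; rewrite /Sk /S /=; last first.
  by move=> xk; have := e_gt0 k; lra.
have cx : (0 < c - phi x)%R by rewrite subr_gt0.
exists (Num.truncn (c - phi x)^-1) => //=.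
suff : (e (Num.truncn (c - phi x)^-1) <= c - phi x)%R by lra.
by rewrite -[leRHS]invrK lef_pV2 ?posrE ?invr_gt0// ltW// truncnS_gt.
Qed.

(** Caratheodory's criterion for metric outer measures. The layers between the
    levels c - 1/k and c - 1/(k+1) lie at positive distance from each other
    when their indices differ by two or more, so the outer measures of the
    parts of X in layers of even index, and of odd index, are summable. Hence
    X inside the sublevel set is, up to a set of arbitrarily small outer
    measure, at positive distance from the complement. *)
Lemma sublevel_caratheodory : (@hausdorff_outer R n s).-caratheodory S.
Proof.
apply: le_caratheodory_measurable => X; rewrite -/(H _).
change (H (X `&` S) + H (X `&` ~` S) <= H X).
have [->|Xoo] := eqVneq (H X) +oo; first by rewrite leey.
pose Rk k := X `&` (Sk k.+1 `\` Sk k).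
have sepR i j x y : (i.+1 < j)%N -> Rk i x -> Rk j y ->
    (e i.+1 - e j <= enorm (x - y))%R.
  move=> ij [_ [/= + _]] [_ [/= _ /negP]]; rewrite -ltNge /Sk /= => xi yj.
  have := phi_lip y x; rewrite -(enormB y x).
  by have := ler_norm (phi y - phi x)%R; lra.
(* b = 0 and b = 1 select the layers of even and of odd index *)
have half (b : nat) J : \sum_(i < J) H (Rk (i.*2 + b)%N) <= H X.
  apply: (@le_trans _ _ (H (\bigcup_(i < J) Rk (i.*2 + b)%N))); last first.
    by apply: le_hausdorff => x [i _ []].
  apply: (@hausdorff_separated_sum (fun i => Rk (i.*2 + b)%N)) => -[|j].
    by exists 1%R => // i x y.
  exists (e (j.*2 + b).+1%N - e (j.+1.*2 + b)%N)%R.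
    by rewrite subr_gt0 e_sdecr// doubleS !addSn.
  move=> i x y ij Ri Rj.
  have ij2 : ((i.*2 + b).+1 < j.+1.*2 + b)%N.
    by rewrite doubleS !addSn ltnS ltnS leq_add2r leq_double -ltnS.
  apply: le_trans (sepR _ _ _ _ ij2 Ri Rj); rewrite lerB//.
  by apply: e_decr; rewrite ltnS leq_add2r leq_double -ltnS.
have tot J : \sum_(0 <= k < J.*2) H (Rk k) <= H X + H X.
  apply: (@le_trans _ _ (\sum_(i < J) H (Rk (i.*2 + 0)%N) + \sum_(i < J) H (Rk (i.*2 + 1)%N))).
    rewrite -big_split/= -(big_mkord xpredT (fun i => H (Rk (i.*2 + 0)%N) + H (Rk (i.*2 + 1)%N))).
    elim: J => [|J IH]; first by rewrite !big_geq.
    by rewrite doubleS !big_nat_recr//= addn0 addn1 -addeA; apply: leeD.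
  by apply: leeD; exact: half.
have Rfin : \sum_(0 <= k <oo) H (Rk k) < +oo.
  apply: (@le_lt_trans _ _ (H X + H X)); last first.
    by rewrite lte_add_pinfty// ltey.
  apply: lime_le; first by apply: is_cvg_nneseries => *; exact: hausdorff_ge0.
  near=> J; apply: le_trans (tot J).
  rewrite -addnn [leRHS](@big_cat_nat _ _ _ J)//= ?leq_addr// leeDl//.
  by apply: sume_ge0 => k _; exact: hausdorff_ge0.
have tail := nneseries_tail_cvg Rfin (fun k _ => hausdorff_ge0 s (Rk k)).
have bound m : H (X `&` S) + H (X `&` ~` S) <= H X + \sum_(m <= k <oo) H (Rk k).
  have XS : H (X `&` S) <= H (X `&` Sk m) + \sum_(m <= k <oo) H (Rk k).
    apply: (@le_trans _ _ (H ((X `&` Sk m) `|` \bigcup_k Rk (k + m)%N))).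
      apply: le_hausdorff => x [Xx]; rewrite S_bigcup => -[k _ xk].
      have [xm|xm] := pselect (Sk m x); first by left.
      right.
      have : exists k, `[< Sk (k + m)%N x >].
        exists k; apply/asboolP; rewrite /Sk /=.
        apply: (le_trans xk); rewrite lerB// e_decr// leq_addr//.
      case/ex_minnP => -[|j] /asboolP Sj minj.
        by [].
      exists j => //; split => //; split; first by rewrite -addSn.
      by move=> /asboolP /minj; rewrite ltnn.
    apply: (le_trans (outer_measureU2 (@hausdorff_outer R n s) _ _)).
    rewrite leeD2l//.
    apply: (le_trans (outer_measure_sigma_subadditive (@hausdorff_outer R n s) _)).
    by rewrite (nneseries_addn (f := fun k => H (Rk k)))// => i; exact: hausdorff_ge0.
  rewrite (le_trans (leeD XS (lexx _)))// addeAC leeD2r//.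
  apply: (@le_trans _ _ (H ((X `&` Sk m) `|` (X `&` ~` S)))).
    apply: (hausdorff_metric (e_gt0 m)) => x y [_ xm] [_ /negP].
    rewrite -leNgt /= => cy; move: xm; rewrite /Sk/= => xm.
    have := phi_lip y x; rewrite -(enormB y x).
    by have := ler_norm (phi y - phi x)%R; lra.
  by apply: le_hausdorff => x [] [].
have cv : H X + \sum_(m <= k <oo) H (Rk k) @[m --> \oo] --> H X + 0.
  apply: cvgeD => //; last exact: cvg_cst.
  by apply: fin_num_adde_defl.
rewrite -[leRHS]adde0 -(cvg_lim _ cv)//.
apply: lime_ge; first by apply/cvg_ex; eexists; exact: cv.
by near=> m; exact: bound.
Unshelve. all: by end_near.
Qed.

End caratheodory_criterion.

(** Half-spaces bounded by coordinate hyperplanes generate the Borel sets, and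
    coordinates are 1-Lipschitz. *)
Lemma borel_caratheodory A : measurable A -> (@hausdorff_outer R n s).-caratheodory A.
Proof.
move: A; apply: smallest_sub.
  split.
  - exact: caratheodory_measurable_set0.
  - by move=> A mA; rewrite setTD; exact: caratheodory_measurable_setC.
  - by move=> F mF; exact: caratheodory_measurable_bigcup.
move=> B; rewrite -bigcup_seq => -[i _ [C mC <-]]; rewrite setTI.
pose f (x : 'rV[R]_n) : measurableTypeR R := x ord0 i.
suff Hg : @measurable _ (measurableTypeR R) `<=`
    [set D | (@hausdorff_outer R n s).-caratheodory (f @^-1` D)] by exact: Hg.
have -> : @measurable _ (measurableTypeR R) = <<s @RGenInftyO.G R >>.
  by have := @RGenInftyO.measurableE R.
apply: smallest_sub.
  split=> [|A /= mA|F /= mF].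
  - by rewrite /= preimage_set0; exact: caratheodory_measurable_set0.
  - by rewrite /= setTD preimage_setC; exact: caratheodory_measurable_setC.
  - by rewrite /= preimage_bigcup; exact: caratheodory_measurable_bigcup.
move=> _ [a ->] /=.
have -> : f @^-1` `]-oo, a[ = [set x | x ord0 i < a]%R.
  by apply/seteqP; split=> x; rewrite /= in_itv.
apply: (@sublevel_caratheodory (fun x => x ord0 i)) => x y.
by have := coor_le_enorm (x - y) i; rewrite !mxE.
Qed.

End hausdorff_theory.

(** * The sphere has positive finite Hausdorff measure *)

Section hausdorff_sphere.
Context {R : realType} {n : nat}.
Local Open Scope ereal_scope.
Local Notation S := (unit_sphere : set 'rV[R]_n.+1).

Lemma hausdorff_gauge_le m (s : R) (A : set 'rV[R]_m) (d : R) :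
  (0 <= s)%R -> (0 <= d)%R -> ediam A <= d%:E ->
  hausdorff_gauge s A <= (ball_volume s * (d / 2) `^ s)%:E.
Proof.
move=> s0 d0 Ad; rewrite /hausdorff_gauge; case: ifPn => [_|/set0P[x Ax]].
  by rewrite lee_fin mulr_ge0 ?ball_volume_ge0 ?powR_ge0.
have A0 : 0 <= ediam A.
  by rewrite (le_trans _ (enorm_le_ediam Ax Ax))// lee_fin enorm_ge0.
have Af : ediam A \is a fin_num by rewrite ge0_fin_numE// (le_lt_trans Ad)// ltry.
rewrite [X in X `^ s](_ : _ = (fine (ediam A) / 2)%:E); last by rewrite EFinM fineK.
rewrite poweR_EFin -EFinM lee_fin ler_wpM2l ?ball_volume_ge0//.
apply: ge0_ler_powR; rewrite ?nnegrE ?divr_ge0//; first exact: fine_ge0.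
by rewrite ler_pM2r ?invr_gt0// -lee_fin fineK.
Qed.

Lemma hausdorff_content_finite_cover m (s : R) (I : finType)
    (F : I -> set 'rV[R]_m) (A : set 'rV[R]_m) (delta d : R) :
  (0 <= s)%R -> (0 <= d)%R -> (d <= delta)%R ->
  (forall x, A x -> exists i, F i x) -> (forall i, ediam (F i) <= d%:E) ->
  hausdorff_content s delta A <=
  (#|I|%:R * (ball_volume s * (d / 2) `^ s))%:E.
Proof.
move=> s0 d0 dd AF Fd.
pose C k := if insub k is Some j then F (enum_val (j : 'I_#|I|)) else set0.
apply: (@le_trans _ _ (\sum_(k <oo) hausdorff_gauge s (C k))).
  apply: ereal_inf_lbound; exists C => //; split=> [x Ax|k].
    have [i Fi] := AF x Ax; exists (enum_rank i) => //.
    by rewrite /C valK enum_rankK.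
  rewrite /C; case: insubP => [j _ _|_]; last by apply: ediam_le.
  by rewrite (le_trans (Fd _))// lee_fin.
rewrite (nneseries_split 0 #|I|); last by move=> k _; exact: hausdorff_gauge_ge0.
rewrite add0n [X in _ + X]eseries0 ?adde0; last first.
  move=> k Ik _; rewrite /C insubF ?hausdorff_gauge0//.
  by apply/negbTE; rewrite -leqNgt.
rewrite big_mkord.
apply: (@le_trans _ _ (\sum_(i < #|I|) (ball_volume s * (d / 2) `^ s)%:E)).
  by apply: lee_sum => i _; rewrite /C valK; exact: hausdorff_gauge_le.
by rewrite sumEFin sumr_const card_ord [in leRHS]mulr_natl.
Qed.

Section cells.
Variable M : nat.
Hypothesis M0 : (0 < M)%N.

(** Central projection of a grid on the faces of the cube [-1, 1]^(n+1):
    [c.1.1] is the axis and [c.1.2] the sign of a face, [c.2] the index of a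
    grid cell of edge 2/M in this face, enlarged to twice its size about a
    corner. *)
Definition sphere_cell (c : 'I_n.+1 * bool * {ffun 'I_n -> 'I_M}) : set 'rV[R]_n.+1 :=
  [set x | [/\ enorm x = 1, 0 < (-1) ^+ c.1.2 * x ord0 c.1.1 &
    forall j, `|x ord0 (lift c.1.1 j) / ((-1) ^+ c.1.2 * x ord0 c.1.1)
      - (2 * (c.2 j)%:R / M%:R - 1)| <= 2 / M%:R]%R].

(** The face is that of a coordinate of largest absolute value, so that the
    ratios of the other coordinates to it lie in [-1, 1]. *)
Lemma sphere_cell_cover (x : 'rV[R]_n.+1) : enorm x = 1%R ->
  exists c, sphere_cell c x.
Proof.
move=> x1.
have [i _ imax] := @arg_maxP _ _ _ ord0 predT (fun i => `|x ord0 i|%R) isT.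
have xi0 : (0 < `|x ord0 i|)%R.
  rewrite normr_gt0; apply/eqP => xi0.
  suff x0 : x = 0%R by move: x1; rewrite x0 enorm0 => /eqP; rewrite eq_sym oner_eq0.
  apply/rowP => j; rewrite mxE; apply/eqP; rewrite -normr_le0.
  by have := imax j isT; rewrite xi0 normr0.
pose b := (x ord0 i < 0)%R.
have bE : ((-1) ^+ b * x ord0 i = `|x ord0 i|)%R by rewrite -normrEsign.
pose t j : R := ((x ord0 (lift i j) / `|x ord0 i| + 1) / 2 * M%:R)%R.
have M0' : (0 < M%:R :> R)%R by rewrite ltr0n.
have t01 j : (0 <= t j <= M%:R)%R.
  have : (`|x ord0 (lift i j) / `|x ord0 i| | <= 1)%R.
    by rewrite normrM normfV normr_id ler_pdivrMr// mul1r; exact: imax.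
  rewrite ler_norml => /andP[? ?].
  by rewrite /t mulr_ge0 ?divr_ge0//= ?ler_piMl//; lra.
have kP j : (minn (Num.truncn (t j)) M.-1 < M)%N.
  by rewrite (leq_ltn_trans (geq_minr _ _))// prednK.
exists (i, b, [ffun j => Ordinal (kP j)]); split => //=.
  by rewrite bE.
move=> j; rewrite bE ffunE /=.
have -> : (x ord0 (lift i j) / `|x ord0 i| = 2 * t j / M%:R - 1)%R.
  by rewrite /t; field; rewrite !gt_eqF.
set k := minn _ _.
have /andP[k1 k2] : (k%:R <= t j <= k%:R + 1)%R.
  have /andP[t0 tM] := t01 j.
  have kle : ((Num.truncn (t j))%:R <= t j)%R by rewrite truncn_le.
  rewrite /k; case: leqP => H.
    by rewrite kle /= ltW// natr1 truncnS_gt.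
  rewrite natr1 prednK// tM andbT (le_trans _ kle)// ler_nat ltnW//.
rewrite [X in `|X|%R](_ : _ = 2 * (t j - k%:R) / M%:R)%R; last by ring.
by rewrite ger0_norm ?ler_pM2r ?invr_gt0// ?divr_ge0 ?mulr_ge0//; lra.
Qed.

(** Two points of a cell, rescaled to lie on the face, are at distance at most
    4n/M; normalising them back to the sphere at most doubles this distance. *)
Lemma ediam_sphere_cell c : ediam (sphere_cell c) <= (8 * n%:R / M%:R)%:E.
Proof.
case: c => -[i b] k; apply: ediam_le => x y [/= x1 xi xc] [/= y1 yi yc].
move: xi yi xc yc; set a := (_ * x ord0 i)%R; set a' := (_ * y ord0 i)%R.
move=> a0 a'0 xc yc; rewrite lee_fin.
pose u := (a^-1 *: x)%R; pose v := (a'^-1 *: y)%R.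
have M0' : (0 < M%:R :> R)%R by rewrite ltr0n.
have uv : (enorm (u - v) <= 4 * n%:R / M%:R)%R.
  apply: (le_trans (enorm_le_sum _)).
  rewrite (bigD1_ord i)//= !mxE.
  have ui : (a^-1 * x ord0 i - a'^-1 * y ord0 i = 0)%R.
    have E (z : R) (z0 : (0 < (-1) ^+ b * z)%R) : (((-1) ^+ b * z)^-1 * z = (-1) ^+ b)%R.
      have z0' : (z != 0)%R by apply: contraTneq z0 => ->; rewrite mulr0 ltxx.
      by rewrite invfM -mulrA mulVf// mulr1 invr_sign.
    by rewrite !E// subrr.
  rewrite ui normr0 add0r.
  apply: (@le_trans _ _ (\sum_(j < n) (4 / M%:R))%R); last first.
    by rewrite sumr_const card_ord -[leLHS]mulr_natl; lra.
  apply: ler_sum => j _; rewrite !mxE.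
  have := xc j; have := yc j; rewrite ![(_ / a)%R]mulrC ![(_ / a')%R]mulrC.
  rewrite !ler_norml => /andP[? ?] /andP[? ?]; apply/andP; split; lra.
have au : (x = a *: u)%R by rewrite scalerA divff ?scale1r// gt_eqF.
have av : (y = a' *: v)%R by rewrite scalerA divff ?scale1r// gt_eqF.
have a1 : (a * enorm u = 1)%R by rewrite -{1}(gtr0_norm a0) -enormZ -au.
have a'1 : (a' * enorm v = 1)%R by rewrite -{1}(gtr0_norm a'0) -enormZ -av.
have ale (z : 'rV[R]_n.+1) : (enorm z = 1 -> (-1) ^+ b * z ord0 i <= 1)%R.
  move=> z1; rewrite -[leRHS]z1; apply: le_trans (coor_le_enorm z i).
  by rewrite (le_trans (ler_norm _))// normrM normr_sign mul1r.
have a_1 : (a <= 1)%R by exact: ale.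
have a'_1 : (a' <= 1)%R by exact: ale.
have aa' : (`|a - a'| * enorm v <= enorm (u - v))%R.
  have n1 : (enorm v <= enorm u + enorm (u - v))%R.
    by have := enormBD v u 0; rewrite !subr0 enormB addrC.
  have n2 : (enorm u <= enorm v + enorm (u - v))%R.
    by have := enormBD u v 0; rewrite !subr0 addrC.
  rewrite -[X in (_ * X)%R](ger0_norm (enorm_ge0 v)) -normrM mulrBl a'1 -a1 -mulrBr.
  rewrite normrM (gtr0_norm a0); apply: (@le_trans _ _ (1 * enorm (u - v))%R); last by rewrite mul1r.
  apply: ler_pM => //; first exact: ltW.
  by rewrite ler_norml; apply/andP; split; lra.
have -> : (x - y = a *: (u - v) + (a - a') *: v)%R.
  by rewrite {1}au {1}av scalerBr scalerBl addrA subrK.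
apply: (le_trans (enormD _ _)); rewrite (enormZ a) (enormZ (a - a')%R v) (gtr0_norm a0).
have : (a * enorm (u - v) <= enorm (u - v))%R by rewrite ler_piMl ?enorm_ge0.
lra.
Qed.

End cells.

(** There are 2 (n+1) M^n cells, of diameter O(1/M), so that the contents stay
    bounded as M grows. *)
Lemma hausdorff_sphere_lty : @hausdorff R n.+1 n%:R S < +oo.
Proof.
apply: (@le_lt_trans _ _ ((n.+1 * 2)%:R * (ball_volume (n%:R : R) * (4 * n%:R) ^+ n))%:E); last exact: ltry.
apply: ge_ereal_sup => _ [d d0 <-].
pose M := (Num.truncn (8 * n%:R / d)%R).+1.
have M0' : (0 < M%:R :> R)%R by rewrite ltr0n.
have Md : (8 * n%:R / M%:R <= d)%R.
  by rewrite ler_pdivrMr// [leRHS]mulrC -ler_pdivrMr// ltW// /M truncnS_gt.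
have c0 : (0 <= 8 * n%:R / M%:R :> R)%R by rewrite divr_ge0// mulr_ge0.
apply: (le_trans (hausdorff_content_finite_cover (F := @sphere_cell M) _ c0 Md _ _)) => //.
- by move=> x Sx; exact: sphere_cell_cover.
- by move=> c; exact: ediam_sphere_cell.
rewrite lee_fin !card_prod card_ffun !card_ord card_bool natrM -mulrA.
apply: ler_wpM2l => //; rewrite mulrCA; apply: ler_wpM2l; first exact: ball_volume_ge0.
rewrite powR_mulrn; last by rewrite divr_ge0.
rewrite natrX -exprMn; apply: lerXn2r; rewrite ?nnegrE.
- by rewrite mulr_ge0// divr_ge0.
- by rewrite mulr_ge0.
by rewrite le_eqVlt; apply/orP; left; apply/eqP; field; rewrite gt_eqF.
Qed.

(** Dropping the first coordinate is 1-Lipschitz and maps the sphere onto the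
    closed unit ball of dimension n. Hence a cover of the sphere by sets of
    diameter d_k yields a cover of the open unit ball by cubes of edge 2 d_k,
    whose total volume is at least that of the ball. *)
Lemma hausdorff_sphere_gt0 : 0 < @hausdorff R n.+1 n%:R S.
Proof.
have bv0 := ball_volume_gt0 (R := R) n.
(* the ratio of the volume of a cube of edge 2d to the gauge of a set of
   diameter d *)
pose c := (4 ^+ n / ball_volume (n%:R : R))%R.
have c0 : (0 < c)%R by rewrite divr_gt0// exprn_gt0.
suff H : lebesgue_rV n (ball0 1) <= c%:E * @hausdorff R n.+1 n%:R S.
  have := lt_le_trans (lebesgue_ball_gt0 (n := n) (ltr01 (R := R))) H.
  rewrite lt0e => /andP[+ _]; rewrite mule_eq0 negb_or => /andP[_ h0].
  by rewrite lt0e h0 hausdorff_ge0.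
apply: (@le_trans _ _ (c%:E * hausdorff_content n%:R 1 S)); last first.
  by rewrite lee_pmul2l ?lte_fin// hausdorff_content_le.
rewrite -lee_pdivrMl//; apply: le_ereal_inf_tmp => _ [C [SC Cd] <-].
rewrite lee_pdivrMl//.
pose P (x : 'rV[R]_n.+1) : 'rV[R]_n := \row_j x ord0 (lift ord0 j).
pose diam k := fine (ediam (C k)).
(* a cube centred at the projection of some point of C k *)
pose K k : set 'rV[R]_n := if pselect (exists x, C k x) is left xP then
  let p := P (projT1 (cid xP)) in
  rect (fun j => `[(p ord0 j - diam k)%R, (p ord0 j + diam k)%R]%classic)
  else set0.
have mK k : measurable (K k).
  rewrite /K; case: pselect => // xP; apply: measurable_rect => i; exact: measurable_itv.
have BK : ball0 1 `<=` \bigcup_k K k.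
  move=> y yB.
  have y1 : (dot y y < 1)%R.
    by rewrite -enorm_sqr expr_lt1 ?enorm_ge0.
  pose x : 'rV[R]_n.+1 := rV_cons (Num.sqrt (1 - dot y y)%R, y).
  have Px : P x = y by apply/rowP => j; rewrite !mxE liftK.
  have Sx : S x.
    rewrite /unit_sphere /= /enorm /dot big_ord_recl mxE unlift_none /= -expr2.
    rewrite sqr_sqrtr ?subr_ge0 ?ltW//.
    under eq_bigr do rewrite !mxE liftK.
    by rewrite subrK sqrtr1.
  have [k _ Ckx] := SC _ Sx; exists k => //; rewrite /K.
  case: pselect => [xP|]; last by case; exists x.
  case: cid => z /= Cz j; rewrite /= in_itv/= -lter_distl -Px !mxE.
  rewrite (le_trans (_ : _ <= enorm (z - x))%R)//.
    by have := coor_le_enorm (x - z) (lift ord0 j); rewrite enormB !mxE.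
  rewrite -lee_fin fineK ?enorm_le_ediam//.
  rewrite ge0_fin_numE ?(le_lt_trans (Cd k)) ?ltry//.
  by rewrite (le_trans _ (enorm_le_ediam Cz Cz))// lee_fin enorm_ge0.
have := measure_sigma_subadditive (lebesgue_rV n) mK (measurable_ball0 1) BK.
move=> /le_trans; apply; rewrite -nneseriesZl; last first.
  by move=> k _; exact: hausdorff_gauge_ge0.
apply: lee_nneseries => [k _ _|k _]; first exact: measure_ge0.
rewrite /K; case: pselect => [xP|_]; last first.
  by rewrite measure0 mule_ge0 ?hausdorff_gauge_ge0// lee_fin ltW.
case: cid => z /= Cz.
rewrite lebesgue_rect; last by move=> i; exact: measurable_itv.
have E0 : 0 <= ediam (C k).
  by rewrite (le_trans _ (enorm_le_ediam Cz Cz))// lee_fin enorm_ge0.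
have Ef : ediam (C k) \is a fin_num.
  by rewrite ge0_fin_numE ?(le_lt_trans (Cd k)) ?ltry.
have d0 : (0 <= diam k)%R by exact: fine_ge0.
rewrite /hausdorff_gauge ifF; last by apply/negbTE/set0P; exists z.
rewrite [X in X `^ _](_ : _ = (diam k / 2)%:E); last by rewrite EFinM fineK.
rewrite poweR_EFin -!EFinM powR_mulrn; last by rewrite divr_ge0.
rewrite [leLHS](_ : _ = ((2 * diam k) ^+ n)%:E); last first.
  rewrite (eq_bigr (fun=> (2 * diam k)%:E)) => [|i _].
    by rewrite prodEFin prodr_const card_ord.
  rewrite lebesgue_measure_itv/= lte_fin; case: ifPn => H.
    by rewrite -EFinB; congr (_%:E); ring.
  by congr (_%:E); move: H; rewrite -leNgt; lra.
rewrite lee_fin /c mulrA divfK ?gt_eqF// -exprMn le_eqVlt; apply/orP; left.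
by apply/eqP; congr (_ ^+ _)%R; field.
Qed.

End hausdorff_sphere.

(** * The constant as an integral over the unit ball *)

Lemma measurable_powabs (R : realType) d (T : measurableType d) (p : R) (F : T -> R) :
  measurable_fun setT F -> measurable_fun setT (fun x => (`|F x| `^ p)%:E).
Proof.
move=> mF; apply/measurable_EFinP; apply: (measurableT_comp (measurable_powR p)).
exact: measurableT_comp.
Qed.

Section directional_kernel.
Context {R : realType} {n : nat}.
Variable p : R.
Hypothesis p0 : 0 < p.
Implicit Types (u w x : 'rV[R]_n).

(** As a function of [x] this is homogeneous of degree 0 and agrees with |<u,
    x>|^p on the unit sphere, so that it relates integrals over the sphere to
    integrals over the ball. *)
Definition dirker u x : R := `|dot u x| `^ p / enorm x `^ p.

Lemma dirker_ge0 u x : 0 <= dirker u x.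
Proof. by rewrite divr_ge0 ?powR_ge0. Qed.

Lemma dirkerZl a u x : dirker (a *: u) x = `|a| `^ p * dirker u x.
Proof. by rewrite /dirker dotZl normrM powRM// mulrA. Qed.

Lemma dirkerZr a u x : a != 0 -> dirker u (a *: x) = dirker u x.
Proof.
move=> a0; rewrite /dirker dotZr enormZ normrM !powRM ?enorm_ge0//.
by rewrite -mulf_div divff ?mul1r// gt_eqF// powR_gt0// normr_gt0.
Qed.

Lemma dirker0r u : dirker u 0 = 0.
Proof. by rewrite /dirker dotC dot0l normr0 powR0 ?mul0r// gt_eqF. Qed.

Lemma dirker_reflect v u x : v != 0 ->
  dirker (reflect_along v u) (reflect_along v x) = dirker u x.
Proof. by move=> v0; rewrite /dirker (dot_reflect _ _ v0) (enorm_reflect _ v0). Qed.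

Lemma measurable_dirker d (T : measurableType d) (f g : T -> 'rV[R]_n) :
  measurable_fun setT f -> measurable_fun setT g ->
  measurable_fun setT (fun t => dirker (f t) (g t)).
Proof.
move=> mf mg; apply: measurable_funM.
  apply: (measurableT_comp (measurable_powR p)).
  by apply: measurableT_comp => //; exact: measurable_dot.
under eq_fun do rewrite -powRN.
apply: (measurableT_comp (measurable_powR (- p))).
exact: measurable_enorm_comp.
Qed.

Local Open Scope ereal_scope.
Local Notation leb := (@lebesgue_rV R n).

Definition dirker_mass w : \bar R := \int[leb]_(x in ball0 1) (dirker w x)%:E.

(** The reflection exchanging the two vectors preserves the ball and Lebesgue
    measure. *)
Lemma dirker_mass_unit w w' : enorm w = 1%R -> enorm w' = 1%R ->
  dirker_mass w = dirker_mass w'.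
Proof.
move=> w1 w'1; have [->//|ww'] := eqVneq w w'.
pose T := @reflect_along R n (w - w')%R.
have u0 : (w - w' != 0)%R by rewrite subr_eq0.
have mT : measurable_fun setT T by exact: measurable_reflect.
rewrite /dirker_mass integral_mkcond [RHS]integral_mkcond.
set g := (X in _ = \int[leb]_x X x).
have mg : measurable_fun setT g.
  apply/(measurable_restrictT _ (measurable_ball0 1)).
  by apply/measurable_funTS/measurable_EFinP; apply: measurable_dirker.
have g0 x : 0 <= g x by apply: erestrict_ge0 => y _; rewrite lee_fin dirker_ge0.
rewrite -(ge0_integral_pushforwardT mT (fun A mA => lebesgue_reflect u0 mA) mg g0).
rewrite /g.
apply: eq_integral => x _; rewrite !patchE /T.
have -> : (reflect_along (w - w') x \in ball0 1) = (x \in ball0 1).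
  by apply/idP/idP; rewrite !inE /ball0 /= enorm_reflect.
by rewrite -{1}(reflect_unit w1 w'1 ww') dirker_reflect.
Qed.

Lemma dirker_massZ w u : enorm w = 1%R ->
  dirker_mass u = (enorm u `^ p)%:E * dirker_mass w.
Proof.
move=> w1; have [->|u0] := eqVneq u 0%R.
  rewrite enorm0 powR0 ?gt_eqF// mul0e /dirker_mass integral0_eq// => x _.
  by rewrite /dirker dot0l normr0 powR0 ?gt_eqF// mul0r.
have nu0 : (enorm u != 0)%R by rewrite enorm_eq0.
have uE : u = (enorm u *: ((enorm u)^-1 *: u))%R by rewrite scalerA divff ?scale1r.
rewrite [in LHS]uE -(@dirker_mass_unit ((enorm u)^-1 *: u)%R w)//; last first.
  by rewrite enormZ ger0_norm ?invr_ge0 ?enorm_ge0// mulVf.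
rewrite /dirker_mass -ge0_integralZl//; first last.
- by rewrite lee_fin powR_ge0.
- by move=> x _; rewrite lee_fin dirker_ge0.
- apply/measurable_funTS/measurable_EFinP; apply: measurable_dirker => //.
- exact: measurable_ball0.
by apply: eq_integral => x _; rewrite dirkerZl ger0_norm ?enorm_ge0// EFinM.
Qed.

End directional_kernel.

Section K_constant.
Context {R : realType} {n : nat}.
Variable p : R.
Hypothesis p0 : (0 < p)%R.
Local Open Scope ereal_scope.
Local Notation V := 'rV[R]_n.+1.
Local Notation S := (unit_sphere : set V).
Local Notation leb := (@lebesgue_rV R n.+1).
Local Notation Ho := (@hausdorff_outer R n.+1 n%:R).
Local Notation CT := (caratheodory_type Ho).
Local Notation hm := (@hausdorff_measure R n.+1 n%:R).

Lemma measurable_sphere : measurable S.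
Proof.
rewrite (_ : S = @enorm R n.+1 @^-1` [set 1%R]); last by [].
by rewrite -[X in measurable X]setTI; apply: measurable_enorm.
Qed.

Lemma origin_rect : [set (0 : V)%R] = rect (fun _ : 'I_n.+1 => [set (0%R : R)]).
Proof.
apply/seteqP; split=> [x -> i|x x0]; first by rewrite mxE.
by apply/rowP => i; rewrite mxE x0.
Qed.

Lemma lebesgue_origin : leb [set 0%R] = 0.
Proof.
rewrite origin_rect lebesgue_rect; last by move=> i; exact: measurable_set1.
by rewrite big_ord_recl lebesgue_measure_set1 mul0e.
Qed.

(** The Hausdorff measure lives on the Caratheodory sigma-algebra; this
    restriction is a finite measure on the Borel sigma-algebra, to which
    Fubini's theorem applies together with Lebesgue measure. *)
Definition sphere_measure (A : set V) : \bar R := Ho (A `&` S).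

Let sphere_measure0 : sphere_measure set0 = 0.
Proof. by rewrite /sphere_measure set0I outer_measure0. Qed.

Let sphere_measure_ge0 A : 0 <= sphere_measure A.
Proof. exact: outer_measure_ge0. Qed.

Let caraS A : measurable A -> (Ho).-cara.-measurable (A `&` S : set CT).
Proof.
move=> mA; apply: (borel_caratheodory n%:R).
exact: measurableI mA measurable_sphere.
Qed.

Let sphere_measure_sigma_additive : semi_sigma_additive sphere_measure.
Proof.
move=> F mF tF mUF; rewrite /sphere_measure setI_bigcupl.
apply: (@measure_semi_sigma_additive _ _ _ hm (fun i => F i `&` S : set CT)).
- by move=> i; exact: caraS.
- exact: trivIset_setIr.
- by rewrite -setI_bigcupl; exact: caraS.
Qed.

HB.instance Definition _ := isMeasure.Build _ _ _ sphere_measure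
  sphere_measure0 sphere_measure_ge0 sphere_measure_sigma_additive.

Let sphere_measure_fin : fin_num_fun sphere_measure.
Proof.
move=> A mA; rewrite ge0_fin_numE; last exact: outer_measure_ge0.
apply: le_lt_trans (hausdorff_sphere_lty (R := R) (n := n)).
by apply: (le_hausdorff n%:R); exact: subIsetr.
Qed.

HB.instance Definition _ := Measure_isFinite.Build _ _ _ sphere_measure
  sphere_measure_fin.

Lemma integral_hausdorff_sphere (g : V -> \bar R) : measurable_fun setT g ->
  (forall v, 0 <= g v) ->
  \int[hm]_(v in S) g v = \int[sphere_measure]_v g v.
Proof.
move=> mg g0.
have mid : measurable_fun setT (id : CT -> V).
  by move=> _ A mA; rewrite setTI; exact: (borel_caratheodory n%:R mA).
have mSc : (Ho).-cara.-measurable (S : set CT).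
  exact: (borel_caratheodory n%:R measurable_sphere).
have m1 : measurable_fun setT (\1_(S : set CT) : CT -> R) by exact: measurable_indic.
have h0 (x : CT) : (0 <= (\1_(S : set CT) x : R))%R by [].
have hnu (A : set V) : measurable A ->
    \int[hm]_(x in (id : CT -> V) @^-1` A) (\1_(S : set CT) x)%:E = sphere_measure A.
  move=> mA; rewrite integral_indic//; last exact: (borel_caratheodory n%:R mA).
  by rewrite /sphere_measure setIC.
rewrite -(ge0_integral_weighted m1 h0 mid hnu mg g0) [LHS]integral_mkcond.
apply: eq_integral => v _; rewrite patchE indicE.
by case: ifP; rewrite ?mule1 ?mule0.
Qed.

Lemma sphere_measure_reflect u (A : set V) : (u != 0)%R ->
  sphere_measure (reflect_along u @^-1` A) = sphere_measure A.
Proof.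
move=> u0; rewrite /sphere_measure -[RHS](@hausdorff_isometry _ _ _ (reflect_along u)).
- rewrite preimage_setI; congr (hausdorff _ (_ `&` _)); apply/funext => x.
  by rewrite /preimage /unit_sphere /= enorm_reflect.
- exact: reflect_alongK.
- move=> x y; rewrite -[RHS](enorm_reflect (x - y) u0) reflect_alongD.
  congr (enorm (_ + _)).
  by rewrite /reflect_along dotNr mulrN mulNr scaleNr opprB opprK addrC.
Qed.

Definition sphere_moment (w : V) : \bar R := \int[hm]_(v in S) (`|dot w v| `^ p)%:E.

Lemma sphere_momentE w :
  sphere_moment w = \int[sphere_measure]_v (`|dot w v| `^ p)%:E.
Proof.
apply: (integral_hausdorff_sphere (g := fun v => (`|dot w v| `^ p)%:E)).
  by apply: measurable_powabs; exact: measurable_dot.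
by move=> v; rewrite lee_fin powR_ge0.
Qed.

Lemma sphere_moment_unit w w' : S w -> S w' -> sphere_moment w = sphere_moment w'.
Proof.
move=> w1 w'1; have [->//|ww'] := eqVneq w w'.
have u0 : (w - w' != 0)%R by rewrite subr_eq0.
have mT := measurable_reflect (w - w')%R.
rewrite !sphere_momentE.
pose g v : \bar R := (`|dot w' v| `^ p)%:E.
have mg : measurable_fun setT g by apply: measurable_powabs; exact: measurable_dot.
have g0 v : 0 <= g v by rewrite lee_fin powR_ge0.
rewrite -[RHS](ge0_integral_pushforwardT (m := sphere_measure) (m' := sphere_measure)
  mT (fun A _ => sphere_measure_reflect A u0) mg g0).
apply: eq_integral => v _; rewrite /g.
by rewrite -{1}(reflect_unit w1 w'1 ww') dot_reflect.
Qed.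

(** Integrate |<v, x>|^p / |x|^p over v in the sphere and x in the ball. For
    each v the inner integral is [dirker_mass p w], and for each x other than
    0 it is the moment of w over the sphere, both by invariance under
    reflections. It remains to divide by the measure of the sphere. *)
Lemma K_constE w : S w -> K_const p w = dirker_mass p w.
Proof.
move=> Sw.
have m0 : measurable [set (0 : V)%R].
  by rewrite origin_rect; apply: measurable_rect => i; exact: measurable_set1.
have mB0 : measurable (ball0 1 `\ (0 : V)%R).
  by apply: measurableD => //; exact: measurable_ball0.
have Fub : dirker_mass p w * hm S = leb unit_ball * sphere_moment w.
  pose k (z : V * V) : \bar R := (dirker p z.1 z.2)%:E * (\1_(ball0 1 : set V) z.2)%:E.
  have mk : measurable_fun setT k.
    apply: emeasurable_funM; apply/measurable_EFinP; first exact: measurable_dirker.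
    apply: (@measurableT_comp _ _ _ _ _ _ (\1_(ball0 1 : set V) : V -> R)); last exact: measurable_snd.
    by apply: measurable_indic; exact: measurable_ball0.
  have k0 z : 0 <= k z by rewrite /k mule_ge0// lee_fin dirker_ge0.
  transitivity (\int[sphere_measure]_v \int[leb]_x k (v, x)).
    rewrite -(integral_hausdorff_sphere (g := fun v => \int[leb]_x k (v, x))); last 2 first.
    - exact: (measurable_fun_fubini_tonelli_F (m2 := leb) k mk k0).
    - by move=> v; apply: integral_ge0.
    have mSc : (Ho).-cara.-measurable (S : set CT).
      exact: (borel_caratheodory n%:R measurable_sphere).
    rewrite -[LHS](integral_cst hm mSc); apply: eq_integral => v; rewrite inE => Sv.
    rewrite /cst (dirker_mass_unit p Sw Sv) /dirker_mass [LHS]integral_mkcond.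
    apply: eq_integral => x _; rewrite patchE /k /= indicE.
    by case: ifP; rewrite ?mule1 ?mule0.
  rewrite (fubini_tonelli k mk k0).
  transitivity (\int[leb]_x ((\1_(ball0 1 `\ (0%R : V)) x)%:E * sphere_moment w)).
    apply: eq_integral => x _; rewrite /k /= ge0_integralZr//; first last.
    - by move=> v _; rewrite lee_fin dirker_ge0.
    - by apply/measurable_EFinP; apply: measurable_dirker.
    rewrite muleC; have [->|x0] := eqVneq x 0%R.
      rewrite integral0_eq ?mule0.
        by rewrite indicE memNset ?mul0e// => -[_]; apply.
      by move=> v _; rewrite dirker0r.
    have -> : \1_(ball0 1 `\ (0%R : V)) x = \1_(ball0 1 : set V) x :> R.
      rewrite !indicE; congr ((_ : bool)%:R); apply/idP/idP; rewrite !inE; first by case.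
      by move=> xB; split => // /= /eqP; apply/negP.
    congr (_ * _).
    have nx0 : (enorm x != 0)%R by rewrite enorm_eq0.
    have Sx : S ((enorm x)^-1 *: x)%R.
      by rewrite /unit_sphere /= enormZ ger0_norm ?invr_ge0 ?enorm_ge0// mulVf.
    rewrite (sphere_moment_unit Sw Sx) sphere_momentE.
    apply: eq_integral => v _; rewrite -(dirkerZr p (a := (enorm x)^-1%R)) ?invr_eq0//.
    by rewrite /dirker Sx powR1 divr1 dotC.
  rewrite ge0_integralZr//; last 2 first.
  - by apply/measurable_EFinP; apply: measurable_indic.
  - by apply: integral_ge0 => v _; rewrite lee_fin powR_ge0.
  congr (_ * _); rewrite integral_indic ?setIT//= unit_ballE.
  apply/eqP; rewrite eq_le; apply/andP; split.
    by apply: le_measure; rewrite ?inE//; exact: measurable_ball0.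
  rewrite -[leRHS]adde0 -lebesgue_origin.
  apply: le_trans (measureU2 leb mB0 m0).
  apply: le_measure; rewrite ?inE//; [exact: measurable_ball0|exact: measurableU|].
  by move=> x xB; have [->|/eqP x0] := eqVneq x 0%R; [right|left].
have hS0 : hm S != 0 by rewrite gt_eqF//; exact: hausdorff_sphere_gt0.
have hSf : hm S \is a fin_num.
  rewrite ge0_fin_numE; first exact: hausdorff_sphere_lty.
  exact: outer_measure_ge0.
rewrite /K_const /= -/(sphere_moment w) muleAC -Fub.
by rewrite -muleA divee ?mule1.
Qed.

End K_constant.

(** * Smooth test functions supported in boxes *)

Section bump.
Context {R : realType}.
Implicit Types (t : R) (m : nat).

(** With the extra parameter [m] the family is closed under derivation up to
    linear combinations, so that one induction shows all its members to be
    smooth; [bump 0] is the classical smooth function that vanishes exactly on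
    the nonpositive half-line. *)
Definition bump m t : R := if 0 < t then t^-1 ^+ m * expR (- t^-1) else 0.

Lemma bump_ge0 m t : 0 <= bump m t.
Proof.
rewrite /bump; case: ifPn => // t0.
by rewrite mulr_ge0 ?expR_ge0// exprn_ge0// invr_ge0 ltW.
Qed.

(** The exponential of 1/t dominates the term of degree m+1 of its power
    series. *)
Lemma bump_le m t : `|bump m t| <= (m.+1)`!%:R * `|t|.
Proof.
rewrite ger0_norm ?bump_ge0// /bump; case: ifPn => t0; last by rewrite mulr_ge0.
rewrite (gtr0_norm t0) expRN ler_pdivrMr ?expR_gt0//.
have u0 : 0 <= t^-1 by rewrite invr_ge0 ltW.
have := expR_ge1Dxn m u0.
have f0 : 0 < (m.+1)`!%:R :> R by rewrite ltr0n fact_gt0.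
move=> H; have {}H : t^-1 ^+ m.+1 <= (m.+1)`!%:R * expR t^-1.
  by rewrite mulrC -ler_pdivrMr//; lra.
rewrite exprSr in H.
by rewrite mulrAC -ler_pdivrMr.
Qed.

Lemma is_derive_bump m t :
  is_derive t 1 (bump m) (- m%:R * bump m.+1 t + bump m.+2 t).
Proof.
have [t0|t0|->] := ltgtP t 0.
- rewrite /bump !ltNge (ltW t0)/= mulr0 addr0.
  apply: (near_eq_is_derive _ (is_derive_cst (0 : R) t 1)).
  have : \forall s \near t, s < 0 by exact: lt_nbhsl.
  by apply: filterS => s s0; rewrite /= ltNge ltW.
- have tn0 : t != 0 by rewrite gt_eqF.
  have dV := is_deriveV tn0 (is_derive_id t 1).
  have dX := is_deriveX m dV.
  have dE := @is_derive1_comp R expR (- (fun s : R => s^-1)) t _ _ (is_derive_expR (- t^-1)) (is_deriveN dV).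
  have dM := is_deriveM dX dE.
  apply: (@near_eq_is_derive _ _ _ ((fun s : R => s^-1) ^+ m * (expR \o - (fun s : R => s^-1)))).
    have : \forall s \near t, 0 < s by exact: lt_nbhsr.
    by apply: filterS => s s0; rewrite /bump s0 mulrfctE exprfctE.
  apply: (is_derive_eq dM).
  rewrite /bump t0 /= /GRing.scale /=.
  rewrite !fctE /=.
  case: m {dX dM} => [|m]; rewrite /= ?expr0 ?exprS; field; exact: tn0.
(* at 0 the difference quotient of bump m is bump m.+1, which tends to 0 *)
- have -> : - m%:R * bump m.+1 0 + bump m.+2 0 = 0 :> R.
    by rewrite /bump ltxx mulr0 addr0.
  have H : h^-1 *: ((bump m \o shift 0) (h *: 1) - bump m 0) @[h --> 0^'] --> (0 : R).
    apply/cvgrPdist_le => e e0; near=> h.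
    rewrite sub0r normrN /= addr0 /GRing.scale /= mulr1.
    rewrite {2}/bump ltxx subr0.
    have -> : h^-1 * bump m h = bump m.+1 h.
      rewrite /bump; case: ifP; last by rewrite mulr0.
      by rewrite exprS mulrA.
    apply: (le_trans (bump_le _ _)).
    have f0 : 0 < (m.+2)`!%:R :> R by rewrite ltr0n fact_gt0.
    rewrite -ler_pdivlMl//.
    near: h; apply: (@cvg_within _ _); exists (((m.+2)`!%:R)^-1 * e) => /=.
      by rewrite mulr_gt0// invr_gt0.
    by move=> y /=; rewrite sub0r normrN => /ltW.
  by apply: DeriveDef; [apply/cvg_ex; exists 0|apply/cvg_lim].
Unshelve. all: by end_near.
Qed.

Lemma continuous_bump m : continuous (bump m).
Proof.
move=> t; have [/derivable1_diffP/differentiable_continuous] := is_derive_bump m t.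
exact.
Qed.

Lemma measurable_bump m : measurable_fun setT (bump m).
Proof. by apply: continuous_measurable_fun; exact: continuous_bump. Qed.

Lemma bump0_le1 t : bump 0 t <= 1.
Proof.
rewrite /bump; case: ifPn => // t0.
by rewrite expr0 mul1r -expR0 ler_expR oppr_le0 invr_ge0 ltW.
Qed.

Lemma bump0_cvg t : bump 0 (k.+1%:R * t) @[k --> \oo] --> ((0 < t)%R%:R : R).
Proof.
case: (ltP 0 t) => t0; last first.
  apply: cvg_near_cst; apply: nearW => k.
  by rewrite /bump ltNge mulr_ge0_le0.
have -> : (fun k => bump 0 (k.+1%:R * t)) = (fun k => expR (- (k.+1%:R^-1 * t^-1))).
  by apply/funext => k; rewrite /bump mulr_gt0// expr0 mul1r invfM.
rewrite -[X in _ --> X](expR0) -[X in expR X]oppr0 -[X in expR (- X)](mul0r t^-1).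
apply: continuous_cvg; first exact: continuous_expR.
apply: cvgN.
by apply: (@cvgM _ _ _ _ (fun k => k.+1%:R^-1) (fun=> t^-1)); [exact: cvg_harmonic|exact: cvg_cst].
Qed.

End bump.

Section Ck.
Context {R : realType} {N : nat}.
Implicit Types (f g : 'rV[R]_N -> R) (i j : 'I_N).

Lemma is_Ck_continuous k f : is_Ck k f -> continuous f.
Proof. by case: k => [|k] []. Qed.

Lemma is_CkW k f : is_Ck k.+1 f -> is_Ck k f.
Proof.
elim: k f => [|k IH] f; first by case.
move=> [cf H]; split => // i; have [df Hi] := H i.
by split => //; exact: IH.
Qed.

Lemma is_Ck_cst k (c : R) : is_Ck k ((fun=> c) : 'rV[R]_N -> R).
Proof.
elim: k c => [|k IH] c; (split; first exact: cst_continuous) => // i.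
split; first by move=> x; exact: derivable_cst.
rewrite (_ : partial i _ = fun=> 0); first exact: IH.
by apply/funext => x; rewrite /partial derive_cst.
Qed.

Lemma is_CkD k f g : is_Ck k f -> is_Ck k g -> is_Ck k (f + g).
Proof.
elim: k f g => [|k IH] f g Hf Hg;
  have cf := is_Ck_continuous Hf; have cg := is_Ck_continuous Hg;
  (split; first by move=> x; exact: (continuousD (cf x) (cg x))) => // i.
case: Hf Hg => _ /(_ i)[df Hf] [_ /(_ i)[dg Hg]].
split; first by move=> x; exact: derivableD.
rewrite (_ : partial i _ = partial i f + partial i g); first exact: IH.
by apply/funext => x; rewrite /partial deriveD.
Qed.

Lemma is_CkM k f g : is_Ck k f -> is_Ck k g -> is_Ck k (f * g).
Proof.
elim: k f g => [|k IH] f g Hf Hg;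
  have cf := is_Ck_continuous Hf; have cg := is_Ck_continuous Hg;
  (split; first by move=> x; exact: (continuousM (cf x) (cg x))) => // i.
have Hf' := is_CkW Hf; have Hg' := is_CkW Hg.
case: Hf Hg => _ /(_ i)[df Hf] [_ /(_ i)[dg Hg]].
split; first by move=> x; exact: derivableM.
rewrite (_ : partial i _ = f * partial i g + g * partial i f).
  by apply: is_CkD; exact: IH.
by apply/funext => x; rewrite /partial deriveM.
Qed.

Lemma is_Ck_prod k (s : seq 'I_N) (F : 'I_N -> 'rV[R]_N -> R) :
  (forall i, is_Ck k (F i)) -> is_Ck k (fun x => \prod_(i <- s) F i x).
Proof.
move=> HF; elim: s => [|i s IH].
  by under eq_fun do rewrite big_nil; exact: is_Ck_cst.
under eq_fun do rewrite big_cons.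
exact: (is_CkM (HF i) IH).
Qed.

Lemma derivative_coor i j (g : R -> R) (x : 'rV[R]_N) :
  (fun h : R => h^-1 *: (((fun y : 'rV[R]_N => g (y ord0 i)) \o shift x)
      (h *: delta_mx ord0 j) - g (x ord0 i))) =
  if i == j then (fun h : R => h^-1 *: ((g \o shift (x ord0 i)) (h *: 1) - g (x ord0 i)))
  else fun=> 0.
Proof.
apply/funext => h; rewrite /= !mxE eqxx /=.
case: eqP => [->|_]; first by rewrite /GRing.scale.
by rewrite mulr0 add0r subrr scaler0.
Qed.

Lemma is_Ck_bump k m (c d : R) i :
  is_Ck k (fun x : 'rV[R]_N => bump m (c * x ord0 i + d)).
Proof.
have cb m' : continuous (fun x : 'rV[R]_N => bump m' (c * x ord0 i + d)).
  move=> x; apply: (@continuous_comp 'rV[R]_N R R (fun y => c * y ord0 i + d) (bump m')); last exact: continuous_bump.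
  apply: (@continuousD R R 'rV[R]_N (fun y => c * y ord0 i) (fun=> d) x); last exact: cst_continuous.
  by apply: (@continuousM R 'rV[R]_N (fun=> c) (fun y => y ord0 i) x); [exact: cst_continuous|exact: coord_continuous].
elim: k m => [|k IH] m; split => //.
move=> j.
pose g t : R := bump m (c * t + d).
pose dg t : R := c * (- m%:R * bump m.+1 (c * t + d) + bump m.+2 (c * t + d)).
have gd (t : R) : is_derive t 1 g (dg t).
  have H1 : is_derive t 1 (fun t : R => c * t + d) c.
    by apply: is_derive_eq; rewrite ?addr0 /GRing.scale/= ?mulr1 ?mulr0 ?addr0 ?add0r.
  have := @is_derive1_comp R (bump m) (fun t : R => c * t + d) t _ _ (is_derive_bump m (c * t + d)) H1.
  by move=> H; apply: (is_derive_eq H); rewrite /dg mulrC.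
have E : (fun x : 'rV[R]_N => g (x ord0 i)) = (fun x : 'rV[R]_N => bump m (c * x ord0 i + d)) by [].
rewrite -E; split.
  move=> x; rewrite /derivable derivative_coor; case: ifP => _.
    by case: (gd (x ord0 i)).
  by apply/cvg_ex; exists 0; exact: cvg_cst.
have [ij|ij] := eqVneq i j; last first.
  rewrite (_ : partial j _ = fun=> 0); first exact: is_Ck_cst.
  apply/funext => x; rewrite /partial /derive derivative_coor (negbTE ij).
  by apply/cvg_lim => //; exact: cvg_cst.
rewrite (_ : partial j _ = (fun=> c) * ((fun=> - m%:R) *
   (fun x : 'rV[R]_N => bump m.+1 (c * x ord0 i + d)) +
   (fun x : 'rV[R]_N => bump m.+2 (c * x ord0 i + d)))).
  apply: is_CkM; first exact: is_Ck_cst.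
  apply: is_CkD; last exact: IH.
  by apply: is_CkM; [exact: is_Ck_cst|exact: IH].
apply/funext => x; rewrite /partial /derive derivative_coor ij eqxx.
have [_] := gd (x ord0 j); rewrite /derive => ->.
by [].
Qed.

(** Test functions supported in the closed box that increase with [k] to the
    indicator of the open box. *)
Definition boxbump (a b : 'rV[R]_N) (k : nat) (x : 'rV[R]_N) : R :=
  \prod_(i < N) (bump 0 (k.+1%:R * (x ord0 i - a ord0 i)) *
                 bump 0 (k.+1%:R * (b ord0 i - x ord0 i))).

Lemma boxbump_ge0 a b k x : 0 <= boxbump a b k x.
Proof. by apply: prodr_ge0 => i _; rewrite mulr_ge0 ?bump_ge0. Qed.

Lemma boxbump_out (a b : 'rV[R]_N) k (x : 'rV[R]_N) i : ~~ (a ord0 i < x ord0 i < b ord0 i) ->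
  boxbump a b k x = 0.
Proof.
move=> H; rewrite /boxbump (bigD1 i)//=; apply/eqP; rewrite mulf_eq0; apply/orP; left.
rewrite mulf_eq0 /bump !pmulr_rgt0// !subr_gt0.
by move: H; rewrite negb_and => /orP[] /negbTE ->; rewrite eqxx ?orbT.
Qed.

Lemma boxbump_le a b k x : boxbump a b k x <= \1_(box a b) x.
Proof.
rewrite indicE; have [|/negP xab] := boolP (x \in box a b).
  move=> _; apply: prodr_ile1 => i _.
  by rewrite mulr_ge0 ?bump_ge0//= mulr_ile1 ?bump_ge0 ?bump0_le1.
have [i Hi] : exists i, ~~ (a ord0 i < x ord0 i < b ord0 i).
  apply: contrapT => /forallNP H; apply: xab; rewrite inE => i.
  by apply/negPn/negP; exact: H.
by rewrite (boxbump_out _ Hi).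
Qed.

Lemma boxbump_cvg a b x : boxbump a b k x @[k --> \oo] --> (\1_(box a b) x : R).
Proof.
have -> : \1_(box a b) x = \prod_(i < N) (((0 < x ord0 i - a ord0 i)%R)%:R *
    ((0 < b ord0 i - x ord0 i)%R)%:R) :> R.
  rewrite indicE; have [|/negP xab] := boolP (x \in box a b).
    rewrite inE => xab; rewrite big1// => i _.
    by rewrite !subr_gt0; have /andP[-> ->] := xab i; rewrite mulr1.
  have [i Hi] : exists i, ~~ (a ord0 i < x ord0 i < b ord0 i).
    apply: contrapT => /forallNP H; apply: xab; rewrite inE => i.
    by apply/negPn/negP; exact: H.
  rewrite (bigD1 i)//= !subr_gt0.
  by move: Hi; rewrite negb_and => /orP[] /negbTE ->; rewrite ?(mul0r, mulr0).
rewrite /boxbump; elim: (index_enum _) => [|i s IH].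
  by under eq_fun do rewrite big_nil; rewrite big_nil; exact: cvg_cst.
under eq_fun do rewrite big_cons; rewrite big_cons.
apply: (@cvgM _ _ _ _ (fun k => bump 0 (k.+1%:R * (x ord0 i - a ord0 i)) *
   bump 0 (k.+1%:R * (b ord0 i - x ord0 i))) (fun k => \prod_(j <- s)
   (bump 0 (k.+1%:R * (x ord0 j - a ord0 j)) *
                 bump 0 (k.+1%:R * (b ord0 j - x ord0 j))))) => //.
apply: (@cvgM _ _ _ _ (fun k => bump 0 (k.+1%:R * (x ord0 i - a ord0 i)))
  (fun k => bump 0 (k.+1%:R * (b ord0 i - x ord0 i)))); exact: bump0_cvg.
Qed.

Lemma measurable_boxbump a b k : measurable_fun setT (boxbump a b k).
Proof.
apply: measurable_prod => i _; apply: measurable_funM;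
  apply: (measurableT_comp (measurable_bump 0)); apply: measurable_funM => //;
  apply: measurable_funB => //; exact: measurable_coor.
Qed.

Definition cbox (a b : 'rV[R]_N) : set 'rV[R]_N :=
  [set x | forall i, `[a ord0 i, b ord0 i]%classic (x ord0 i)].

Lemma compact_cbox a b : compact (cbox a b).
Proof. apply: (@rV_compact R N (fun i => `[a ord0 i, b ord0 i]%classic)) => i; exact: segment_compact. Qed.

Lemma test_function_boxbump a b k : test_function (boxbump a b k).
Proof.
split=> [m|].
  apply: is_Ck_prod => i.
  rewrite (_ : (fun x => _) = (fun x : 'rV[R]_N => bump 0 (k.+1%:R * x ord0 i + - (k.+1%:R * a ord0 i)))
      * (fun x : 'rV[R]_N => bump 0 (- k.+1%:R * x ord0 i + k.+1%:R * b ord0 i))).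
    by apply: is_CkM; exact: is_Ck_bump.
  by apply/funext => x /=; rewrite fctE /= !mulrBr addrC mulNr; congr (bump _ _ * bump _ _); rewrite addrC.
have clc : closed (cbox a b) by apply: compact_closed; [exact: norm_hausdorff|exact: compact_cbox].
apply: (@subclosed_compact _ _ (cbox a b)); [exact: closed_closure|exact: compact_cbox|].
rewrite closureE => x; apply => /=; split => // y /= y0 i.
rewrite /= in_itv /=; apply: contraNT y0 => H; apply/eqP.
apply: (boxbump_out _ (i := i)); apply: contraNN H => /andP[/ltW -> /ltW ->]//.
Qed.

End Ck.

(** * Fundamental lemma of the calculus of variations *)

Section fundamental_lemma.
Context {R : realType} {N : nat}.
Local Notation leb := (@lebesgue_rV R N).
Local Open Scope ereal_scope.

Lemma integrable_mulr_bounded d (T : measurableType d) (mu : {measure set T -> \bar R})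
    (D : set T) (F h : T -> R) (M : R) : measurable D ->
  mu.-integrable D (EFin \o F) -> measurable_fun setT F -> measurable_fun setT h ->
  (forall x, (`|h x| <= M * \1_D x)%R) ->
  mu.-integrable setT (fun x => (F x * h x)%:E).
Proof.
move=> mD iF mF mh hM.
have M0 x : (0 <= M * \1_D x)%R := le_trans (normr_ge0 _) (hM x).
have iFD : mu.-integrable setT (fun x => M%:E * ((EFin \o F) \_ D) x).
  apply: integrableZl => //.
  exact: (integrable_mkcond _ mD).1.
apply: (le_integrable measurableT _ _ iFD) => [|x _].
  by apply/measurable_EFinP; exact: measurable_funM.
rewrite /= patchE; have := hM x; have := M0 x; rewrite indicE.
case: (x \in D) => /= M0x hMx.
  rewrite lee_fin !normrM mulrC.
  by apply: ler_wpM2r => //; rewrite mulr1 in hMx M0x *; rewrite (ger0_norm M0x).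
move: hMx; rewrite mulr0 normr_le0 => /eqP ->.
by rewrite !mulr0.
Qed.

(** By dominated convergence F has zero integral over every box, hence, by
    Dynkin's lemma inside a fixed cube, over every Borel subset of the cube. *)
Lemma fundamental_lemma (F : 'rV[R]_N -> R) : measurable_fun setT F ->
  (forall r, leb.-integrable (cube r) (EFin \o F)) ->
  (forall a b k, \int[leb]_x (F x * boxbump a b k x)%:E = 0) ->
  {ae leb, forall x, F x = 0%R}.
Proof.
move=> mF iF F0.
have mFE : measurable_fun setT (EFin \o F) by exact/measurable_EFinP.
have box_cube (a b : 'rV[R]_N) : exists r, box a b `<=` cube r.
  exists (\sum_i (`|a ord0 i| + `|b ord0 i|))%R => x xab; apply/cubeP => i.
  rewrite (bigD1 i)//= ltr_wpDr//; first by apply: sumr_ge0.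
  have /andP[ax xb] := xab i; rewrite ltr_norml.
  have := ler_norm (b ord0 i); have := ler_norm (- a ord0 i)%R; rewrite normrN.
  have := normr_ge0 (a ord0 i); have := normr_ge0 (b ord0 i).
  by move=> ? ? ? ?; apply/andP; split; lra.
have ibox a b : leb.-integrable (box a b) (EFin \o F).
  have [r abr] := box_cube a b.
  by apply: integrableS (iF r) => //; exact: measurable_box.
have intbox a b : \int[leb]_(x in box a b) (F x)%:E = 0.
  rewrite integral_mkcond.
  have := @dominated_cvg _ _ _ leb setT measurableT
    (fun k x => (F x * boxbump a b k x)%:E) ((EFin \o F) \_ (box a b))
    (abse \o ((EFin \o F) \_ (box a b))).
  have -> : (fun k => \int[leb]_x (F x * boxbump a b k x)%:E) = fun=> 0.
    by apply/funext => k; exact: F0.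
  move=> DC; suff H : (0 : \bar R) @[_ --> \oo] --> \int[leb]_x (((EFin \o F) \_ (box a b)) x).
    by rewrite -(cvg_lim _ H)// lim_cst.
  - apply: DC => [k|x _|x _||k x _].
    + apply/measurable_EFinP; apply: measurable_funM => //.
      exact: measurable_boxbump.
    + rewrite patchE.
      have H1 : (F x * boxbump a b k x)%:E @[k --> \oo] --> (F x * \1_(box a b) x)%:E.
        apply: cvg_EFin; first by near=> k.
        by apply: cvgMl_tmp; exact: boxbump_cvg.
      by move: H1; rewrite indicE; case: ifP => _; rewrite ?mulr1 ?mulr0.
    + by rewrite /= patchE; case: ifP.
    + by apply: integrable_abse; apply: (integrable_mkcond _ (measurable_box a b)).1.
    + rewrite /= patchE.
      have := boxbump_le a b k x; have := boxbump_ge0 a b k x; rewrite indicE.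
      case: (x \in box a b) => /= b0 b1; rewrite ?abseE lee_fin normrM.
        by rewrite ler_piMr// ger0_norm.
      have -> : boxbump a b k x = 0%R by apply/eqP; rewrite eq_le b0 b1.
      by rewrite normr0 mulr0.
have ae_cube k : {ae leb, forall x, cube k.+1%:R x -> F x = 0%R}.
  pose Q := cube k.+1%:R : set 'rV[R]_N.
  have mQ : measurable Q by exact: measurable_box.
  have iQ (A : set 'rV[R]_N) : measurable A -> leb.-integrable (A `&` Q) (EFin \o F).
    move=> mA; apply: (integrableS mQ (measurableI _ _ mA mQ) _ (iF k.+1%:R)).
    exact: subIsetr.
  have zeroI (A : set 'rV[R]_N) : measurable A -> \int[leb]_(x in A `&` Q) (F x)%:E = 0.
    rewrite measurable_boxes; move: A; apply: (dynkin_induction (G := boxes)).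
    - exact: measurable_boxes.
    - exact: setI_closed_boxes.
    - by rewrite setTI; exact: intbox.
    - move=> A bA; have : boxes (A `&` Q) by apply: setI_closed_boxes => //; eexists; eexists.
      by case=> a [b ->]; exact: intbox.
    - move=> A mA A0; have : \int[leb]_(x in Q) (F x)%:E = 0 by exact: intbox.
      rewrite -{1}(setTI Q) -(setvU A) setIUl integral_setU//; last 4 first.
      + exact: measurableI (measurableC mA) mQ.
      + exact: measurableI mA mQ.
      + exact: measurable_funTS.
      + apply/disj_set2P; rewrite setIACA setICl set0I//.
      by rewrite A0 adde0.
    - move=> G mG tG G0; rewrite setI_bigcupl integral_bigcup//.
      + by rewrite eseries0.
      + exact: trivIset_setIr.
      + by move=> i; exact: measurableI.
      + by rewrite -setI_bigcupl; apply: iQ; exact: bigcupT_measurable.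
  have : ae_eq leb Q (EFin \o F) (cst 0).
    apply: (integral_ae_eq mQ) => //; first exact: iF.
    by move=> E EQ mE; rewrite integral0 -(zeroI E mE) setIidl.
  by apply: filterS => x H /H /= [].
have := ae_foralln ae_cube.
apply: filterS => x H; have : setT x by [].
by rewrite -bigcup_cube => -[k _ xk]; exact: (H k).
Unshelve. all: by end_near.
Qed.

End fundamental_lemma.

(** * Averages along segments *)

Section unit_interval.
Context {R : realType}.
Local Open Scope ereal_scope.
Local Notation L1 := (@lebesgue_measure R).
Local Notation I01 := (`[0%R, 1%R]%classic : set R).

Let mI : measurable (I01 : set (measurableTypeR R)). Proof. exact: measurable_itv. Qed.

Let L1I : L1 I01 = 1.
Proof. by have := @lebesgue_measure_itv R `[0%R, 1%R]; rewrite /= lte_fin ltr01 sube0. Qed.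

Let L1Ioo : (L1 : {measure set (measurableTypeR R) -> \bar R}) I01 < +oo.
Proof. by rewrite [ltLHS]L1I ltry. Qed.

(** As a measure on the whole line of total mass 1, it makes averages over [0,
    1] fit the statements about product measures and about finite measures. *)
Definition unif01 : {finite_measure set (measurableTypeR R) -> \bar R} :=
  mfrestr mI L1Ioo.

Lemma unif01T : unif01 setT = 1.
Proof. by rewrite /unif01 /= /mfrestr /mrestr setTI. Qed.

Lemma integral_cst_unif01 (C : \bar R) : \int[unif01]_r C = C.
Proof. by rewrite (integral_cst unif01 measurableT) [X in _ * X]unif01T mule1. Qed.

Lemma ge0_integral_unif01 (f : R -> \bar R) : measurable_fun setT f ->
  (forall r, 0 <= f r) -> \int[unif01]_r f r = \int[L1]_(r in I01) f r.
Proof.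
move=> mf f0.
have m1 : measurable_fun setT (\1_I01 : R -> R) by exact: measurable_indic.
rewrite -(@ge0_integral_weighted _ _ (measurableTypeR R) (measurableTypeR R) R L1 unif01 (\1_I01) id)//.
  rewrite [RHS]integral_mkcond; apply: eq_integral => r _; rewrite patchE indicE.
  by case: ifP; rewrite ?mule1 ?mule0.
move=> A mA; rewrite preimage_id integral_indic//.
by rewrite /unif01 /= /mfrestr /mrestr setIC.
Qed.

Lemma integral_unif01 (f : R -> \bar R) : measurable_fun setT f ->
  \int[unif01]_r f r = \int[L1]_(r in I01) f r.
Proof.
move=> mf; rewrite integralE [RHS]integralE; congr (_ - _);
  apply: ge0_integral_unif01 => //.
  exact: measurable_funepos.
exact: measurable_funeneg.
Qed.

End unit_interval.

Section lines.
Context {R : realType} {N : nat}.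
Implicit Types (phi : 'rV[R]_N -> R) (i : 'I_N) (x : 'rV[R]_N).

Local Notation e_ i := (delta_mx ord0 i : 'rV[R]_N).

Lemma is_derive_line phi i x (c r : R) : is_Ck 1 phi ->
  is_derive r 1 (fun r => phi (x + (c * r) *: e_ i)%R)
    (c * partial i phi (x + (c * r) *: e_ i))%R.
Proof.
move=> [_ /(_ i)[dphi _]].
pose g (t : R) : R := phi (x + t *: e_ i)%R.
have dg (t : R) : is_derive t 1 g (partial i phi (x + t *: e_ i))%R.
  have E : (fun h : R => h^-1 *: ((g \o shift t) (h *: (1 : R)) - g t))%R =
     (fun h : R => h^-1 *: ((phi \o shift (x + t *: e_ i)) (h *: e_ i) - phi (x + t *: e_ i)))%R.
    apply/funext => h; rewrite /g /=; congr (_ *: (phi _ - _)).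
    by rewrite [h *: (1 : R)]mulr1 scalerDl addrCA.
  split; first by rewrite /derivable E; exact: dphi.
  by rewrite /derive E.
have H1 : is_derive r 1 (fun r : R => c * r)%R c.
  by apply: is_derive_eq; rewrite /GRing.scale/= ?mulr1 ?mulr0 ?addr0 ?add0r.
have := @is_derive1_comp R g (fun r => c * r)%R r _ _ (dg (c * r)%R) H1.
by move=> H; apply: (is_derive_eq H); rewrite mulrC.
Qed.

Lemma continuous_line phi i x (c : R) : continuous phi ->
  continuous (fun r : R => phi (x + (c * r) *: e_ i)%R).
Proof.
move=> cphi r.
apply: (@continuous_comp R 'rV[R]_N R (fun r : R => x + (c * r) *: e_ i)%R phi); last exact: cphi.
apply: (@continuousD R 'rV[R]_N R (fun=> x) (fun r : R => (c * r) *: e_ i)%R r).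
  exact: cst_continuous.
apply: (@continuous_comp R R 'rV[R]_N (fun r : R => c * r)%R (fun t : R => t *: e_ i)%R r).
  exact: mulrl_continuous.
exact: scalel_continuous.
Qed.

Lemma line_FTC phi i x (c : R) : is_Ck 1 phi ->
  (\int[unif01]_r (c * partial i phi (x + (c * r) *: e_ i))%:E =
  (phi (x + c *: e_ i) - phi x)%:E)%E.
Proof.
move=> Cphi.
have cp : continuous (partial i phi) by case: Cphi => _ /(_ i)[_ []].
have cl := @continuous_line _ i x c cp.
have cM : continuous (fun r : R => c * partial i phi (x + (c * r) *: e_ i))%R.
  move=> r; apply: (@continuousM R R (fun=> c) (fun r : R => partial i phi (x + (c * r) *: e_ i)) r).
    exact: cst_continuous.
  exact: cl.
rewrite integral_unif01; last first.
  by apply/measurable_EFinP; exact: continuous_measurable_fun.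
have dF r := is_derive_line i x c r Cphi.
have cF : continuous (fun r => phi (x + (c * r) *: e_ i)%R).
  by apply: continuous_line; exact: is_Ck_continuous Cphi.
rewrite (@continuous_FTC2 _ _ (fun r => phi (x + (c * r) *: e_ i)%R))//.
- by rewrite mulr1 mulr0 scale0r addr0.
- exact: continuous_subspaceT.
- split; first by move=> r _; case: (dF r).
  + by apply: cvg_at_right_filter; exact: cF.
  + by apply: cvg_at_left_filter; exact: cF.
- by move=> r _; rewrite derive1E; case: (dF r).
Qed.

Lemma measurable_line i (c : R) :
  measurable_fun setT (fun z : 'rV[R]_N * R => z.1 + (c * z.2) *: e_ i)%R.
Proof.
apply: measurable_rVD; first exact: measurable_fst.
apply: measurable_rVZ; last exact: measurable_cst.
by apply: measurable_funM => //; exact: measurable_snd.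
Qed.

Lemma measurable_partial phi i : measurable_fun setT phi ->
  (forall x, derivable phi x (e_ i)) -> measurable_fun setT (partial i phi).
Proof.
move=> mphi dphi.
pose h (k : nat) : R := k.+1%:R^-1%R.
apply: (@measurable_fun_cvg _ _ _ setT
  (fun k x => (h k)^-1 *: (phi (h k *: e_ i + x) - phi x))%R).
- move=> k; apply: measurable_funM => //; apply: measurable_funB => //.
  apply: (measurableT_comp mphi); apply: measurable_rVD => //; exact: measurable_cst.
- move=> x _; have := dphi x => /cvg_ex[l Hl].
  have -> : partial i phi x = l by apply/cvg_lim.
  apply: (cvg_comp h (fun t => t^-1 *: ((phi \o shift x) (t *: e_ i) - phi x))%R _ Hl).
  move=> A [e /= e0 He].
  have /cvgrPdist_lt/(_ _ e0) := @cvg_harmonic R.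
  by apply: filterS => k; rewrite /h => Hk; apply: He => //=; rewrite invr_eq0.
Qed.

(** The partial derivative is continuous, hence bounded on the compact closed
    box, and it vanishes off this box. *)
Lemma partial_boxbump_bound a b k i :
  exists M : R, forall x, (`|partial i (boxbump a b k) x| <= M * \1_(cbox a b) x)%R.
Proof.
have [Ck _] := test_function_boxbump a b k.
have cp : continuous (partial i (boxbump a b k)) by case: (Ck 1%N) => _ /(_ i)[_ []].
have : bounded_set (partial i (boxbump a b k) @` cbox a b).
  apply: compact_bounded; apply: continuous_compact; last exact: compact_cbox.
  exact: continuous_subspaceT.
move=> /pinfty_ex_gt0[M _ HM]; exists M => x; rewrite indicE.
have [xab|/negP xab] := boolP (x \in cbox a b).
  by rewrite mulr1; apply: HM; exists x => //; rewrite inE in xab.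
rewrite mulr0 normr_le0; apply/eqP.
have [j Hj] : exists j, ~~ (a ord0 j <= x ord0 j <= b ord0 j)%R.
  apply: contrapT => /forallNP H; apply: xab; rewrite inE => j.
  by rewrite /= in_itv /=; apply/negPn/negP; exact: H.
pose d : R := Num.max (a ord0 j - x ord0 j) (x ord0 j - b ord0 j).
have d0 : 0 < d.
  by rewrite lt_max !subr_gt0; move: Hj; rewrite negb_and -!ltNge.
have out h : `|h| < d -> boxbump a b k (h *: e_ i + x) = 0.
  move=> hd; apply: (boxbump_out _ (i := j)); rewrite !mxE /=.
  have hl : `|h * (j == i)%:R| < d.
    by rewrite normrM; case: (j == i); rewrite ?normr1 ?mulr1 ?normr0 ?mulr0.
  move: hl; set t := h * _; rewrite lt_max negb_and -!leNgt.
  have t1 := ler_norm t; have t2 := ler_norm (- t); rewrite normrN in t2.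
  by case/orP => H; apply/orP; [left|right]; lra.
apply/cvg_lim => //; apply: cvg_near_cst.
near=> h; have hd : `|h| < d by near: h; exact: dnbhs0_lt.
rewrite /= out// -[x in boxbump a b k x]add0r -(scale0r (e_ i)) out ?normr0//.
by rewrite subrr scaler0.
Unshelve. all: by end_near.
Qed.

End lines.

(** * Integrals of p-th powers and Jensen's inequality *)

Section Lp_tools.
Context {R : realType} {N : nat}.
Local Notation leb := (@lebesgue_rV R N).
Local Open Scope ereal_scope.
Implicit Types (f g F : 'rV[R]_N -> R) (p : R).

Definition powint p F : \bar R := \int[leb]_x (`|F x| `^ p)%:E.

Lemma powint_ge0 p F : 0 <= powint p F.
Proof. by apply: integral_ge0 => x _; rewrite lee_fin powR_ge0. Qed.

Lemma LfunP_powint p F : (0 < p)%R -> F \in Lfun leb p%:E ->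
  measurable_fun setT F /\ powint p F < +oo.
Proof.
move=> p0; rewrite inE => /andP[]; rewrite inE /= => mF; rewrite inE /= /finite_norm => nF.
split => //; have -> : powint p F = 'N[leb]_p%:E[EFin \o F] `^ p.
  by rewrite powR_Lnorm ?gt_eqF//.
exact: poweR_lty.
Qed.

Lemma norm_le_powR p (t : R) : (1 <= p)%R -> (`|t| <= 1 + `|t| `^ p)%R.
Proof.
move=> p1; have [t1|t1] := leP `|t|%R 1%R; first by rewrite (le_trans t1)// lerDl powR_ge0.
rewrite -[leLHS]powRr1// (@le_trans _ _ (`|t| `^ p)%R) ?lerDr//.
by apply: ler_powR => //; exact: ltW.
Qed.

Lemma integrable_powint_loc p F D : (1 <= p)%R -> measurable_fun setT F ->
  powint p F < +oo -> measurable D -> leb D < +oo ->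
  leb.-integrable D (EFin \o F).
Proof.
move=> p1 mF Foo mD Doo; apply/integrableP; split.
  by apply: measurable_funTS; exact/measurable_EFinP.
apply: (@le_lt_trans _ _ (\int[leb]_(x in D) (1 + (`|F x| `^ p)%:E))).
  apply: ge0_le_integral => //.
  - by apply: measurable_funTS; do 2 apply: measurableT_comp => //.
  - by apply: measurable_funTS; apply: emeasurable_funD => //; exact: measurable_powabs.
  - by move=> x _; rewrite /= -EFinD lee_fin norm_le_powR.
rewrite ge0_integralD//; last by apply: measurable_funTS; exact: measurable_powabs.
rewrite integral_cst// mul1e lte_add_pinfty//.
apply: le_lt_trans Foo; apply: ge0_subset_integral => //.
exact: measurable_powabs.
Qed.

Lemma integral_translation (h : 'rV[R]_N) (F : 'rV[R]_N -> \bar R) :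
  measurable_fun setT F -> \int[leb]_x F (x + h)%R = \int[leb]_x F x.
Proof.
move=> mF; rewrite integralE [RHS]integralE; congr (_ - _).
  rewrite -(ge0_integral_translation h (f := F^\+))//; last exact: measurable_funepos.
  by apply: eq_integral => x _; rewrite ?funeposE ?funenegE.
rewrite -(ge0_integral_translation h (f := F^\-))//; last exact: measurable_funeneg.
by apply: eq_integral => x _; rewrite ?funeposE ?funenegE.
Qed.

Lemma integral_norm_shift_mul (v : 'rV[R]_N) (F h : 'rV[R]_N -> R) :
  measurable_fun setT F -> measurable_fun setT h ->
  \int[leb]_x `|(F x * h (x - v))%:E| = \int[leb]_x `|(F (x + v) * h x)%:E|.
Proof.
move=> mF mh; pose G (x : 'rV[R]_N) : \bar R := `|(F (x + v) * h x)%:E|.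
have mG : measurable_fun setT G.
  apply: measurableT_comp => //; apply/measurable_EFinP; apply: measurable_funM => //.
  exact: measurableT_comp mF (measurable_addrV _).
have G0 x : 0 <= G x by exact: abse_ge0.
transitivity (\int[leb]_x G (x - v)%R); first by apply: eq_integral => x _; rewrite /G subrK.
exact: (ge0_integral_translation (- v)%R mG G0).
Qed.

Lemma integrable_translation (h : 'rV[R]_N) (F : 'rV[R]_N -> \bar R) :
  leb.-integrable setT F -> leb.-integrable setT (fun x => F (x + h)%R).
Proof.
move=> /integrableP[mF Foo]; apply/integrableP; split.
  exact: measurableT_comp mF (measurable_addrV h).
by rewrite (ge0_integral_translation h (f := fun x => `|F x|))//; exact: measurableT_comp.
Qed.

Lemma powint_translation p F (h : 'rV[R]_N) : measurable_fun setT F ->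
  powint p (fun x => F (x + h)%R) = powint p F.
Proof.
move=> mF; apply: (ge0_integral_translation h (f := fun x => (`|F x| `^ p)%:E)).
  exact: measurable_powabs.
by move=> x; rewrite lee_fin powR_ge0.
Qed.

End Lp_tools.

Section jensen.
Context {R : realType}.
Local Open Scope ereal_scope.
Implicit Types (h : R -> R) (p : R).

Lemma powint_unif01_integrable p h : (1 <= p)%R -> measurable_fun setT h ->
  \int[unif01]_r (`|h r| `^ p)%:E < +oo ->
  unif01.-integrable setT (EFin \o h).
Proof.
move=> p1 mh hoo; apply/integrableP; split; first exact/measurable_EFinP.
apply: (@le_lt_trans _ _ (\int[unif01]_r (1 + (`|h r| `^ p)%:E))).
  apply: ge0_le_integral => //.
  - by do 2 apply: measurableT_comp => //.
  - by apply: emeasurable_funD => //; exact: measurable_powabs.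
  - by move=> x _; rewrite /= -EFinD lee_fin norm_le_powR.
rewrite ge0_integralD//; last exact: measurable_powabs.
rewrite integral_cst// mul1e lte_add_pinfty//.
by rewrite [ltLHS]unif01T ltry.
Qed.

(** Hoelder's inequality against the constant function 1. If the right-hand
    side is infinite there is nothing to prove; otherwise h is integrable. *)
Lemma jensen_unif01 p h : (1 < p)%R -> measurable_fun setT h ->
  (`|fine (\int[unif01]_r (h r)%:E)| `^ p)%:E <= \int[unif01]_r (`|h r| `^ p)%:E.
Proof.
move=> p1 mh; have p0 : (0 < p)%R by rewrite (lt_trans ltr01).
have [hoo|] := ltP (\int[unif01]_r (`|h r| `^ p)%:E) +oo; last first.
  by rewrite leye_eq => /eqP ->; rewrite leey.
have ih := powint_unif01_integrable (ltW p1) mh hoo.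
pose q := (p / (p - 1))%R.
have q0 : (0 < q)%R by rewrite divr_gt0// subr_gt0.
have pq : (p^-1 + q^-1 = 1)%R by rewrite /q invf_div -{1}[(p^-1)%R]mul1r -mulrDl addrC subrK divff// gt_eqF.
have := hoelder unif01 mh (measurable_cst (1%R : R)) p0 q0 pq.
rewrite [X in _ <= _ * X](_ : _ = 1) ?mule1; last first.
  by rewrite (_ : EFin \o cst 1%R = cst 1)// Lnorm_cst1 [X in X `^ _]unif01T poweR1r.
rewrite Lnorm1 => H.
have fN : (`|fine (\int[unif01]_r (h r)%:E)|)%:E <= 'N[unif01]_p%:E[EFin \o h].
  apply: le_trans H; rewrite -[leLHS]/(`|(fine (\int[unif01]_r (h r)%:E))%:E|).
  rewrite fineK; last exact: integrable_fin_num.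
  apply: (le_trans (le_abse_integral unif01 measurableT _)).
    exact/measurable_EFinP.
  by under [leRHS]eq_integral do rewrite /= mulr1.
have -> : \int[unif01]_r (`|h r| `^ p)%:E = 'N[unif01]_p%:E[EFin \o h] `^ p.
  by rewrite powR_Lnorm ?gt_eqF//.
rewrite -poweR_EFin.
by apply: gt0_ler_poweR fN; rewrite ?(ltW p0)// in_itv /= leey andbT ?lee_fin ?Lnorm_ge0.
Qed.

End jensen.

(** * Weak partial derivatives and increments along an axis *)

Section representation.
Context {R : realType} {N : nat}.
Local Notation leb := (@lebesgue_rV R N).
Local Notation e_ i := (delta_mx ord0 i : 'rV[R]_N).
Local Open Scope ereal_scope.
Variables (p : R) (f g : 'rV[R]_N -> R) (i : 'I_N).
Hypothesis p1 : (1 < p)%R.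
Hypotheses (mf : measurable_fun setT f) (mg : measurable_fun setT g).
Hypotheses (foo : powint p f < +oo) (goo : powint p g < +oo).
Hypothesis wfg : weak_partial i f g.

Let p1' : (1 <= p)%R. Proof. exact: ltW. Qed.

Lemma boxbump_shift (a b : 'rV[R]_N) k (h x : 'rV[R]_N) :
  boxbump a b k (x - h) = boxbump (a + h) (b + h) k x.
Proof.
apply: eq_bigr => j _; rewrite !mxE; congr (bump _ (_ * _) * bump _ (_ * _))%R; ring.
Qed.

Lemma partial_boxbump_shift (a b : 'rV[R]_N) k (h x : 'rV[R]_N) :
  partial i (boxbump a b k) (x - h) = partial i (boxbump (a + h) (b + h) k) x.
Proof.
rewrite /partial /derive.
have -> // : (fun t : R => t^-1 *: ((boxbump a b k \o shift (x - h)) (t *: e_ i) - boxbump a b k (x - h)))%R =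
  (fun t : R => t^-1 *: ((boxbump (a + h) (b + h) k \o shift x) (t *: e_ i) - boxbump (a + h) (b + h) k x))%R.
by apply/funext => t /=; rewrite -!boxbump_shift addrA.
Qed.

Lemma measurable_cbox (a b : 'rV[R]_N) : measurable (cbox a b).
Proof. apply: (measurable_rect (A := fun j => `[a ord0 j, b ord0 j]%classic)) => j; exact: measurable_itv. Qed.

Lemma lebesgue_cbox_lty (a b : 'rV[R]_N) : leb (cbox a b) < +oo.
Proof.
apply: (le_lt_trans _ (lebesgue_box_lty (a - const_mx 1)%R (b + const_mx 1)%R)).
apply: le_measure; rewrite ?inE; [exact: measurable_cbox|exact: measurable_box|].
move=> x xab j; rewrite !mxE; have := xab j; rewrite /= in_itv /= => /andP[? ?].
by apply/andP; split; lra.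
Qed.

Lemma boxbump_bound (a b : 'rV[R]_N) k x : (`|boxbump a b k x| <= 1 * \1_(cbox a b) x)%R.
Proof.
rewrite mul1r ger0_norm ?boxbump_ge0// (le_trans (boxbump_le _ _ _ _))// !indicE ler_nat.
have [|//] := boolP (x \in box a b); rewrite inE => xab.
rewrite mem_set// => j; rewrite /= in_itv /=.
by have /andP[/ltW -> /ltW ->] := xab j.
Qed.

Lemma integrable_mul_bump (a b : 'rV[R]_N) (F h : 'rV[R]_N -> R) (M : R) : measurable_fun setT F -> powint p F < +oo ->
  measurable_fun setT h -> (forall x, (`|h x| <= M * \1_(cbox a b) x)%R) ->
  leb.-integrable setT (fun x => (F x * h x)%:E).
Proof.
move=> mF Foo mh hM; apply: (integrable_mulr_bounded (measurable_cbox a b) _ mF mh hM).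
exact: (integrable_powint_loc p1' mF Foo (measurable_cbox a b) (lebesgue_cbox_lty a b)).
Qed.

Section one_box.
Variables (a b : 'rV[R]_N) (k : nat).
Local Notation phi := (boxbump a b k).
Local Notation dphi := (partial i phi).

Let Ckphi : is_Ck 1 phi. Proof. by have [H _] := test_function_boxbump a b k; exact: H. Qed.

Let mphi : measurable_fun setT phi. Proof. exact: measurable_boxbump. Qed.

Let mdphi : measurable_fun setT dphi.
Proof. by apply: measurable_partial => //; case: Ckphi => _ /(_ i)[]. Qed.

Let phi_bound := boxbump_bound a b k.

Lemma integrable_mul_bump_shift (F h : 'rV[R]_N -> R) (M : R) (v : 'rV[R]_N) :
  measurable_fun setT F -> powint p F < +oo ->
  measurable_fun setT h -> (forall x, (`|h x| <= M * \1_(cbox a b) x)%R) ->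
  leb.-integrable setT (fun x => (F x * h (x - v))%:E).
Proof.
move=> mF Foo mh hM.
have mFv : measurable_fun setT (fun x : 'rV[R]_N => F (x + v)%R).
  exact: measurableT_comp mF (measurable_addrV _).
have Foov : powint p (fun x : 'rV[R]_N => F (x + v)%R) < +oo by rewrite powint_translation.
have := integrable_translation (- v)%R (integrable_mul_bump mFv Foov mh hM).
by under eq_fun do rewrite subrK.
Qed.

(** The translate of a [boxbump] is the [boxbump] of the translated box. *)
Lemma weak_partial_shift (h : 'rV[R]_N) :
  \int[leb]_x (f x * dphi (x - h))%:E = - \int[leb]_x (g x * phi (x - h))%:E.
Proof.
under eq_integral do rewrite partial_boxbump_shift.
under [in RHS]eq_integral do rewrite boxbump_shift.
have [M HM] := partial_boxbump_bound (a + h) (b + h) k i.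
have [T1 T2] := test_function_boxbump (a + h) (b + h) k.
have := wfg (conj T1 T2); rewrite /Rintegral => H.
have mB := measurable_boxbump (a + h) (b + h) k.
have mdB : measurable_fun setT (partial i (boxbump (a + h) (b + h) k)).
  by apply: measurable_partial => //; case: (T1 1%N) => _ /(_ i)[].
have fin1 := integrable_fin_num measurableT (integrable_mul_bump mf foo mdB HM).
have fin2 := integrable_fin_num measurableT
  (integrable_mul_bump mg goo mB (boxbump_bound (a + h) (b + h) k)).
by rewrite -(fineK fin1) H EFinN fineK.
Qed.

Lemma integrable_line (F h : 'rV[R]_N -> R) (c M : R) :
  measurable_fun setT F -> powint p F < +oo ->
  measurable_fun setT h -> (forall x, (`|h x| <= M * \1_(cbox a b) x)%R) ->
  (leb \x unif01).-integrable setT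
    (fun z => (F (z.1 + (c * z.2) *: e_ i) * h z.1)%:E).
Proof.
move=> mF Foo mh hM.
have M0 x : (0 <= M * \1_(cbox a b) x)%R := le_trans (normr_ge0 _) (hM x).
have mL := measurable_line i c.
have mI : measurable_fun setT (fun z : 'rV[R]_N * R => (F (z.1 + (c * z.2) *: e_ i) * h z.1)%:E).
  apply/measurable_EFinP; apply: measurable_funM; first exact: measurableT_comp mF mL.
  exact: measurableT_comp mh measurable_fst.
apply/(integrable21ltyP leb unif01 mI).
pose C : \bar R := `|M|%:E * (leb (cbox a b) + powint p F).
have Coo : C < +oo.
  rewrite lte_mul_pinfty ?lee_fin//; apply: lte_add_pinfty => //.
  exact: lebesgue_cbox_lty.
apply: (@le_lt_trans _ _ (\int[unif01]_r C)); last first.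
  by rewrite integral_cst_unif01.
apply: ge0_le_integral => //.
- by move=> r _; apply: integral_ge0.
- apply: (measurable_fun_fubini_tonelli_G (m1 := leb) (fun z => `|(F (z.1 + (c * z.2) *: e_ i) * h z.1)%:E|)) => //.
  exact: measurableT_comp.
move=> r _ /=.
have mFr : measurable_fun setT (fun x : 'rV[R]_N => F (x + (c * r) *: e_ i)%R).
  exact: measurableT_comp mF (measurable_addrV _).
apply: (@le_trans _ _ (\int[leb]_x (`|M|%:E * ((\1_(cbox a b) x)%:E + (`|F (x + (c * r) *: e_ i)| `^ p)%:E)))).
  apply: ge0_le_integral => //.
  - apply/measurable_EFinP; apply: measurableT_comp => //; exact: measurable_funM.
  - apply: emeasurable_funM => //; apply: emeasurable_funD; last exact: measurable_powabs.
    by apply/measurable_EFinP; apply: measurable_indic; exact: measurable_cbox.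
  - move=> x _; rewrite -EFinD -EFinM lee_fin normrM.
    have := hM x; have := M0 x; rewrite indicE; case: (x \in _) => /= M0x hMx.
      rewrite mulr1 in hMx M0x; rewrite (ger0_norm M0x) mulrC.
      by apply: ler_pM => //; exact: norm_le_powR.
    move: hMx; rewrite mulr0 normr_le0 => /eqP ->; rewrite normr0 mulr0.
    by rewrite mulr_ge0// addr_ge0// powR_ge0.
rewrite ge0_integralZl//; last 2 first.
- apply: emeasurable_funD; last exact: measurable_powabs.
  by apply/measurable_EFinP; apply: measurable_indic; exact: measurable_cbox.
- by move=> x _; rewrite -EFinD lee_fin addr_ge0// powR_ge0.
apply: lee_wpmul2l => //; rewrite ge0_integralD//; last 2 first.
- by apply/measurable_EFinP; apply: measurable_indic; exact: measurable_cbox.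
- exact: measurable_powabs.
have -> : \int[leb]_x (\1_(cbox a b) x)%:E = leb (cbox a b).
  by rewrite (integral_indic _ measurableT (measurable_cbox a b)) setIT.
by rewrite leeD2l// -[leRHS](powint_translation p ((c * r) *: e_ i)).
Qed.

(** Translating the increment of f onto the test function turns it into an
    average of partial derivatives of translated test functions ([line_FTC]);
    the definition of the weak derivative, applied under the average, moves
    these onto g, and translating back gives the claim. *)
Lemma weak_line (c : R) :
  \int[leb]_x ((f (x + c *: e_ i) - f x) * phi x)%:E =
  \int[leb]_x \int[unif01]_r (c * g (x + (c * r) *: e_ i) * phi x)%:E.
Proof.
have [M HM] := partial_boxbump_bound a b k i.
pose h (r : R) : 'rV[R]_N := ((c * r) *: e_ i)%R.
have h1 : h 1%R = (c *: e_ i)%R by rewrite /h mulr1.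
rewrite -h1.
have mfc : measurable_fun setT (fun x : 'rV[R]_N => f (x + h 1%R)%R).
  exact: measurableT_comp mf (measurable_addrV _).
have ifphi := integrable_mul_bump mf foo mphi phi_bound.
have ifcphi : leb.-integrable setT (fun x => (f (x + h 1%R) * phi x)%:E).
  apply: (integrable_mul_bump mfc _ mphi phi_bound).
  by rewrite (powint_translation p _ mf).
have ifphic := integrable_mul_bump_shift (h 1%R) mf foo mphi phi_bound.
transitivity (\int[leb]_x (f x * (phi (x - h 1%R) - phi x))%:E).
  transitivity (\int[leb]_x (f (x + h 1%R) * phi x)%:E - \int[leb]_x (f x * phi x)%:E).
    rewrite -(integralB measurableT ifcphi ifphi).
    by apply: eq_integral => x _; rewrite -EFinB mulrBl.
  rewrite -(integral_translation (- h 1%R)%R (F := fun x => (f (x + h 1%R) * phi x)%:E)); last first.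
    exact: measurable_int ifcphi.
  under eq_integral do rewrite subrK.
  rewrite -(integralB measurableT ifphic ifphi).
  by apply: eq_integral => x _; rewrite -EFinB mulrBr.
have mL := measurable_line i (- c).
have I1 : (leb \x unif01).-integrable setT
    (fun z => (f z.1 * (- c * dphi (z.1 + (- c * z.2) *: e_ i)))%:E).
  have m1 : measurable_fun setT (fun z : 'rV[R]_N * R => (f z.1 * dphi (z.1 + (- c * z.2) *: e_ i))%:E).
    apply/measurable_EFinP; apply: measurable_funM; last exact: measurableT_comp mdphi mL.
    exact: measurableT_comp mf measurable_fst.
  have I0 : (leb \x unif01).-integrable setT
    (fun z => (f z.1 * dphi (z.1 + (- c * z.2) *: e_ i))%:E).
    apply/(integrable21ltyP leb unif01 m1).
    have /integrableP[mI _] := integrable_line c mf foo mdphi HM.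
    have /(integrable21ltyP leb unif01 mI) := integrable_line c mf foo mdphi HM.
    have E (r : R) : \int[leb]_x `|(f x * dphi (x + (- c * r) *: e_ i))%:E| =
        \int[leb]_x `|(f (x + (c * r) *: e_ i) * dphi x)%:E|.
      transitivity (\int[leb]_x `|(f x * dphi (x - h r))%:E|).
        by apply: eq_integral => x _; rewrite /h mulNr scaleNr.
      exact: integral_norm_shift_mul.
    move=> H0; apply: le_lt_trans H0.
    by rewrite le_eqVlt; apply/orP; left; apply/eqP; apply: eq_integral => r _; exact: E.
  have := integrableZl measurableT (- c) I0.
  by apply: eq_integrable => // z _; rewrite -EFinM mulrCA.
transitivity (\int[leb]_x \int[unif01]_r (f x * (- c * dphi (x + (- c * r) *: e_ i)))%:E).
  apply: eq_integral => x _.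
  have E := line_FTC i x (- c) Ckphi; rewrite scaleNr -h1 in E.
  rewrite EFinM -E -integralZl//.
  have mI : measurable_fun setT (fun r : R => (- c * dphi (x + (- c * r) *: e_ i))%R).
    apply: measurable_funM => //; apply: (measurableT_comp mdphi).
    apply: measurable_rVD; first exact: measurable_cst.
    by apply: measurable_rVZ => //; exact: measurable_cst.
  have ic := @finite_measure_integrable_cst _ (measurableTypeR R) R unif01 setT (`|c| * `|M|)%R measurableT.
  apply: (le_integrable measurableT _ _ ic).
    exact/measurable_EFinP.
  move=> r _; rewrite /= lee_fin !normrM normrN !normr_id; apply: ler_wpM2l => //.
  apply: (le_trans (HM _)); rewrite indicE; case: (_ \in _); rewrite ?mulr1 ?mulr0//.
  exact: ler_norm.
rewrite (Fubini I1).
have I2 := integrable_line c mg goo mphi phi_bound.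
have I2' : (leb \x unif01).-integrable setT
   (fun z => (c * g (z.1 + (c * z.2) *: e_ i) * phi z.1)%:E).
  have := integrableZl measurableT c I2.
  by apply: eq_integrable => // z _; rewrite -EFinM mulrA.
rewrite (Fubini I2').
have E1 (x : 'rV[R]_N) (r : R) : (f x * (- c * dphi (x + (- c * r) *: e_ i)))%:E =
    (- c)%:E * (f x * dphi (x - h r))%:E.
  by rewrite /h -scaleNr -mulNr -EFinM; congr (_%:E); exact: mulrCA.
apply: eq_integral => r _.
have mgr : measurable_fun setT (fun x : 'rV[R]_N => g (x + h r)%R).
  exact: measurableT_comp mg (measurable_addrV _).
have gooh : powint p (fun x : 'rV[R]_N => g (x + h r)%R) < +oo by rewrite powint_translation.
have ig := integrable_mul_bump mgr gooh mphi phi_bound.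
transitivity ((- c)%:E * \int[leb]_x (f x * dphi (x - h r))%:E).
  rewrite -(integralZl measurableT (integrable_mul_bump_shift (h r) mf foo mdphi HM)).
  apply: eq_integral => x _; exact: E1.
rewrite weak_partial_shift EFinN muleNN.
rewrite -(integral_translation (h r) (F := fun x => (g x * phi (x - h r))%:E)); last first.
  exact: measurable_int (integrable_mul_bump_shift (h r) mg goo mphi phi_bound).
under eq_integral do rewrite addrK.
rewrite -(integralZl measurableT ig).
by apply: eq_integral => x _; rewrite -EFinM mulrA.
Qed.

End one_box.
End representation.

(** * Increments as averages of the weak partial derivative *)

Section slices.
Context {R : realType} {N : nat}.
Local Notation leb := (@lebesgue_rV R N).
Local Notation e_ i := (delta_mx ord0 i : 'rV[R]_N).
Local Open Scope ereal_scope.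

Lemma measurable_slice_integral (K : 'rV[R]_N -> R -> R) :
  measurable_fun setT (fun z : 'rV[R]_N * R => K z.1 z.2) ->
  measurable_fun setT (fun x => \int[unif01]_r (K x r)%:E).
Proof.
move=> mK.
have mKE : measurable_fun setT (fun z : 'rV[R]_N * R => (K z.1 z.2)%:E).
  exact/measurable_EFinP.
rewrite (_ : (fun x => _) = (fun x =>
   \int[unif01]_r (fun z : 'rV[R]_N * R => (K z.1 z.2)%:E)^\+ (x, r) -
   \int[unif01]_r (fun z : 'rV[R]_N * R => (K z.1 z.2)%:E)^\- (x, r))); last first.
  apply/funext => x; rewrite integralE.
  by congr (_ - _); apply: eq_integral => r _; rewrite ?funeposE ?funenegE.
apply: emeasurable_funB.
  apply: (measurable_fun_fubini_tonelli_F (m2 := unif01)) => //.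
  exact: measurable_funepos.
apply: (measurable_fun_fubini_tonelli_F (m2 := unif01)) => //.
exact: measurable_funeneg.
Qed.

Lemma tonelli_slices (K : 'rV[R]_N -> R -> R) :
  measurable_fun setT (fun z : 'rV[R]_N * R => K z.1 z.2) ->
  (forall x r, (0 <= K x r)%R) ->
  \int[leb]_x \int[unif01]_r (K x r)%:E = \int[unif01]_r \int[leb]_x (K x r)%:E.
Proof.
move=> mK K0.
apply: (@fubini_tonelli _ _ _ _ R leb unif01 (fun z : 'rV[R]_N * R => (K z.1 z.2)%:E)).
  exact/measurable_EFinP.
by move=> z; rewrite lee_fin.
Qed.

End slices.

Section increments.
Context {R : realType} {N : nat}.
Local Notation leb := (@lebesgue_rV R N).
Local Notation e_ i := (delta_mx ord0 i : 'rV[R]_N).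
Local Open Scope ereal_scope.
Variables (p : R) (f g : 'rV[R]_N -> R) (i : 'I_N) (c : R).
Hypothesis p1 : (1 < p)%R.
Hypotheses (mf : measurable_fun setT f) (mg : measurable_fun setT g).
Hypotheses (foo : powint p f < +oo) (goo : powint p g < +oo).
Hypothesis wfg : weak_partial i f g.

Let p1' : (1 <= p)%R. Proof. exact: ltW. Qed.
Let p0 : (0 < p)%R. Proof. exact: lt_trans ltr01 p1. Qed.

Let gl (x : 'rV[R]_N) (r : R) : R := g (x + (c * r) *: e_ i).

Let mgl : measurable_fun setT (fun z : 'rV[R]_N * R => gl z.1 z.2).
Proof. exact: measurableT_comp mg (measurable_line i c). Qed.

Let mglx x : measurable_fun setT (gl x).
Proof. exact: (measurableT_comp mgl (measurable_pair1 x)). Qed.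

Let G (x : 'rV[R]_N) : R := fine (\int[unif01]_r (gl x r)%:E).

Let mG : measurable_fun setT G.
Proof. by apply: measurableT_comp => //; exact: measurable_slice_integral. Qed.

Let mpgl : measurable_fun setT (fun z : 'rV[R]_N * R => (`|gl z.1 z.2| `^ p)%R).
Proof. by apply/measurable_EFinP; exact: measurable_powabs. Qed.

Let slices : \int[leb]_x \int[unif01]_r (`|gl x r| `^ p)%:E = powint p g.
Proof.
rewrite (tonelli_slices mpgl); last by move=> x r; exact: powR_ge0.
rewrite -[RHS](integral_cst_unif01 (powint p g)); apply: eq_integral => r _.
exact: (powint_translation p ((c * r) *: e_ i)%R mg).
Qed.

Let mslices : measurable_fun setT (fun x => \int[unif01]_r (`|gl x r| `^ p)%:E).
Proof. exact: (measurable_slice_integral (K := fun x r => (`|gl x r| `^ p)%R)). Qed.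

Let Goo : powint p G < +oo.
Proof.
apply: le_lt_trans goo; rewrite -slices; apply: ge0_le_integral => //.
- exact: measurable_powabs.
- by move=> x _; exact: jensen_unif01.
Qed.

Let slice_integrable : {ae leb, forall x, unif01.-integrable setT (EFin \o gl x)}.
Proof.
have : leb.-integrable setT (fun x => \int[unif01]_r (`|gl x r| `^ p)%:E).
  apply/integrableP; split; first exact: mslices.
  apply: le_lt_trans goo; rewrite -slices le_eqVlt; apply/orP; left; apply/eqP.
  by apply: eq_integral => x _; rewrite gee0_abs// integral_ge0// => r _; rewrite lee_fin powR_ge0.
move=> /(integrable_ae measurableT); apply: filterS => x /(_ I) fx.
apply: (powint_unif01_integrable p1' (mglx x)).
by rewrite ltey_eq fx.
Qed.

(** The difference of both sides is locally integrable, and its integral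
    against every [boxbump] vanishes by [weak_line]. *)
Lemma increment_line : {ae leb, forall x, f (x + c *: e_ i)%R - f x = c * G x}%R.
Proof.
have mfc : measurable_fun setT (fun x : 'rV[R]_N => f (x + c *: e_ i)%R).
  exact: measurableT_comp mf (measurable_addrV _).
have fcoo : powint p (fun x : 'rV[R]_N => f (x + c *: e_ i)%R) < +oo.
  by rewrite (powint_translation p _ mf).
pose F (x : 'rV[R]_N) : R := (f (x + c *: e_ i) - f x - c * G x)%R.
have mF : measurable_fun setT F.
  by apply: measurable_funB; [exact: measurable_funB|exact: measurable_funM].
suff : {ae leb, forall x, F x = 0%R}.
  by apply: filterS => x /eqP; rewrite subr_eq0 => /eqP.
apply: fundamental_lemma => // [r|a b k].
  have cub : measurable (cube r : set 'rV[R]_N) by exact: measurable_box.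
  have coo : leb (cube r) < +oo by exact: lebesgue_box_lty.
  have iG := integrableZl cub c (integrable_powint_loc p1' mG Goo cub coo).
  have := integrableB cub (integrableB cub
     (integrable_powint_loc p1' mfc fcoo cub coo) (integrable_powint_loc p1' mf foo cub coo)) iG.
  by apply: eq_integrable.
have mphi := measurable_boxbump a b k.
have bphi := boxbump_bound a b k.
have iG := integrableZl measurableT c (integrable_mul_bump p1 mG Goo mphi bphi).
have ic := integrable_mul_bump p1 mfc fcoo mphi bphi.
have if_ := integrable_mul_bump p1 mf foo mphi bphi.
have id := integrableB measurableT ic if_.
transitivity (\int[leb]_x ((f (x + c *: e_ i) - f x) * boxbump a b k x)%:E -
  \int[leb]_x (c%:E * (G x * boxbump a b k x)%:E)).
  rewrite -(integralB measurableT _ iG); last first.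
    by apply: eq_integrable id => // x _; rewrite mulrBl.
  by apply: eq_integral => x _; rewrite /F -EFinM -EFinB [in RHS]mulrA -mulrBl.
have mK : measurable_fun setT (fun x => \int[unif01]_r (c * gl x r * boxbump a b k x)%:E).
  apply: (measurable_slice_integral (K := fun x r => (c * gl x r * boxbump a b k x)%R)).
  apply: measurable_funM; first exact: measurable_funM.
  exact: measurableT_comp mphi measurable_fst.
rewrite (weak_line p1 mf mg foo goo wfg).
rewrite [X in X - _](_ : _ = \int[leb]_x (c%:E * (G x * boxbump a b k x)%:E)).
  by rewrite subee// integrable_fin_num.
apply: ae_eq_integral => //; first exact: measurable_int iG.
apply: filterS slice_integrable => x ix _.
transitivity (\int[unif01]_r ((c * boxbump a b k x)%:E * (gl x r)%:E)).
  by apply: eq_integral => r _; rewrite -EFinM mulrAC.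
rewrite (integralZl measurableT ix) -(fineK (integrable_fin_num measurableT ix)).
by rewrite -!EFinM -/(G x) -mulrA [(boxbump _ _ _ _ * _)%R]mulrC.
Qed.

(** By [increment_line], the function on the left is almost everywhere c times
    the average over r in [0, 1] of g (x + c r e_i) - g x; apply Jensen's
    inequality and integrate in x. *)
Lemma powint_increment :
  powint p (fun x : 'rV[R]_N => f (x + c *: e_ i) - f x - c * g x)%R <=
  (`|c| `^ p)%:E * \int[unif01]_r powint p (fun x => g (x + (c * r) *: e_ i) - g x)%R.
Proof.
have mfc : measurable_fun setT (fun x : 'rV[R]_N => f (x + c *: e_ i)%R).
  exact: measurableT_comp mf (measurable_addrV _).
pose d (x : 'rV[R]_N) (r : R) : R := (gl x r - g x)%R.
have mdl : measurable_fun setT (fun z : 'rV[R]_N * R => d z.1 z.2).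
  apply: measurable_funB => //; exact: measurableT_comp mg measurable_fst.
have mpd : measurable_fun setT (fun z : 'rV[R]_N * R => (`|d z.1 z.2| `^ p)%R).
  by apply/measurable_EFinP; exact: measurable_powabs.
have mpdI : measurable_fun setT (fun x => \int[unif01]_r (`|d x r| `^ p)%:E).
  exact: (measurable_slice_integral (K := fun x r => (`|d x r| `^ p)%R)).
have d0 x : 0 <= \int[unif01]_r (`|d x r| `^ p)%:E.
  by apply: integral_ge0 => r _; rewrite lee_fin powR_ge0.
rewrite -(tonelli_slices mpd); last by move=> x r; exact: powR_ge0.
rewrite -ge0_integralZl//; last by move=> x _; exact: d0.
apply: (ae_ge0_le_integral measurableT) => //.
- apply: measurable_powabs; apply: measurable_funB; first exact: measurable_funB.
  exact: measurable_funM.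
- by move=> x _; apply: mule_ge0 => //; exact: d0.
- exact: emeasurable_funM.
apply: filterS2 increment_line slice_integrable => x -> ix _.
have Gd : (G x - g x)%R = fine (\int[unif01]_r (d x r)%:E).
  have ig := @finite_measure_integrable_cst _ (measurableTypeR R) R unif01 setT (g x) measurableT.
  rewrite (_ : \int[unif01]_r (d x r)%:E = \int[unif01]_r (gl x r)%:E - (g x)%:E).
    by rewrite fineB// ?integrable_fin_num.
  by rewrite -(integral_cst_unif01 (g x)%:E) -(integralB measurableT ix ig).
rewrite -mulrBr Gd normrM powRM// EFinM; apply: lee_wpmul2l; first by rewrite lee_fin powR_ge0.
apply: jensen_unif01 => //; exact: (measurableT_comp mdl (measurable_pair1 x)).
Qed.

End increments.

(** * The norm of L^p *)

Section pnorm.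
Context {R : realType} {N : nat}.
Local Notation leb := (@lebesgue_rV R N).
Implicit Types (F G : 'rV[R]_N -> R) (h : 'rV[R]_N).
Variable p : R.
Hypothesis p1 : 1 < p.

Let p0 : 0 < p. Proof. exact: lt_trans ltr01 p1. Qed.

Definition Lp F := measurable_fun setT F /\ (powint p F < +oo)%E.

Definition pnorm F : R := fine 'N[leb]_p%:E[EFin \o F]%E.

Definition tdiff h F : 'rV[R]_N -> R := fun x => F (x + h) - F x.

Lemma powint_Lnorm F : (powint p F = 'N[leb]_p%:E[EFin \o F] `^ p)%E.
Proof. by rewrite powR_Lnorm ?gt_eqF. Qed.

Lemma Lnorm_powint F : ('N[leb]_p%:E[EFin \o F] = powint p F `^ p^-1)%E.
Proof. by rewrite powint_Lnorm -poweRrM divff ?gt_eqF// poweRe1// Lnorm_ge0. Qed.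

Lemma pnorm_ge0 F : 0 <= pnorm F.
Proof. by rewrite fine_ge0// Lnorm_ge0. Qed.

Lemma Lnorm_pnorm F : Lp F -> ('N[leb]_p%:E[EFin \o F] = (pnorm F)%:E)%E.
Proof.
move=> [_ Foo]; rewrite fineK// ge0_fin_numE ?Lnorm_ge0//.
by rewrite Lnorm_powint poweR_lty.
Qed.

Lemma powint_pnorm F : Lp F -> powint p F = (pnorm F `^ p)%:E.
Proof. by move=> LF; rewrite powint_Lnorm Lnorm_pnorm// poweR_EFin. Qed.

Lemma pnorm_le F (e : R) : 0 <= e -> (powint p F <= (e `^ p)%:E)%E -> pnorm F <= e.
Proof.
move=> e0 Fe; have Foo : (powint p F < +oo)%E by apply: le_lt_trans Fe _; rewrite ltry.
rewrite -lee_fin fineK; last first.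
  by rewrite ge0_fin_numE ?Lnorm_ge0// Lnorm_powint poweR_lty.
rewrite Lnorm_powint.
have -> : e%:E = ((e `^ p)%:E `^ p^-1)%E.
  by rewrite poweR_EFin -powRrM divff ?gt_eqF// powRr1.
by apply: gt0_ler_poweR Fe; rewrite ?invr_ge0 ?(ltW p0)// in_itv /= leey andbT ?lee_fin ?powint_ge0 ?powR_ge0.
Qed.

Lemma LnormD F G : measurable_fun setT F -> measurable_fun setT G ->
  ('N[leb]_p%:E[EFin \o (F \+ G)%R] <=
   'N[leb]_p%:E[EFin \o F] + 'N[leb]_p%:E[EFin \o G])%E.
Proof. by move=> mF mG; apply: minkowski_EFin => //; exact: ltW. Qed.

Lemma LpD F G : Lp F -> Lp G -> Lp (F \+ G).
Proof.
move=> LF LG; have [[mF _] [mG _]] := (LF, LG).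
split; first exact: measurable_funD.
rewrite powint_Lnorm poweR_lty// (le_lt_trans (LnormD mF mG))//.
by rewrite !Lnorm_pnorm// ltry.
Qed.

Lemma pnormD F G : Lp F -> Lp G -> pnorm (F \+ G) <= pnorm F + pnorm G.
Proof.
move=> LF LG; have [[mF _] [mG _]] := (LF, LG).
rewrite -lee_fin EFinD -(Lnorm_pnorm (LpD LF LG)) -(Lnorm_pnorm LF) -(Lnorm_pnorm LG).
exact: LnormD.
Qed.

Lemma powintZ c F : measurable_fun setT F ->
  (powint p (fun x => c * F x)%R = (`|c| `^ p)%:E * powint p F)%E.
Proof.
move=> mF; rewrite /powint -ge0_integralZl//; last exact: measurable_powabs.
by apply: eq_integral => x _; rewrite normrM powRM.
Qed.

Lemma LpZ c F : Lp F -> Lp (fun x => c * F x).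
Proof.
move=> [mF Foo]; split; first exact: measurable_funM.
by rewrite powintZ// lte_mul_pinfty.
Qed.

Lemma pnormZ c F : Lp F -> pnorm (fun x => c * F x) = `|c| * pnorm F.
Proof.
move=> LF; have [mF Foo] := LF.
have := powintZ c mF; rewrite (powint_pnorm LF) (powint_pnorm (LpZ c LF)).
rewrite -EFinM -powRM ?pnorm_ge0// => -[] /(congr1 (fun t => t `^ p^-1)).
by rewrite -!powRrM divff ?gt_eqF// !powRr1 ?mulr_ge0 ?pnorm_ge0.
Qed.

Lemma LpB F G : Lp F -> Lp G -> Lp (F \- G).
Proof.
move=> LF LG; have := LpD LF (LpZ (-1) LG).
by congr (Lp _); apply/funext => x /=; rewrite mulN1r.
Qed.

Lemma pnormB F G : Lp F -> Lp G -> pnorm (F \- G) <= pnorm F + pnorm G.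
Proof.
move=> LF LG; have := pnormD LF (LpZ (-1) LG); rewrite pnormZ// normrN1 mul1r.
by congr (pnorm _ <= _); apply/funext => x /=; rewrite mulN1r.
Qed.

Lemma Lp_sum (I : Type) (r : seq I) (F : I -> 'rV[R]_N -> R) :
  (forall i, Lp (F i)) -> Lp (fun x => \sum_(i <- r) F i x).
Proof.
move=> LF; elim: r => [|i r IH].
  split; first by under eq_fun do rewrite big_nil; exact: measurable_cst.
  by rewrite /powint; under eq_integral do rewrite big_nil normr0 powR0 ?gt_eqF//; rewrite integral0.
by have := LpD (LF i) IH; congr (Lp _); apply/funext => x /=; rewrite big_cons.
Qed.

Lemma pnorm0 : pnorm (fun=> 0) = 0.
Proof.
apply/eqP; rewrite eq_le pnorm_ge0 andbT; apply: pnorm_le => //.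
by rewrite /powint; under eq_integral do rewrite normr0; rewrite powR0 ?gt_eqF// integral0.
Qed.

Lemma pnorm_sum (I : Type) (r : seq I) (F : I -> 'rV[R]_N -> R) :
  (forall i, Lp (F i)) -> pnorm (fun x => \sum_(i <- r) F i x) <= \sum_(i <- r) pnorm (F i).
Proof.
move=> LF; elim: r => [|i r IH].
  by under eq_fun do rewrite big_nil; rewrite big_nil pnorm0.
under eq_fun do rewrite big_cons; rewrite big_cons.
by apply: (le_trans (pnormD (LF i) (Lp_sum r LF))); rewrite lerD2l.
Qed.

Lemma Lp_translation h F : Lp F -> Lp (fun x => F (x + h)).
Proof.
move=> [mF Foo]; split; last by rewrite powint_translation.
exact: measurableT_comp mF (measurable_addrV h).
Qed.

Lemma pnorm_translation h F : Lp F -> pnorm (fun x => F (x + h)) = pnorm F.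
Proof. by move=> [mF _]; rewrite /pnorm !Lnorm_powint powint_translation. Qed.

Lemma Lp_tdiff h F : Lp F -> Lp (tdiff h F).
Proof. by move=> LF; exact: LpB (Lp_translation h LF) LF. Qed.

End pnorm.

(** * Continuity of translations in L^p *)

Import HBNNSimple.

Section translation_continuity.
Context {R : realType} {N : nat}.
Local Notation leb := (@lebesgue_rV R N).
Implicit Types (F G : 'rV[R]_N -> R) (h : 'rV[R]_N) (A B : set 'rV[R]_N).
Variable p : R.
Hypothesis p1 : 1 < p.

Let p0 : 0 < p. Proof. exact: lt_trans ltr01 p1. Qed.

Definition translation_continuous F := forall e : R, 0 < e ->
  exists2 d : R, 0 < d & forall h, (forall j, `|h ord0 j| <= d) ->
    pnorm p (tdiff h F) <= e.

Local Notation Tcont := translation_continuous.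

Lemma TcontD F G : Lp p F -> Lp p G -> Tcont F -> Tcont G -> Tcont (F \+ G).
Proof.
move=> LF LG TF TG e e0; have e2 : 0 < e / 2 by rewrite divr_gt0.
have [dF dF0 HF] := TF _ e2; have [dG dG0 HG] := TG _ e2.
exists (Num.min dF dG) => [|h hd]; first by rewrite lt_min dF0.
have -> : tdiff h (F \+ G) = tdiff h F \+ tdiff h G.
  by apply/funext => x; rewrite /tdiff /= opprD addrACA.
apply: (le_trans (pnormD p1 (Lp_tdiff p1 h LF) (Lp_tdiff p1 h LG))).
rewrite [leRHS](splitr e) lerD//.
  by apply: HF => j; apply: le_trans (hd j) _; rewrite ge_min lexx.
by apply: HG => j; apply: le_trans (hd j) _; rewrite ge_min lexx orbT.
Qed.

Lemma TcontZ c F : Lp p F -> Tcont F -> Tcont (fun x => c * F x).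
Proof.
move=> LF TF e e0; have c1 : 0 < `|c| + 1 by rewrite ltr_pwDr.
have [d d0 HF] := TF _ (divr_gt0 e0 c1); exists d => // h hd.
have -> : tdiff h (fun x => c * F x) = (fun x => c * tdiff h F x).
  by apply/funext => x; rewrite /tdiff mulrBr.
rewrite (pnormZ p1 c (Lp_tdiff p1 h LF)).
apply: (@le_trans _ _ ((`|c| + 1) * (e / (`|c| + 1)))).
  by apply: ler_pM => //; [exact: pnorm_ge0|rewrite lerDl|exact: HF].
by rewrite mulrC divfK// gt_eqF.
Qed.

Lemma TcontB F G : Lp p F -> Lp p G -> Tcont F -> Tcont G -> Tcont (F \- G).
Proof.
move=> LF LG TF TG; have := TcontD LF (LpZ (-1) LG) TF (TcontZ (-1) LG TG).
by congr Tcont; apply/funext => x /=; rewrite mulN1r.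
Qed.

Lemma Tcont0 : Tcont (fun=> 0).
Proof.
move=> e e0; exists 1 => // h _.
rewrite (_ : tdiff _ _ = fun=> 0) ?pnorm0 ?ltW//.
by apply/funext => x; rewrite /tdiff subrr.
Qed.

Lemma Tcont_sum (I : Type) (r : seq I) (F : I -> 'rV[R]_N -> R) :
  (forall i, Lp p (F i)) -> (forall i, Tcont (F i)) ->
  Tcont (fun x => \sum_(i <- r) F i x).
Proof.
move=> LF TF; elim: r => [|i r IH].
  by under eq_fun do rewrite big_nil; exact: Tcont0.
under eq_fun do rewrite big_cons.
by apply: TcontD => //; exact: Lp_sum.
Qed.

(** Translations are isometries of L^p. *)
Lemma Tcont_approx F : Lp p F ->
  (forall e, 0 < e -> exists G, [/\ Lp p G, Tcont G & pnorm p (F \- G) <= e]) ->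
  Tcont F.
Proof.
move=> LF approx e e0; have e3 : 0 < e / 3 by rewrite divr_gt0.
have [G [LG TG FG]] := approx _ e3; have [d d0 HG] := TG _ e3.
exists d => // h hd.
have LFG := LpB p1 LF LG.
have -> : tdiff h F = (fun x => (F \- G) (x + h)) \- (F \- G) \+ tdiff h G.
  by apply/funext => x; rewrite /tdiff /=; ring.
have LT := Lp_translation h LFG.
apply: (le_trans (pnormD p1 (LpB p1 LT LFG) (Lp_tdiff p1 h LG))).
have := pnormB p1 LT LFG; rewrite pnorm_translation//.
have := HG h hd; move: FG; set a := pnorm _ _; set b := pnorm _ (tdiff _ _); set c := pnorm _ (_ \- _).
by move=> ? ? ?; lra.
Qed.

Lemma powint_indic A : measurable A -> powint p (\1_A) = leb A.
Proof.
move=> mA; rewrite -[in RHS](setIT A) -integral_indic//.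
apply: eq_integral => x _; rewrite indicE; case: (x \in A) => /=.
  by rewrite normr1 powR1.
by rewrite normr0 powR0// gt_eqF.
Qed.

Lemma Lp_indic A : measurable A -> (leb A < +oo)%E -> Lp p (\1_A).
Proof.
by move=> mA Aoo; split; [exact: measurable_indic|rewrite powint_indic].
Qed.

Lemma cvg_powR_norm0 (u : R^nat) : u @ \oo --> 0 -> `|u n| `^ p @[n --> \oo] --> 0.
Proof.
move=> /cvgrPdist_lt u0; apply/cvgrPdist_lt => e e0.
have ep : 0 < e `^ p^-1 by rewrite powR_gt0.
apply: filterS (u0 _ ep) => n; rewrite !sub0r !normrN => un.
have pV : p^-1 * p = 1 by rewrite mulVf ?gt_eqF.
rewrite ger0_norm ?powR_ge0// -[ltRHS](powRr1 (ltW e0)) -pV powRrM.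
by apply: gt0_ltr_powR; rewrite ?nnegrE ?powR_ge0.
Qed.

Lemma cvg_nondecreasing_approx (u : (\bar R)^nat) (l : \bar R) (e : R) :
  u @ \oo --> l -> l \is a fin_num -> 0 < e -> exists n, (l <= u n + e%:E)%E.
Proof.
move=> cu lf e0; apply: contrapT => /forallNP H.
have : (l <= l - e%:E)%E.
  rewrite -{1}(cvg_lim _ cu)//; apply: lime_le; first by apply/cvg_ex; exists l.
  by apply: nearW => n; rewrite leeBrDr//; apply: ltW; rewrite ltNge; exact/negP/H.
by rewrite leeBrDr// -{2}[l]adde0 leeD2lE// lee_fin leNgt e0.
Qed.

(** For sets increasing to a set of finite measure the indicators converge in
    L^p. *)
Lemma Tcont_bigcup (A : (set 'rV[R]_N)^nat) : (forall n, measurable (A n)) ->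
  (leb (\bigcup_n A n) < +oo)%E -> nondecreasing_seq A ->
  (forall n, Tcont (\1_(A n))) -> Tcont (\1_(\bigcup_n A n)).
Proof.
move=> mA Uoo ndA TA.
have mU : measurable (\bigcup_n A n) by exact: bigcupT_measurable.
have AU n : A n `<=` \bigcup_n A n by exact: bigcup_sup.
have Aoo n : (leb (A n) < +oo)%E.
  by apply: le_lt_trans Uoo; apply: le_measure; rewrite ?inE.
apply: Tcont_approx => [|e e0]; first exact: Lp_indic.
have cA : leb \o A @ \oo --> leb (\bigcup_n A n) by exact: nondecreasing_cvg_mu.
have ep0 : 0 < e `^ p by rewrite powR_gt0.
have [n Hn] : exists n, (leb (\bigcup_n A n) <= leb (A n) + (e `^ p)%:E)%E.
  by apply: cvg_nondecreasing_approx cA _ ep0; rewrite ge0_fin_numE.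
exists (\1_(A n)); split; [exact: Lp_indic|exact: TA|].
apply: pnorm_le => //; first exact: ltW.
have -> : \1_(\bigcup_n A n) \- \1_(A n) = \1_(\bigcup_n A n `\` A n) :> ('rV[R]_N -> R).
  apply/funext => x /=; rewrite !indicE in_setD.
  have [xA|xA] := boolP (x \in A n); last by rewrite andbT subr0.
  by rewrite andbF mem_set ?subrr//; apply: AU; rewrite inE in xA; exact: xA.
rewrite powint_indic; last exact: measurableD.
rewrite measureD// setIidr// leeBlDl//.
by rewrite ge0_fin_numE// Aoo.
Qed.

(** The box shrunk by 1/k on every side is contained in the box and in its
    translates by vectors with coordinates at most 1/k, and its volume tends
    to that of the box. *)
Lemma Tcont_box a b : Tcont (\1_(box a b)).
Proof.
(* the boxes shrunk by 1/(k+1) *)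
pose A (k : nat) : set 'rV[R]_N := box (a + const_mx k.+1%:R^-1) (b - const_mx k.+1%:R^-1).
have mA k : measurable (A k) by exact: measurable_box.
have kinv m n : (m <= n)%N -> n.+1%:R^-1 <= m.+1%:R^-1 :> R.
  by move=> mn; rewrite lef_pV2 ?posrE// ler_nat ltnS.
have ndA : nondecreasing_seq A.
  move=> m n mn; apply/subsetPset => x xA i; have := xA i; rewrite !mxE.
  move: (kinv _ _ mn); move: (m.+1%:R^-1) (n.+1%:R^-1) => u v ? /andP[? ?]; apply/andP; split; lra.
have AU : box a b = \bigcup_k A k.
  apply/seteqP; split => [x xab|x [k _ xA] i]; last first.
    have := xA i; rewrite !mxE.
    have : 0 < k.+1%:R^-1 :> R by rewrite invr_gt0.
    by move: (k.+1%:R^-1) => u ? /andP[? ?]; apply/andP; split; lra.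
  have [k Hk] : exists k : nat, forall i,
      k.+1%:R^-1 < x ord0 i - a ord0 i /\ k.+1%:R^-1 < b ord0 i - x ord0 i.
    pose m (i : 'I_N) : R := Num.min (x ord0 i - a ord0 i) (b ord0 i - x ord0 i).
    have m0 i : 0 < m i.
      by rewrite /m lt_min !subr_gt0; have /andP[-> ->] := xab i.
    pose M : R := \sum_i (m i)^-1.
    exists (Num.trunc M) => i; suff : (Num.trunc M).+1%:R^-1 < m i.
      by rewrite lt_min => /andP[].
    rewrite invf_plt ?posrE//; apply: (@le_lt_trans _ _ M).
      by rewrite /M (bigD1 i)//= lerDl sumr_ge0// => j _; rewrite invr_ge0 ltW.
    exact: truncnS_gt.
  exists k => // i; rewrite !mxE; have [] := Hk i.
  by move: (k.+1%:R^-1) => u ? ?; apply/andP; split; lra.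
have cA : leb \o A @ \oo --> leb (box a b).
  by rewrite AU; apply: nondecreasing_cvg_mu => //; rewrite -AU; exact: measurable_box.
move=> e e0.
have ep0 : 0 < e `^ p / 2 by rewrite divr_gt0// powR_gt0.
have Boo := lebesgue_box_lty a b.
have Aoo k : (leb (A k) < +oo)%E by exact: lebesgue_box_lty.
have [k Hk] : exists k, (leb (box a b) <= leb (A k) + (e `^ p / 2)%:E)%E.
  by apply: cvg_nondecreasing_approx cA _ ep0; rewrite ge0_fin_numE.
exists k.+1%:R^-1 => [|h hd]; first by rewrite invr_gt0.
apply: pnorm_le => //; first exact: ltW.
have mB : measurable (box a b) by exact: measurable_box.
have Lind := Lp_indic mB Boo.
(* stated without subtraction: pointwise, |1_A (x + h) - 1_A x|^p + 2 1_Ak x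
   is at most 1_A (x + h) + 1_A x *)
suff H : (powint p (tdiff h (\1_(box a b))) + (2%:E * leb (A k)) <= 2%:E * leb (box a b))%E.
  have /ge0_fin_numE fA : (0 <= leb (A k))%E by [].
  rewrite -leeBrDr in H; last by rewrite fin_numM// fA Aoo.
  apply: (le_trans H); rewrite leeBlDr; last by rewrite fin_numM// fA Aoo.
  apply: (@le_trans _ _ (2%:E * (leb (A k) + (e `^ p / 2)%:E))%E); first exact: lee_wpmul2l.
  rewrite ge0_muleDr//; last by rewrite lee_fin ltW.
  by rewrite addeC -EFinM mulrC divfK.
have mI B : measurable B -> measurable_fun setT (fun x => (\1_B x)%:E : \bar R).
  by move=> mB'; apply/measurable_EFinP; exact: measurable_indic.
have intI B : measurable B -> (\int[leb]_x (\1_B x)%:E = leb B)%E.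
  by move=> mB'; rewrite integral_indic// setIT.
have mIt := measurableT_comp (mI _ mB) (measurable_addrV h).
have e1 : (2%:E * leb (box a b) = \int[leb]_x ((\1_(box a b) (x + h))%:E + (\1_(box a b) x)%:E))%E.
  rewrite ge0_integralD//; try exact: mIt; try exact: mI.
  rewrite (ge0_integral_translation h (f := fun x => (\1_(box a b) x)%:E))//; last exact: mI.
  by rewrite intI// mule_natl mule2n.
have e2 : (2%:E * leb (A k) = \int[leb]_x (2%:E * (\1_(A k) x)%:E))%E.
  by rewrite ge0_integralZl// ?intI//; exact: mI.
have mt : measurable_fun setT (fun x => (`|tdiff h \1_(box a b) x| `^ p)%:E).
  by apply: measurable_powabs; case: (Lp_tdiff p1 h Lind).
rewrite e1 e2 /powint -ge0_integralD//; last first.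
  by apply: emeasurable_funM => //; exact: mI.
apply: ge0_le_integral => //.
- by move=> x _; rewrite -EFinM -EFinD lee_fin addr_ge0 ?powR_ge0.
- by apply: emeasurable_funD => //; apply: emeasurable_funM => //; exact: mI.
- by apply: emeasurable_funD; [exact: mIt|exact: mI].
move=> x _; rewrite -EFinM -!EFinD lee_fin /tdiff !indicE.
have in1 : x \in A k -> x \in box a b.
  by rewrite !inE => xA; rewrite AU; exists k.
have in2 : x \in A k -> (x + h) \in box a b.
  rewrite !inE => xA i; have := xA i; rewrite !mxE.
  have u0 : 0 < k.+1%:R^-1 :> R by rewrite invr_gt0.
  have := hd i; rewrite ler_norml; move: u0; move: (k.+1%:R^-1) => u u0 /andP[? ?] /andP[? ?].
  by apply/andP; split; lra.
have [xA|xA] := boolP (x \in A k).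
  by rewrite in1// in2//= subrr normr0 powR0 ?gt_eqF//; lra.
case: (x \in box a b); case: ((x + h) \in box a b); rewrite /= ?subrr ?subr0 ?sub0r ?normrN ?normr1 ?normr0 ?powR1 ?powR0 ?gt_eqF//; lra.
Qed.


(** Dynkin's lemma, starting from boxes; the intersection with a cube keeps
    all measures finite. *)
Lemma Tcont_cube_indic (r : R) A : measurable A -> Tcont (\1_(A `&` cube r)).
Proof.
pose Q := cube r : set 'rV[R]_N.
have mQ : measurable Q by exact: measurable_box.
have Qoo : (leb Q < +oo)%E by exact: lebesgue_box_lty.
have mAQ B : measurable B -> measurable (B `&` Q) by move=> mB; exact: measurableI.
have AQoo B : measurable B -> (leb (B `&` Q) < +oo)%E.
  by move=> mB; apply: le_lt_trans Qoo; apply: le_measure; rewrite ?inE//; exact: mAQ.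
have LI B : measurable B -> Lp p (\1_(B `&` Q)).
  by move=> mB; apply: Lp_indic; [exact: mAQ|exact: AQoo].
rewrite measurable_boxes; move: A; apply: (dynkin_induction (G := boxes)).
- exact: measurable_boxes.
- exact: setI_closed_boxes.
- by rewrite setTI; exact: Tcont_box.
- move=> A bA; have : boxes (A `&` cube r) by apply: setI_closed_boxes => //; eexists; eexists.
  by case=> a [b ->]; exact: Tcont_box.
- move=> A mA TA.
  have -> : \1_(~` A `&` cube r) = \1_(setT `&` Q) \- \1_(A `&` Q) :> ('rV[R]_N -> R).
    apply/funext => x /=; rewrite !indicE !in_setI in_setC in_setT.
    by case: (x \in A); case: (x \in Q); rewrite /= ?subrr ?subr0.
  apply: TcontB => //; try exact: LI.
  by rewrite setTI; exact: Tcont_box.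
- move=> F mF tF TF; rewrite setI_bigcupl.
  pose B n := \big[setU/set0]_(i < n) (F i `&` Q).
  have mB n : measurable (B n) by apply: bigsetU_measurable => i _; exact: mAQ.
  have BE n : B n = \bigcup_(i < n) (F i `&` Q) by rewrite bigcup_mkord.
  have EB : \bigcup_i (F i `&` cube r) = \bigcup_n B n.
    rewrite eqEsubset; split => [x [n _ xF]|x [n _]].
      by exists n.+1 => //; rewrite /B big_ord_recr /=; right.
    by rewrite BE => -[k _ xF]; exists k.
  rewrite EB; apply: Tcont_bigcup => //.
  + rewrite -EB -setI_bigcupl; apply: AQoo; exact: bigcupT_measurable.
  + by apply/nondecreasing_seqP => n; apply/subsetPset; rewrite /B big_ord_recr /=; exact: subsetUl.
  + elim=> [|n IH].
      rewrite /B big_ord0 (_ : \1_set0 = fun=> 0); first exact: Tcont0.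
      by apply/funext => x; rewrite indicE in_set0.
    have -> : \1_(B n.+1) = \1_(B n) \+ \1_(F n `&` Q) :> ('rV[R]_N -> R).
      apply/funext => x; rewrite /B big_ord_recr /= -/(B n) !indicE in_setU.
      have [xB|] := boolP (x \in B n); last by rewrite add0r.
      rewrite memNset ?addr0// => -[xFn _].
      move: xB; rewrite inE BE => -[k /= kn [xFk _]].
      have := tF k n I I (ex_intro _ x (conj xFk xFn)).
      by move=> kE; rewrite kE ltnn in kn.
    apply: TcontD => //; last exact: LI.
    apply: Lp_indic => //; apply: le_lt_trans Qoo; apply: le_measure; rewrite ?inE//.
    by rewrite BE => x [k _ []].
Qed.

Lemma Tcont_simple (s : {nnsfun 'rV[R]_N >-> R}) (r : R) :
  Lp p (fun x => s x * \1_(cube r) x) /\ Tcont (fun x => s x * \1_(cube r) x).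
Proof.
have -> : (fun x => s x * \1_(cube r) x) = (fun x =>
    \sum_(y <- finmap.enum_fset (fset_set (range s))) y * \1_(s @^-1` [set y] `&` cube r) x).
  apply/funext => x; rewrite fimfunE fsbig_finite//= big_distrl/=.
  by apply: eq_bigr => y _; rewrite -mulrA !indicE in_setI -natrM mulnb.
have mA y : measurable (s @^-1` [set y]) by exact: measurable_sfunP.
have mAQ y : measurable (s @^-1` [set y] `&` cube r).
  by apply: measurableI => //; exact: measurable_box.
have L y : Lp p (\1_(s @^-1` [set y] `&` cube r)).
  apply: Lp_indic => //; apply: le_lt_trans (lebesgue_box_lty (const_mx (- r)) (const_mx r)).
  by apply: le_measure; rewrite ?inE//; exact: measurable_box.
split; first by apply: (Lp_sum p1) => y; exact: LpZ.
by apply: Tcont_sum => y; [exact: LpZ|apply: TcontZ => //; exact: Tcont_cube_indic].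
Qed.

(** Simple functions below F, cut off outside larger and larger cubes,
    converge to F in L^p by dominated convergence. *)
Lemma Tcont_ge0 F : Lp p F -> (forall x, 0 <= F x) -> Tcont F.
Proof.
move=> LF F0; have [mF Foo] := LF.
have mFE : measurable_fun setT (EFin \o F) by exact/measurable_EFinP.
pose s := nnsfun_approx measurableT mFE.
have sc x : s n x @[n --> \oo] --> F x.
  have := cvg_nnsfun_approx measurableT mFE (fun x _ => F0 x) (I : setT x).
  exact: fine_cvg.
have sF n x : s n x <= F x.
  rewrite -(cvg_lim _ (sc x))//; apply: (nondecreasing_cvgn_le (u_ := s ^~ x)).
    by move=> k m km; have /lefP := nd_nnsfun_approx measurableT mFE km; apply.
  by apply/cvg_ex; exists (F x); exact: sc.
pose G n (x : 'rV[R]_N) : R := s n x * \1_(cube n.+1%:R) x.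
have LG n := (Tcont_simple (s n) n.+1%:R).1.
have GF x : G n x @[n --> \oo] --> F x.
  rewrite -[F x]mulr1; apply: cvgM; first exact: sc.
  apply: cvg_near_cst; have : setT x by [].
  rewrite -bigcup_cube => -[k _ xk]; exists k => // n /= kn.
  rewrite indicE mem_set//; apply/cubeP => i; move/cubeP : xk => /(_ i)/lt_le_trans; apply.
  by rewrite ler_nat ltnS.
have G0 n x : 0 <= G n x <= F x.
  rewrite mulr_ge0//= /G indicE; case: (_ \in _); rewrite ?mulr1 ?mulr0//.
have : powint p (F \- G n) @[n --> \oo] --> 0%E.
  have -> : (0 : \bar R)%E = (\int[leb]_x (cst 0 x))%E by rewrite integral0.
  apply: (@dominated_cvg _ _ _ leb setT measurableT _ _ (fun x => (`|F x| `^ p)%:E)) => //.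
  - by move=> n; apply: measurable_powabs; apply: measurable_funB => //; case: (LG n).
  - move=> x _; apply: cvg_EFin; first by near=> k.
    apply: cvg_powR_norm0 => //; rewrite -(subrr (F x)).
    by apply: cvgB => //; exact: cvg_cst.
  - apply/integrableP; split; first exact: measurable_powabs.
    apply: le_lt_trans Foo; rewrite le_eqVlt; apply/orP; left; apply/eqP.
    by apply: eq_integral => x _; rewrite gee0_abs// lee_fin powR_ge0.
  - move=> n x _; rewrite gee0_abs ?lee_fin ?powR_ge0// ge0_ler_powR ?nnegrE ?(ltW p0)//.
    have /andP[G1 G2] := G0 n x; rewrite /= ger0_norm ?subr_ge0// ger0_norm//.
    by rewrite gerBl.
move=> cvg0; apply: Tcont_approx => // e e0.
have ep0 : 0 < e `^ p by rewrite powR_gt0.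
have [n Hn] : exists n, (powint p (F \- G n)%R <= (e `^ p)%:E)%E.
  have /fine_cvgP[_ /cvgrPdist_lt/(_ _ ep0)[n _ /(_ n (leqnn n))]] := cvg0.
  rewrite /= sub0r normrN => H; exists n.
  have Ln := LpB p1 LF (LG n).
  have /fineK <- : powint p (F \- G n)%R \is a fin_num.
    by rewrite ge0_fin_numE; [exact: Ln.2|exact: powint_ge0].
  by rewrite lee_fin ltW// (le_lt_trans (ler_norm _)).
exists (G n); split; [exact: LG|exact: (Tcont_simple (s n) n.+1%:R).2|].
by apply: pnorm_le => //; exact: ltW.
Unshelve. all: by end_near.
Qed.

Lemma translation_continuousP F : Lp p F -> Tcont F.
Proof.
move=> LF; have [mF Foo] := LF.
pose P (x : 'rV[R]_N) := Num.max (F x) 0; pose M (x : 'rV[R]_N) := Num.max (- F x) 0.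
have mP : measurable_fun setT P by exact: measurable_maxr.
have mM : measurable_fun setT M by apply: measurable_maxr => //; exact: measurableT_comp.
have LP : Lp p P.
  split; first exact: mP.
  apply: le_lt_trans Foo; apply: ge0_le_integral => //.
  - exact: measurable_powabs.
  - exact: measurable_powabs.
  - move=> x _; rewrite lee_fin ge0_ler_powR ?nnegrE ?(ltW p0)//.
    by rewrite /P; have [_|/ltW H] := leP (F x) 0; rewrite ?normr0//.
have LM : Lp p M.
  split; first exact: mM.
  apply: le_lt_trans Foo; apply: ge0_le_integral => //.
  - exact: measurable_powabs.
  - exact: measurable_powabs.
  - move=> x _; rewrite lee_fin ge0_ler_powR ?nnegrE ?(ltW p0)//.
    by rewrite /M; have [_|/ltW H] := leP (- F x) 0; rewrite ?normr0// normrN.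
have -> : F = P \- M.
  apply/funext => x; rewrite /P /M /=; have [H|H] := leP (F x) 0.
    by rewrite max_l ?oppr_ge0// sub0r opprK.
  by rewrite max_r ?oppr_le0 ?ltW// subr0.
by apply: TcontB => //; apply: Tcont_ge0 => // x; rewrite /P /M le_max lexx orbT.
Qed.

End translation_continuity.

(** * Differentiability in L^p *)

Section Lp_differentiability.
Context {R : realType} {N : nat}.
Local Notation leb := (@lebesgue_rV R N).
Local Notation e_ i := (delta_mx ord0 i : 'rV[R]_N).
Implicit Types (h x : 'rV[R]_N).
Variables (p : R) (f : 'rV[R]_N -> R) (Df : 'rV[R]_N -> 'rV[R]_N).
Hypothesis p1 : 1 < p.

Let p0 : 0 < p. Proof. exact: lt_trans ltr01 p1. Qed.

Local Notation g i := (fun x => Df x ord0 i).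

Hypothesis Lf : Lp p f.
Hypothesis Lg : forall i, Lp p (g i).
Hypothesis wfg : forall i, weak_partial i f (g i).

Lemma unif01_integral_le (u : R -> \bar R) (C : \bar R) :
  measurable_fun setT u -> (forall r : R, 0 <= u r)%E -> (0 <= C)%E ->
  (forall r : R, 0 <= r <= 1 -> (u r <= C)%E) -> (\int[unif01]_r u r <= C)%E.
Proof.
move=> mu u0 C0 uC; rewrite -(integral_cst_unif01 C) !ge0_integral_unif01//.
apply: ge0_le_integral => //; exact: measurable_funTS.
Qed.

Lemma finite_uniform (P : 'I_N -> R -> Prop) :
  (forall i d d', P i d -> 0 < d' -> d' <= d -> P i d') ->
  (forall i, exists2 d, 0 < d & P i d) -> exists2 d, 0 < d & forall i, P i d.
Proof.
move=> Pmono Pex.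
have [d dP] : {d : 'I_N -> R & forall i, 0 < d i /\ P i (d i)}.
  by apply: (@choice 'I_N R (fun i d => 0 < d /\ P i d)) => i; have [d d0 Pd] := Pex i; exists d.
have m0 : 0 < \big[Num.min/1]_i d i.
  elim/big_ind : _ => [//|a b a0 b0|i _]; [by rewrite lt_min a0|exact: (dP i).1].
exists (\big[Num.min/1]_i d i) => // i; apply: (Pmono _ _ _ (dP i).2 m0).
exact: bigmin_le_cond.
Qed.

(** [powint_increment] bounds the left-hand side by an average of translation
    errors of the partial derivative. *)
Lemma pnorm_increment_line (i : 'I_N) (e : R) : 0 < e ->
  exists2 d, 0 < d & forall c : R, `|c| <= d ->
    pnorm p (fun x => f (x + c *: e_ i) - f x - c * g i x) <= `|c| * e.
Proof.
move=> e0; have [mf foo] := Lf; have [mg goo] := Lg i.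
have [d d0 Hd] := translation_continuousP p1 (Lg i) e0.
exists d => // c cd; apply: pnorm_le => //; first by rewrite mulr_ge0// ltW.
apply: (le_trans (powint_increment c p1 mf mg foo goo (@wfg i))).
rewrite powRM ?(ltW e0)// EFinM; apply: lee_wpmul2l; first by rewrite lee_fin powR_ge0.
pose K (z : 'rV[R]_N * R) : R := `|Df (z.1 + (c * z.2) *: e_ i) ord0 i - Df z.1 ord0 i| `^ p.
have mK : measurable_fun setT (EFin \o K).
  apply: measurable_powabs; apply: measurable_funB.
    exact: measurableT_comp mg (measurable_line i c).
  exact: measurableT_comp mg measurable_fst.
apply: unif01_integral_le.
- apply: (measurable_fun_fubini_tonelli_G (m1 := leb) (EFin \o K)) => // z.
  by rewrite lee_fin powR_ge0.
- by move=> r; exact: powint_ge0.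
- by rewrite lee_fin powR_ge0.
- move=> r /andP[r0 r1].
  have LT := Lp_tdiff p1 ((c * r) *: e_ i) (Lg i).
  rewrite [leLHS](powint_pnorm p1 LT) lee_fin ge0_ler_powR ?nnegrE ?pnorm_ge0 ?(ltW e0) ?(ltW p0)//.
  apply: Hd => j; rewrite !mxE eqxx /= !normrM (ger0_norm r0).
  rewrite -[d]mulr1 -[d * 1]mulr1; apply: ler_pM; rewrite ?mulr_ge0//; last by case: eqP; rewrite ?normr1 ?normr0.
  by apply: ler_pM.
Qed.

Definition remainder h x : R := f (x + h) - f x - dot h (Df x).

Lemma Lp_gradient h : Lp p (fun x => dot h (Df x)).
Proof.
exact: (Lp_sum p1 (index_enum 'I_N) (fun i => LpZ (h ord0 i) (Lg i))).
Qed.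

Lemma Lp_remainder h : Lp p (remainder h).
Proof. exact: (LpB p1 (Lp_tdiff p1 h Lf) (Lp_gradient h)). Qed.

(** Going from x to x + h along one axis at a time, each leg is estimated by
    [pnorm_increment_line] translated to its starting point, and replacing the
    partial derivative there by its value at x costs a translation error. *)
Lemma pnorm_remainder_sum (e : R) : 0 < e ->
  exists2 d, 0 < d & forall h, (forall j, `|h ord0 j| <= d) ->
    pnorm p (remainder h) <= e * \sum_j `|h ord0 j|.
Proof.
move=> e0; have e2 : 0 < e / 2 by rewrite divr_gt0.
have [d1 d10 H1] : exists2 d, 0 < d & forall i c, `|c| <= d ->
    pnorm p (fun x => f (x + c *: e_ i) - f x - c * g i x) <= `|c| * (e / 2).
  apply: finite_uniform => [i d d' Hd d'0 dd' c cd'|i].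
    by apply: Hd; exact: le_trans dd'.
  exact: pnorm_increment_line.
have [d2 d20 H2] : exists2 d, 0 < d & forall i h, (forall j, `|h ord0 j| <= d) ->
    pnorm p (tdiff h (g i)) <= e / 2.
  apply: finite_uniform => [i d d' Hd d'0 dd' h hd'|i].
    by apply: Hd => j; exact: le_trans dd'.
  exact: translation_continuousP (Lg i) _ e2.
(* a path has at most N legs, so its points stay within d2 of the start *)
exists (Num.min d1 (d2 / N.+1%:R)) => [|h hd].
  by rewrite lt_min d10 divr_gt0.
have hd1 j : `|h ord0 j| <= d1 by apply: le_trans (hd j) _; rewrite ge_min lexx.
have hd2 j : `|h ord0 j| <= d2 / N.+1%:R by apply: le_trans (hd j) _; rewrite ge_min lexx orbT.
(* the displacement after moving along the axes in s, and its linear effect *)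
pose P (s : seq 'I_N) : 'rV[R]_N := \sum_(j <- s) h ord0 j *: e_ j.
pose S (s : seq 'I_N) (x : 'rV[R]_N) : R := \sum_(j <- s) h ord0 j * Df x ord0 j.
have LS s : Lp p (S s) by exact: (Lp_sum p1 s (fun i => LpZ (h ord0 i) (Lg i))).
have P_le s i : `|P s ord0 i| <= (size s)%:R * (d2 / N.+1%:R).
  elim: s => [|j s IH]; first by rewrite /P big_nil mxE normr0 mul0r.
  rewrite /P big_cons mxE -/(P s) /= -natr1 mulrDl mul1r addrC.
  apply: (le_trans (ler_normD _ _)); apply: lerD => //.
  rewrite !mxE eqxx /= normrM; apply: le_trans (hd2 j).
  by case: eqP; rewrite ?normr1 ?normr0 ?mulr1 ?mulr0.
have step s : (size s <= N)%N ->
    pnorm p (fun x => f (x + P s) - f x - S s x) <= e * \sum_(j <- s) `|h ord0 j|.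
  elim: s => [_|j s IH sN].
    rewrite (_ : (fun x => _) = fun=> 0) ?pnorm0 ?big_nil ?mulr0//.
    by apply/funext => x; rewrite /P /S !big_nil addr0 !subrr.
  pose A x := f (x + h ord0 j *: e_ j) - f x - h ord0 j * g j x.
  have LA : Lp p A.
    exact: (LpB p1 (Lp_tdiff p1 (h ord0 j *: e_ j) Lf) (LpZ (h ord0 j) (Lg j))).
  have LAP : Lp p (fun x => A (x + P s)) := Lp_translation (P s) LA.
  pose B x := h ord0 j * tdiff (P s) (g j) x.
  have LB : Lp p B := LpZ (h ord0 j) (Lp_tdiff p1 (P s) (Lg j)).
  pose C x := f (x + P s) - f x - S s x.
  have LC : Lp p C := LpB p1 (Lp_tdiff p1 (P s) Lf) (LS s).
  rewrite (_ : (fun x => _) = ((fun x => A (x + P s)) \+ B) \+ C); last first.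
    apply/funext => x; rewrite /A /B /C /S /tdiff /= /P !big_cons -/(P s).
    rewrite (addrC (h ord0 j *: _)) addrA; ring.
  have H3 := pnormD p1 (LpD p1 LAP LB) LC; apply: (le_trans H3).
  rewrite big_cons mulrDr; apply: lerD; last by apply: IH; exact: ltnW.
  apply: (le_trans (pnormD p1 LAP LB)).
  rewrite (pnorm_translation p1 (P s) LA) (pnormZ p1 (h ord0 j) (Lp_tdiff p1 (P s) (Lg j))).
  have -> : e * `|h ord0 j| = `|h ord0 j| * (e / 2) + `|h ord0 j| * (e / 2) by field.
  apply: lerD; first by apply: H1.
  apply: ler_wpM2l => //; apply: H2 => i; apply: (le_trans (P_le s i)).
  rewrite mulrA ler_pdivrMr// mulrC; apply: ler_wpM2l; first exact: ltW.
  by rewrite ler_nat; apply: ltnW; apply: ltnW.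
have := step (index_enum 'I_N); rewrite /index_enum -enumT size_enum_ord leqnn => /(_ isT).
rewrite !big_enum /=; congr (pnorm p _ <= _); apply/funext => x.
rewrite /remainder; congr (f (x + _) - _ - _).
  by apply/rowP => i; rewrite /P big_enum /= [in RHS](row_sum_delta h).
by rewrite /S big_enum.
Qed.

Lemma pnorm_remainder (e : R) : 0 < e ->
  exists2 d, 0 < d & forall h, enorm h <= d -> pnorm p (remainder h) <= e * enorm h.
Proof.
move=> e0; have eN : 0 < e / N.+1%:R by rewrite divr_gt0.
have [d d0 Hd] := pnorm_remainder_sum eN; exists d => // h hd.
apply: (le_trans (Hd h _)) => [j|]; first exact: le_trans (coor_le_enorm _ _) hd.
rewrite -mulrA [_^-1 * _]mulrC; apply: ler_wpM2l; first exact: ltW.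
rewrite ler_pdivrMr//; apply: (@le_trans _ _ (enorm h * N%:R)); last first.
  by apply: ler_wpM2l; rewrite ?enorm_ge0// ler_nat.
rewrite mulr_natr -[X in _ *+ X](card_ord N) -sumr_const.
by apply: ler_sum => j _; exact: coor_le_enorm.
Qed.

End Lp_differentiability.

(** * Concentration of radial mollifiers at the origin *)

Section sandwich.
Context {R : realType}.
Local Open Scope ereal_scope.

(** For fixed w the upper bound tends to L + w V and the lower bound forces
    the lower limit of E to be at least L - w V. The sequences X and T may
    depend on w, so the limit in w has to be taken last. *)
Lemma cvg_sandwich (E : (\bar R)^nat) (L V : R) : (0 <= L)%R -> (0 <= V)%R ->
  (forall n, 0 <= E n) ->
  (forall w : R, (0 < w)%R -> exists (X T : (\bar R)^nat) (C : R),
    [/\ X @ \oo --> 1, T @ \oo --> 0, (0 <= C)%R &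
     forall n, E n <= X n * (L + w * V)%:E + C%:E * T n /\
               X n * L%:E <= E n + (w * V)%:E * X n]) ->
  E @ \oo --> L%:E.
Proof.
move=> L0 V0 E0 H.
have key (eta : R) : (0 < eta)%R -> \forall n \near \oo,
    E n \is a fin_num /\ (`|L - fine (E n)| <= eta / 2)%R.
  move=> eta0; pose w : R := (eta / (4 * (V + 1)))%R.
  have w0 : (0 < w)%R by rewrite divr_gt0// mulr_gt0// ltr_wpDl.
  have wV : (w * V <= eta / 4)%R.
    have V1 : (0 < V + 1)%R by rewrite ltr_wpDl.
    have -> : (w * V = eta / 4 * (V / (V + 1)))%R by rewrite /w; field; rewrite gt_eqF.
    rewrite ler_piMr//; first by rewrite divr_ge0// ltW.
    by rewrite ler_pdivrMr// mul1r lerDl.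
  have wV0 : (0 <= w * V)%R by rewrite mulr_ge0// ltW.
  have [X [T [C [cX cT C0 XT]]]] := H w w0.
  pose D : R := (4 * (L + w * V + C + 1))%R.
  have D0 : (0 < D)%R by rewrite mulr_gt0// ltr_wpDl// !addr_ge0.
  pose k : R := (eta / D)%R.
  have k0 : (0 < k)%R by rewrite divr_gt0.
  have kD : (k * (L + w * V + C) <= eta / 4)%R.
    rewrite /k /D; rewrite mulrAC ler_pdivrMr//.
    rewrite /D; have -> : (eta / 4 * (4 * (L + w * V + C + 1)) = eta * (L + w * V + C + 1))%R by field.
    by apply: ler_wpM2l; [exact: ltW|rewrite lerDl].
  clearbody k.
  have /fine_cvgP[fX /cvgrPdist_lt/(_ _ k0) nX] := cX.
  have /fine_cvgP[fT /cvgrPdist_lt/(_ _ k0) nT] := cT.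
  near=> n.
  have /fineK EX : X n \is a fin_num by near: n.
  have /fineK ET : T n \is a fin_num by near: n.
  have Xn : (`|1 - fine (X n)| < k)%R by near: n.
  have Tn : (`|0 - fine (T n)| < k)%R by near: n.
  have [H1 H2] := XT n; move: H1 H2; rewrite -EX -ET; move: Xn Tn.
  move: (fine (X n)) (fine (T n)) => x t Xn Tn H1 H2.
  have fE : E n \is a fin_num.
    rewrite ge0_fin_numE//; apply: le_lt_trans H1 _.
    by rewrite -!EFinM -EFinD ltry.
  split => //; suff : forall e, E n = e%:E -> (`|L - e| <= eta / 2)%R.
    by apply; rewrite fineK.
  move=> e Ee; move: H1 H2; rewrite Ee -!EFinM -!EFinD !lee_fin => H1 H2.
  move: Xn Tn; rewrite !ltr_norml => /andP[x1 x2] /andP[t1 t2].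
  rewrite ler_norml; apply/andP; split.
    have : ((x - 1) * (L + w * V) <= k * (L + w * V))%R.
      apply: ler_wpM2r; first by rewrite addr_ge0.
      lra.
    have : (C * t <= C * k)%R by apply: ler_wpM2l => //; lra.
    move: kD H1; rewrite !mulrDr; lra.
  have : ((1 - x) * L <= k * L)%R by apply: ler_wpM2r => //; lra.
  have : (w * V * (x - 1) <= w * V * k)%R by apply: ler_wpM2l => //; lra.
  have : (0 <= k * C)%R by rewrite mulr_ge0// ltW.
  move: kD H2; rewrite !mulrDr; lra.
apply/fine_cvgP; split.
  by have := key 1%R ltr01; apply: filterS => n [].
apply/cvgrPdist_lt => eta eta0; apply: filterS (key _ eta0) => n [_ H1].
by apply: (le_lt_trans H1); lra.
Unshelve. all: by end_near.
Qed.

End sandwich.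

(** Monotone functions are Borel; taking the maximum with 0 extends the
    profile monotonically from the half-line to the line. *)
Lemma measurable_profile (R : realType) (N : nat) rho rhot (n : nat) :
  @mollifiers R N rho rhot -> measurable_fun setT (fun r : R => rhot n (Num.max r 0)).
Proof.
move=> mol; apply: nonincreasing_measurable => // r s rs.
apply: mollifier_profile_nonincreasing mol _ _ _ _ _; first by rewrite le_max lexx orbT.
by rewrite ge_max !le_max rs lexx !orbT.
Qed.

Section radial_limit.
Context {R : realType} {N : nat}.
Local Notation leb := (@lebesgue_rV R N).
Local Open Scope ereal_scope.
Variables (rho : nat -> 'rV[R]_N -> 'rV[R]_N -> R) (rhot : nat -> R -> R).
Hypothesis mol : mollifiers rho rhot.
Hypothesis N0 : (0 < N)%N.
Variables (phi psi : 'rV[R]_N -> R).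
Hypotheses (mphi : measurable_fun setT phi) (mpsi : measurable_fun setT psi).
Hypotheses (phi0 : forall h, (0 <= phi h)%R) (psi0 : forall h, (0 <= psi h)%R).
Hypothesis psi_homogeneous : forall (a : R) h, (0 < a)%R -> psi (a *: h) = psi h.
Hypothesis psi_fin : \int[leb]_(h in ball0 1) (psi h)%:E < +oo.
Hypothesis phi_psi : forall w : R, (0 < w)%R -> exists2 d : R, (0 < d)%R &
  forall h, (enorm h <= d)%R -> (`|phi h - psi h| <= w)%R.
Hypothesis phi_far : forall d : R, (0 < d)%R -> exists2 C : R, (0 <= C)%R &
  forall h, (d < enorm h)%R -> (phi h <= C)%R.

Let rt n (r : R) : R := rhot n (Num.max r 0%R).

Let rt0 n r : (0 <= rt n r)%R.
Proof. by apply: mollifier_profile_ge0 mol _ _ _; rewrite le_max lexx orbT. Qed.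

Let mrt n : measurable_fun setT (rt n).
Proof. exact: measurable_profile mol. Qed.

Let rt_enorm n (h : 'rV[R]_N) : rt n (enorm h) = rhot n (enorm h).
Proof. by rewrite /rt max_l// enorm_ge0. Qed.

(** Given w, choose d with |phi - psi| <= w on the ball of radius d. On this
    ball polar integration splits the integral against psi, or against a
    constant, into the radial mass of the mollifier, which tends to 1, and an
    integral over the unit ball. Off this ball phi is bounded and the mass of
    the mollifier tends to 0. *)
Lemma radial_limit :
  \int[leb]_h (rhot n (enorm h) * phi h)%:E @[n --> \oo] -->
  \int[leb]_(h in ball0 1) (psi h)%:E.
Proof.
have L0 : 0 <= \int[leb]_(h in ball0 1) (psi h)%:E.
  by apply: integral_ge0 => h _; rewrite lee_fin.
have fL : \int[leb]_(h in ball0 1) (psi h)%:E \is a fin_num by rewrite ge0_fin_numE.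
have fV : leb (ball0 1) \is a fin_num by rewrite ge0_fin_numE// lebesgue_ball_lty.
rewrite -(fineK fL).
apply: (cvg_sandwich (V := fine (leb (ball0 1)))).
- exact: fine_ge0.
- exact: fine_ge0.
- by move=> n; apply: integral_ge0 => h _; rewrite lee_fin mulr_ge0// -rt_enorm.
move=> w w0; have [d d0 Hd] := phi_psi w0; have [C C0 HC] := phi_far d0.
(* the profile near the origin and away from it *)
pose F n (r : R) : R := (rt n r * \1_`]-oo, d] r)%R.
pose F' n (r : R) : R := (rt n r * \1_`]d, +oo[ r)%R.
have F0 n r : (0 <= F n r)%R by rewrite mulr_ge0// indicE.
have F'0 n r : (0 <= F' n r)%R by rewrite mulr_ge0// indicE.
have mF n : measurable_fun setT (F n).
  by apply: measurable_funM => //; exact: measurable_indic.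
have mF' n : measurable_fun setT (F' n).
  by apply: measurable_funM => //; exact: measurable_indic.
pose X n := \int[lebesgue_measure]_(r in `[0%R, +oo[) ((F n r)%:E * (N%:R * r ^+ N.-1)%:E).
pose T n := \int[leb]_h (F' n (enorm h))%:E.
have mFe n : measurable_fun setT (fun h : 'rV[R]_N => F n (enorm h)).
  exact: measurableT_comp (mF n) measurable_enorm.
have mFe' n : measurable_fun setT (fun h : 'rV[R]_N => F' n (enorm h)).
  exact: measurableT_comp (mF' n) measurable_enorm.
have cX : X @ \oo --> 1.
  have -> : X = (fun n => N%:R%:E * \int[lebesgue_measure]_(r in `[0%R, d]) (r ^+ N.-1 * rhot n r)%:E).
    apply/funext => n.
    transitivity (N%:R%:E * \int[lebesgue_measure]_(r in `[0%R, d]) (r ^+ N.-1 * rt n r)%:E); last first.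
      congr (_ * _); apply: eq_integral => r; rewrite inE /= in_itv /= => /andP[r0 _].
      by rewrite /rt max_l.
    have mX : measurable_fun setT (fun r : R => r ^+ N.-1)%R.
      exact: (measurable_funX (T := measurableTypeR R)).
    have mrn : measurable_fun `[0%R, d]%classic (fun r : R => (r ^+ N.-1 * rt n r)%:E).
      apply: measurable_funTS; apply/measurable_EFinP; exact: (measurable_funM mX (mrt n)).
    rewrite -ge0_integralZl//; last first.
      by move=> r; rewrite /= in_itv /= => /andP[r0 _]; rewrite lee_fin mulr_ge0// exprn_ge0.
    rewrite /X [LHS]integral_mkcond [RHS]integral_mkcond; apply: eq_integral => r _.
    rewrite !patchE /F indicE !mem_setE !in_itv/= andbT.
    case: (0 <= r)%R => //=; case: (r <= d)%R => /=; last by rewrite mulr0 mul0e.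
    by rewrite mulr1 -!EFinM mulrC mulrA.
  have -> : (1 : \bar R) = N%:R%:E * (N%:R^-1)%:E.
    by rewrite -EFinM divff// pnatr_eq0 -lt0n.
  by apply: cvgeZl => //; exact: mollifier_profile_cvg mol _ d0.
have cT : T @ \oo --> 0.
  apply: (squeeze_cvge _ (cvg_cst 0) (mollifier_tail_cvg mol d0 0%R)).
  apply: nearW => n; apply/andP; split; first by apply: integral_ge0 => h _; rewrite lee_fin.
  rewrite /T [leRHS]integral_mkcond; apply: ge0_le_integral => //.
  - by move=> h _; rewrite lee_fin.
  - by apply/measurable_EFinP.
  - have mtail : measurable [set y : 'rV[R]_N | (d <= enorm (0 - y))%R].
      have := measurable_enorm (R := R) (n := N) measurableT (measurable_itv `[d, +oo[).
      rewrite setTI; congr measurable; apply/seteqP; split => y /=;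
        by rewrite in_itv/= andbT sub0r enormN.
    apply/(measurable_restrictT _ mtail); apply: measurable_funTS; apply/measurable_EFinP.
    have -> : rho n 0%R = (fun h => rt n (enorm h)).
      by apply/funext => h; rewrite (mollifier_radial mol) sub0r enormN -rt_enorm.
    exact: measurableT_comp (mrt n) measurable_enorm.
  move=> h _; rewrite patchE /F' indicE mem_setE in_itv/= andbT.
  have [dh|_] := ltP d (enorm h); last by rewrite mulr0; case: ifP => // _; rewrite lee_fin (mollifier_ge0 mol).
  rewrite mem_set /= ?sub0r ?enormN; last exact: ltW.
  by rewrite mulr1 (mollifier_radial mol) sub0r enormN rt_enorm.
exists X, T, C; split => //.
have polar n : \int[leb]_h (F n (enorm h) * psi h)%:E = X n * \int[leb]_(h in ball0 1) (psi h)%:E.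
  rewrite -(polar_homogeneous (F := fun r => (F n r)%:E) N0 mpsi psi0 psi_homogeneous psi_fin)//.
    exact/measurable_EFinP.
  by move=> r; rewrite lee_fin.
have polar1 n : \int[leb]_h (F n (enorm h))%:E = X n * leb (ball0 1).
  have m1 : measurable_fun setT (fun _ : 'rV[R]_N => 1%R : R) by exact: measurable_cst.
  have -> : leb (ball0 1) = \int[leb]_(h in ball0 1) (1%R : R)%:E.
    by rewrite integral_cst ?mul1e//; exact: measurable_ball0.
  rewrite -(polar_homogeneous (F := fun r => (F n r)%:E) (Psi := fun=> 1%R) N0 m1)//.
  - by apply: eq_integral => h _; rewrite mule1.
  - by rewrite integral_cst ?mul1e ?lebesgue_ball_lty//; exact: measurable_ball0.
  - exact/measurable_EFinP.
  - by move=> r; rewrite lee_fin.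
have mE (u : 'rV[R]_N -> R) : measurable_fun setT u -> measurable_fun setT (EFin \o u).
  by move=> mu; exact/measurable_EFinP.
have mrte n : measurable_fun setT (fun h : 'rV[R]_N => rhot n (enorm h)).
  under eq_fun do rewrite -rt_enorm.
  exact: measurableT_comp (mrt n) measurable_enorm.
have X0 n : 0 <= X n.
  apply: integral_ge0 => r; rewrite /= in_itv /= andbT => r0.
  by rewrite -EFinM lee_fin mulr_ge0// mulr_ge0// exprn_ge0.
have Fw n : \int[leb]_h (w * F n (enorm h))%:E = (w * fine (leb (ball0 1)))%:E * X n.
  under eq_integral do rewrite EFinM.
  rewrite ge0_integralZl//; [|exact: mE|by move=> h _; rewrite lee_fin|by rewrite lee_fin ltW].
  by rewrite polar1 EFinM fineK// -muleA [X n * _]muleC.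
move=> n; split.
  apply: (@le_trans _ _ (\int[leb]_h (F n (enorm h) * psi h)%:E +
      \int[leb]_h (w * F n (enorm h))%:E + \int[leb]_h (C * F' n (enorm h))%:E)).
    rewrite -ge0_integralD//; last 4 first.
    - by move=> h _; rewrite lee_fin mulr_ge0.
    - by apply: mE; exact: measurable_funM.
    - by move=> h _; rewrite lee_fin mulr_ge0// ltW.
    - by apply: mE; exact: measurable_funM.
    rewrite -ge0_integralD//; last 4 first.
    - by move=> h _; rewrite -EFinD lee_fin addr_ge0// mulr_ge0// ltW.
    - by apply: emeasurable_funD; apply: mE; exact: measurable_funM.
    - by move=> h _; rewrite lee_fin mulr_ge0.
    - by apply: mE; exact: measurable_funM.
    apply: ge0_le_integral => //.
    - by move=> h _; rewrite lee_fin mulr_ge0// -rt_enorm.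
    - by apply: mE; exact: measurable_funM.
    - apply: emeasurable_funD; last by apply: mE; exact: measurable_funM.
      by apply: emeasurable_funD; apply: mE; exact: measurable_funM.
    move=> h _; rewrite -!EFinD lee_fin -rt_enorm /F /F' !indicE !mem_setE !in_itv/= andbT ltNge.
    have [hd|hd] := leP (enorm h) d; rewrite /= !mulr1 !mulr0 ?mul0r ?add0r ?addr0.
      rewrite [(w * _)%R]mulrC -mulrDr; apply: ler_wpM2l => //.
      by have := Hd h hd; rewrite ler_norml => /andP[_]; rewrite lerBlDl.
    by rewrite mulrC; apply: ler_wpM2r => //; exact: HC.
  have L0' : 0 <= (fine (\int[leb]_(h in ball0 1) (psi h)%:E))%:E by rewrite fineK.
  have V0' : 0 <= (w * fine (leb (ball0 1)))%:E.
    by rewrite lee_fin; apply: mulr_ge0; [exact: ltW|exact: fine_ge0].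
  rewrite polar Fw EFinD (ge0_muleDr _ L0' V0') fineK//.
  rewrite [X n * (w * _)%:E]muleC leeD2l//.
  under eq_integral do rewrite EFinM.
  by rewrite ge0_integralZl//; [exact: mE|move=> h _; rewrite lee_fin].
rewrite fineK// -polar -Fw -ge0_integralD//; last 4 first.
- by move=> h _; rewrite lee_fin mulr_ge0// -rt_enorm.
- by apply: mE; exact: measurable_funM.
- by move=> h _; rewrite lee_fin mulr_ge0// ltW.
- by apply: mE; exact: measurable_funM.
apply: ge0_le_integral => //.
- by move=> h _; rewrite lee_fin mulr_ge0.
- by apply: mE; exact: measurable_funM.
- by apply: emeasurable_funD; apply: mE; exact: measurable_funM.
move=> h _; rewrite -!EFinD lee_fin -rt_enorm /F indicE mem_setE in_itv/=.
have [hd|hd] := leP (enorm h) d; rewrite /= ?mulr1 ?mulr0 ?mul0r ?addr0 ?mulr_ge0//.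
rewrite [(w * _)%R]mulrC -mulrDr; apply: ler_wpM2l => //.
have := Hd h hd; rewrite ler_norml => /andP[+ _].
by rewrite lerBrDl; lra.
Qed.

End radial_limit.

(** * Energies of difference quotients and of the gradient *)

Section difference_quotients.
Context {R : realType} {N : nat}.
Local Notation leb := (@lebesgue_rV R N).
Implicit Types (h x : 'rV[R]_N).
Variables (p : R) (f : 'rV[R]_N -> R) (Df : 'rV[R]_N -> 'rV[R]_N).
Hypothesis p1 : 1 < p.

Let p0 : 0 < p. Proof. exact: lt_trans ltr01 p1. Qed.

Local Notation g i := (fun x => Df x ord0 i).

Hypothesis Lf : Lp p f.
Hypothesis Lg : forall i, Lp p (g i).
Hypothesis wfg : forall i, weak_partial i f (g i).

(** The tangent inequality for the power function, from Young's inequality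
    applied to a^(p-1) b. *)
Lemma powRB_le (a b : R) : 0 <= b -> b <= a -> a `^ p - b `^ p <= p * a `^ (p - 1) * (a - b).
Proof.
move=> b0 ba; have a0 := le_trans b0 ba.
(* the conjugate exponent, so that (a^(p-1))^q = a^p *)
pose q := p / (p - 1).
have pB1 : 0 < p - 1 by rewrite subr_gt0.
have q0 : 0 < q by rewrite divr_gt0.
have pq : q^-1 + p^-1 = 1.
  by rewrite /q invf_div -{2}[p^-1]mul1r -mulrDl subrK divff// gt_eqF.
have := conjugate_powR (powR_ge0 a (p - 1)) b0 q0 p0 pq.
have -> : (a `^ (p - 1)) `^ q = a `^ p.
  by rewrite -powRrM /q mulrCA divff ?mulr1// gt_eqF.
have E : a `^ (p - 1) * a = a `^ p by rewrite mulrC mulr_powRB1.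
have -> : p * a `^ (p - 1) * (a - b) = p * (a `^ p - a `^ (p - 1) * b).
  by rewrite -E; ring.
move=> H.
have qE : q^-1 = 1 - p^-1 by rewrite -pq addrK.
have : p * (a `^ p - (a `^ p / q + b `^ p / p)) <= p * (a `^ p - a `^ (p - 1) * b).
  by rewrite ler_wpM2l ?(ltW p0)// lerD2l lerN2.
apply: le_trans; rewrite le_eqVlt; apply/orP; left; apply/eqP.
by rewrite qE; field; rewrite gt_eqF.
Qed.

Lemma powR_dist_le (a b M : R) : 0 <= a <= M -> 0 <= b <= M ->
  `|a `^ p - b `^ p| <= p * M `^ (p - 1) * `|a - b|.
Proof.
wlog ba : a b / b <= a.
  move=> H aM bM; have [ba|/ltW ab] := leP b a; first exact: H.
  by rewrite distrC [X in _ * X]distrC; exact: H.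
move=> /andP[a0 aM] /andP[b0 bM].
have pB1 : 0 <= p - 1 by rewrite subr_ge0 ltW.
rewrite !ger0_norm ?subr_ge0//; last by rewrite ge0_ler_powR ?nnegrE ?(ltW p0).
apply: (le_trans (powRB_le b0 ba)); rewrite ler_wpM2r ?subr_ge0// ler_wpM2l ?(ltW p0)//.
by rewrite ge0_ler_powR ?nnegrE// (le_trans a0).
Qed.

Definition quotient_energy h : R := fine (powint p (tdiff h f)) / enorm h `^ p.
Definition gradient_energy h : R :=
  fine (powint p (fun x => dot h (Df x))) / enorm h `^ p.
Local Notation phi := quotient_energy.
Local Notation psi := gradient_energy.

Lemma fine_powintE (F : 'rV[R]_N -> R) h : Lp p F ->
  fine (powint p F) / enorm h `^ p = (pnorm p F / enorm h) `^ p.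
Proof.
move=> LF; rewrite (powint_pnorm p1 LF) /= powRM ?invr_ge0 ?enorm_ge0 ?pnorm_ge0//.
congr (_ * _); rewrite -[(enorm h)^-1]powR_inv1 ?enorm_ge0// -powRrM mulN1r.
by rewrite powRN.
Qed.

Let Ld h : Lp p (tdiff h f). Proof. exact: Lp_tdiff. Qed.
Let Lgr h : Lp p (fun x => dot h (Df x)). Proof. exact: Lp_gradient. Qed.

Lemma quotient_energy_ge0 h : 0 <= phi h.
Proof. by rewrite /phi (fine_powintE h (Ld h)) powR_ge0. Qed.

Lemma gradient_energy_ge0 h : 0 <= psi h.
Proof. by rewrite /psi (fine_powintE h (Lgr h)) powR_ge0. Qed.

Let B : R := \sum_i pnorm p (g i).

Let B0 : 0 <= B. Proof. by apply: sumr_ge0 => i _; exact: pnorm_ge0. Qed.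

Lemma pnorm_gradient_le h : pnorm p (fun x => dot h (Df x)) / enorm h <= B.
Proof.
have [->|h0] := eqVneq h 0; first by rewrite enorm0 invr0 mulr0.
rewrite ler_pdivrMr ?enorm_gt0// /dot.
apply: (le_trans (pnorm_sum p1 (index_enum 'I_N) (fun i => LpZ (h ord0 i) (Lg i)))).
rewrite /B mulr_suml; apply: ler_sum => i _; rewrite (pnormZ p1 _ (Lg i)) mulrC.
by apply: ler_wpM2l; [exact: pnorm_ge0|exact: coor_le_enorm].
Qed.

Lemma gradient_energy_le h : psi h <= B `^ p.
Proof.
rewrite /psi (fine_powintE h (Lgr h)) ge0_ler_powR ?nnegrE ?(ltW p0)//; last exact: pnorm_gradient_le.
by rewrite divr_ge0 ?enorm_ge0 ?pnorm_ge0.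
Qed.

(** The two L^p norms differ by at most the norm of the remainder divided by
    |h|; on a bounded range of values the p-th power is Lipschitz. *)
Lemma quotient_energy_near (w : R) : 0 < w -> exists2 d : R, 0 < d &
  forall h, enorm h <= d -> `|phi h - psi h| <= w.
Proof.
move=> w0; pose M := B + 1; have M0 : 0 < M by rewrite ltr_wpDl.
pose k := p * M `^ (p - 1); have k0 : 0 < k by rewrite mulr_gt0 ?powR_gt0.
pose e := Num.min 1 (w / k).
have e0 : 0 < e by rewrite lt_min ltr01 divr_gt0.
have [d d0 Hd] := pnorm_remainder p1 Lf Lg wfg e0; exists d => // h hd.
rewrite /phi /psi (fine_powintE h (Ld h)) (fine_powintE h (Lgr h)).
set a := pnorm p (tdiff h f) / enorm h; set b := pnorm p _ / enorm h.
have a0 : 0 <= a by rewrite divr_ge0 ?enorm_ge0 ?pnorm_ge0.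
have b0 : 0 <= b by rewrite divr_ge0 ?enorm_ge0 ?pnorm_ge0.
have bB : b <= B by exact: pnorm_gradient_le.
have ab : `|a - b| <= e.
  have [hE|h0] := eqVneq h 0.
    by rewrite /a /b hE enorm0 invr0 !mulr0 subrr normr0 ltW.
  have Lr := Lp_remainder p1 Lf Lg h.
  rewrite /a /b -mulrBl normrM (ger0_norm (_ : 0 <= (enorm h)^-1)) ?invr_ge0 ?enorm_ge0//.
  rewrite ler_pdivrMr ?enorm_gt0//; apply: le_trans (Hd h hd).
  rewrite ler_norml lerBlDr lerNl opprB lerBlDr; apply/andP; split.
    have := pnormB p1 (Ld h) Lr; rewrite addrC.
    congr (pnorm p _ <= _); apply/funext => x; rewrite /remainder /tdiff /=; ring.
  have := pnormD p1 Lr (Lgr h).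
  by congr (pnorm p _ <= _); apply/funext => x; rewrite /remainder /tdiff /=; ring.
have e1 : e <= 1 by rewrite ge_min lexx.
apply: (@le_trans _ _ (k * `|a - b|)).
  apply: powR_dist_le; rewrite ?a0 ?b0 /M/=; last by lra.
  by move: ab; rewrite ler_norml => /andP[_]; lra.
rewrite mulrC -ler_pdivlMr//; apply: (le_trans ab).
by rewrite ge_min lexx orbT.
Qed.

Lemma quotient_energy_far (d : R) : 0 < d -> exists2 C : R, 0 <= C &
  forall h, d < enorm h -> phi h <= C.
Proof.
move=> d0; exists ((2 * pnorm p f / d) `^ p) => [|h dh]; first exact: powR_ge0.
have h0 : 0 < enorm h := lt_trans d0 dh.
rewrite /phi (fine_powintE h (Ld h)) ge0_ler_powR ?nnegrE ?(ltW p0)//.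
- by rewrite divr_ge0 ?enorm_ge0 ?pnorm_ge0.
- by rewrite divr_ge0 ?(ltW d0)// mulr_ge0 ?pnorm_ge0.
apply: ler_pM; rewrite ?pnorm_ge0 ?invr_ge0 ?enorm_ge0//; last first.
  by rewrite lef_pV2 ?posrE// ltW.
have := pnormB p1 (Lp_translation h Lf) Lf.
by rewrite (pnorm_translation p1 h Lf) mulr_natl mulr2n.
Qed.

Local Open Scope ereal_scope.

Lemma measurable_powint_param (K : 'rV[R]_N -> 'rV[R]_N -> R) :
  measurable_fun setT (fun z : 'rV[R]_N * 'rV[R]_N => K z.1 z.2) ->
  measurable_fun setT (fun h => fine (powint p (K ^~ h)) / enorm h `^ p)%R.
Proof.
move=> mK; apply: measurable_funM.
  apply: measurableT_comp => //.
  apply: (measurable_fun_fubini_tonelli_G (m1 := leb)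
    (fun z : 'rV[R]_N * 'rV[R]_N => (`|K z.1 z.2| `^ p)%:E)).
    exact: measurable_powabs.
  by move=> z; rewrite lee_fin powR_ge0.
under eq_fun do rewrite -powRN.
exact: measurableT_comp (measurable_powR (- p)) measurable_enorm.
Qed.

Let mDf : measurable_fun setT Df.
Proof. by apply/measurable_fun_rVP => i; have [] := Lg i. Qed.

Lemma measurable_quotient_energy : measurable_fun setT phi.
Proof.
have [mf _] := Lf.
apply: (measurable_powint_param (K := fun x h => (f (x + h) - f x)%R)).
apply: measurable_funB; last exact: measurableT_comp mf measurable_fst.
by apply: (measurableT_comp mf); apply: measurable_rVD; [exact: measurable_fst|exact: measurable_snd].
Qed.

Lemma measurable_gradient_energy : measurable_fun setT psi.
Proof.
apply: (measurable_powint_param (K := fun x h => dot h (Df x))).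
by apply: measurable_dot; [exact: measurable_snd|exact: measurableT_comp mDf measurable_fst].
Qed.

Lemma gradient_energyE h : (psi h)%:E = \int[leb]_x (dirker p (Df x) h)%:E.
Proof.
have [mF Foo] := Lgr h.
rewrite /psi EFinM fineK ?ge0_fin_numE ?powint_ge0// muleC /powint.
rewrite -ge0_integralZl//.
- by apply: eq_integral => x _; rewrite -EFinM /dirker dotC mulrC.
- exact: measurable_powabs.
- by rewrite lee_fin invr_ge0 powR_ge0.
Qed.

Lemma gradient_energy_homogeneous (a : R) h : (0 < a)%R -> psi (a *: h) = psi h.
Proof.
move=> a0; apply: EFin_inj; rewrite !gradient_energyE.
by apply: eq_integral => x _; rewrite dirkerZr// gt_eqF.
Qed.

Lemma gradient_energy_ball_lty : \int[leb]_(h in ball0 1) (psi h)%:E < +oo.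
Proof.
apply: (@le_lt_trans _ _ (\int[leb]_(h in ball0 1) (B `^ p)%:E)).
  apply: ge0_le_integral => //.
  - exact: measurable_ball0.
  - by move=> h _; rewrite lee_fin gradient_energy_ge0.
  - by apply/measurable_funTS/measurable_EFinP; exact: measurable_gradient_energy.
  - by move=> h _; rewrite lee_fin gradient_energy_le.
rewrite integral_cst; last exact: measurable_ball0.
by rewrite lte_mul_pinfty ?lee_fin ?powR_ge0//; exact: lebesgue_ball_lty.
Qed.

(** Exchanging the integrals, the inner one over the ball is [dirker_mass p
    (Df x)], which is |Df x|^p times the mass of a unit vector. *)
Lemma gradient_energy_ball (w : 'rV[R]_N) : enorm w = 1%R ->
  \int[leb]_(h in ball0 1) (psi h)%:E =
  dirker_mass p w * powint p (fun x => enorm (Df x)).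
Proof.
move=> w1.
pose K (z : 'rV[R]_N * 'rV[R]_N) : \bar R := (dirker p (Df z.1) z.2 * \1_(ball0 1) z.2)%:E.
have mK : measurable_fun setT K.
  apply/measurable_EFinP; apply: measurable_funM.
    by apply: measurable_dirker; [exact: measurableT_comp mDf measurable_fst|exact: measurable_snd].
  have mB : measurable_fun setT (\1_(ball0 1) : 'rV[R]_N -> R).
    by apply: measurable_indic; exact: measurable_ball0.
  exact: measurableT_comp mB measurable_snd.
have K0 z : 0 <= K z by rewrite lee_fin mulr_ge0 ?dirker_ge0// indicE.
transitivity (\int[leb]_h \int[leb]_x K (x, h)).
  rewrite integral_mkcond; apply: eq_integral => h _; rewrite patchE /K /= indicE.
  case: (h \in _).
    by rewrite gradient_energyE; apply: eq_integral => x _; rewrite mulr1.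
  by under eq_integral do rewrite mulr0; rewrite integral0.
rewrite -(@fubini_tonelli _ _ _ _ R leb leb K mK K0).
transitivity (\int[leb]_x (dirker_mass p w * (`|enorm (Df x)| `^ p)%:E)).
  apply: eq_integral => x _; rewrite muleC ger0_norm ?enorm_ge0// -(dirker_massZ p0 (Df x) w1).
  rewrite /dirker_mass [RHS]integral_mkcond; apply: eq_integral => h _.
  by rewrite patchE /K /= indicE; case: ifP; rewrite ?mulr1 ?mulr0.
rewrite ge0_integralZl//; last first.
  by apply: integral_ge0 => x _; rewrite lee_fin dirker_ge0.
by apply: measurable_powabs; exact: measurable_enorm_comp.
Qed.

End difference_quotients.

(** * The nonlocal energy *)

Section energy.
Context {R : realType} {N : nat}.
Local Notation leb := (@lebesgue_rV R N).
Local Open Scope ereal_scope.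

(** Substitute x = y + h in the inner integral, then integrate in y first. *)
Lemma nonlocal_energyE (p : R) (rho : 'rV[R]_N -> 'rV[R]_N -> R) (rhot : R -> R) f :
  (1 < p)%R -> Lp p f -> (forall x y, rho x y = rhot (enorm (x - y))) ->
  (forall r, (0 <= r)%R -> (0 <= rhot r)%R) ->
  measurable_fun setT (fun h : 'rV[R]_N => rhot (enorm h)) ->
  nonlocal_energy p rho f =
  \int[leb]_h (rhot (enorm h) * quotient_energy p f h)%:E.
Proof.
move=> p1 Lf rhoE rhot0 mrhot; have [mf foo] := Lf.
pose K (z : 'rV[R]_N * 'rV[R]_N) : \bar R :=
  (`|f (z.1 + z.2) - f z.1| `^ p / enorm z.2 `^ p * rhot (enorm z.2))%:E.
have mdf : measurable_fun setT (fun z : 'rV[R]_N * 'rV[R]_N => f (z.1 + z.2) - f z.1)%R.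
  apply: measurable_funB; last exact: measurableT_comp mf measurable_fst.
  by apply: (measurableT_comp mf); apply: measurable_rVD; [exact: measurable_fst|exact: measurable_snd].
have mK : measurable_fun setT K.
  apply/measurable_EFinP; apply: measurable_funM; last exact: measurableT_comp mrhot measurable_snd.
  apply: measurable_funM; first by apply/measurable_EFinP; exact: measurable_powabs.
  under eq_fun do rewrite -powRN.
  apply: (measurableT_comp (measurable_powR (- p))).
  by apply: measurable_enorm_comp; exact: measurable_snd.
have K0 z : 0 <= K z by rewrite lee_fin mulr_ge0 ?rhot0 ?enorm_ge0// divr_ge0 ?powR_ge0.
transitivity (\int[leb]_y \int[leb]_h K (y, h)).
  apply: eq_integral => y _.
  have mKy : measurable_fun setT (fun x : 'rV[R]_N => K (y, x - y)%R).
    apply: (measurableT_comp (f := fun h => K (y, h))); last exact: (measurable_addrV (- y)).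
    exact: (measurableT_comp mK (measurable_pair1 y)).
  rewrite -(ge0_integral_translation (- y)%R (f := fun h => K (y, h)))//.
  - by apply: eq_integral => x _; rewrite /K /= [(y + _)%R]addrC subrK rhoE.
  - exact: (measurableT_comp mK (measurable_pair1 y)).
rewrite (@fubini_tonelli _ _ _ _ R leb leb K mK K0).
apply: eq_integral => h _.
have c0 : (0 <= rhot (enorm h) / enorm h `^ p)%R by rewrite divr_ge0 ?powR_ge0 ?rhot0 ?enorm_ge0.
have LT := Lp_tdiff p1 h Lf.
have fT : powint p (tdiff h f) \is a fin_num.
  by rewrite ge0_fin_numE; [exact: LT.2|exact: powint_ge0].
transitivity ((rhot (enorm h) / enorm h `^ p)%:E * powint p (tdiff h f)); last first.
  by rewrite -(fineK fT) -EFinM /quotient_energy mulrAC mulrA.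
rewrite /powint -ge0_integralZl//; last by apply: measurable_powabs; exact: LT.1.
by apply: eq_integral => x _; rewrite -EFinM /K /tdiff /=; congr (_%:E); ring.
Qed.

End energy.

Lemma measurable_radial_profile (R : realType) (N : nat) rho rhot (n : nat) :
  @mollifiers R N rho rhot -> measurable_fun setT (fun h : 'rV[R]_N => rhot n (enorm h)).
Proof.
move=> mol.
have -> : (fun h : 'rV[R]_N => rhot n (enorm h)) =
    (fun r : R => rhot n (Num.max r 0)) \o @enorm R N.
  by apply/funext => h; rewrite /= max_l// enorm_ge0.
exact: measurableT_comp (measurable_profile n mol) measurable_enorm.
Qed.

(** * The limit of the nonlocal energies *)

Theorem proposition4p3 (R : realType) (N : nat) (p : R)
    (rho : nat -> 'rV[R]_N -> 'rV[R]_N -> R) (rhot : nat -> R -> R)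
    (f : 'rV[R]_N -> R) (Df : 'rV[R]_N -> 'rV[R]_N) :
  (1 <= N)%N -> 1 < p ->
  mollifiers rho rhot ->
  sobolev_W1p p f Df ->
  [/\ lebesgue_rV N unit_ball = (pi `^ (N%:R / 2) / Gamma (N%:R / 2 + 1))%:E :> \bar R,
      forall w w' : 'rV[R]_N, unit_sphere w -> unit_sphere w' ->
        K_const p w = K_const p w'
    & forall w : 'rV[R]_N, unit_sphere w ->
        nonlocal_energy p (rho n) f @[n --> \oo] -->
        (K_const p w * 'N[lebesgue_rV N]_p%:E[EFin \o enorm \o Df] `^ p)%E].
Proof.
case: N rho f Df => [//|m] rho f Df _ p1 mol Sf.
have p0 : 0 < p := lt_trans ltr01 p1.
split.
- exact: lebesgue_unit_ball.
- by move=> w w' w1 w'1; rewrite (K_constE p0 w1) (K_constE p0 w'1); exact: (dirker_mass_unit p w1 w'1).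
move=> w w1; have [Lpf Lpg] := Sf.
have Lf : Lp p f := LfunP_powint p0 Lpf.
have Lg i : Lp p (fun x => Df x ord0 i) := LfunP_powint p0 (Lpg i).1.
have wfg i := (Lpg i).2.
have -> : (K_const p w * 'N[lebesgue_rV m.+1]_p%:E[EFin \o enorm \o Df] `^ p =
    \int[lebesgue_rV m.+1]_(h in ball0 1) (gradient_energy p Df h)%:E)%E.
  by rewrite (gradient_energy_ball p1 Lg w1) (K_constE p0 w1) (powint_Lnorm p1).
have -> : (fun n => nonlocal_energy p (rho n) f) =
    (fun n => \int[lebesgue_rV m.+1]_h (rhot n (enorm h) * quotient_energy p f h)%:E)%E.
  apply/funext => n; apply: nonlocal_energyE => //.
  - by move=> x y; exact: mollifier_radial mol n x y.
  - exact: mollifier_profile_ge0 mol n.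
  - exact: measurable_radial_profile mol.
apply: (radial_limit mol (ltn0Sn m)).
- exact: measurable_quotient_energy Lf.
- exact: measurable_gradient_energy Lg.
- exact: quotient_energy_ge0 p1 Lf.
- exact: gradient_energy_ge0 p1 Lg.
- exact: gradient_energy_homogeneous p1 Lg.
- exact: gradient_energy_ball_lty p1 Lg.
- exact: quotient_energy_near p1 Lf Lg wfg.
- exact: quotient_energy_far p1 Lf.
Qed.
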